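(* Consider the relaxed assortment and fulfillment problem described in the context, with an arbitrary choice model $\phi$ satisfying the stated assumptions, arbitrary (possibly non-stationary) arrival probabilities $\lambda_{jt}$, and a fixed nonzero inventory placement $\boldsymbol c=(c_i^\ell)\in\mathbb Z_+^{nL}$. Let $c_{\min}=\min\{c_i^\ell : i\in\mathcal N,\ \ell\in\mathcal L,\ c_i^\ell>0\}$. Then one can compute in polynomial time a (randomized) assortment and fulfillment policy whose expected total profit starting from inventory $\boldsymbol c$ is at least $$\max\left\{0.322,\ 1-\frac{m+1}{\sqrt{c_{\min}}}\right\}\cdot J_1^*(\boldsymbol c).$$
   Context: Setting. Products $\mathcal N=\{1,\dots,n\}$, customer types $\mathcal M=\{1,\dots,m\}$, warehouses $\mathcal L=\{1,\dots,L\}$, time periods $\mathcal T=\{1,\dots,T\}$. In each period $t$ at most one customer arrives; a type-$j$ customer arrives with probability $\lambda_{jt}\ge 0$ (with $\sum_{j}\lambda_{jt}\le 1$), independently across periods. If a type-$j$ customer is offered the assortment $S\subseteq\mathcal N$, she chooses product $i$ with probability $\phi_{ij}(S)$ and nothing with probability $1-\sum_{i}\phi_{ij}(S)\geq 0$; choices are independent across periods. Assumptions on $\phi$: $\phi_{kj}(S)=0$ if $k\notin S$; weak substitutability: $\phi_{ij}(S\cup\{k\})\le\phi_{ij}(S)$ for all $S$, $i\in S$, $k\notin S$. Serving product $i$ to a type-$j$ customer from warehouse $\ell$ gives profit $r_{ij}^\ell\in\mathbb R$ (possibly negative). Relaxed problem. A virtual warehouse $L+1$ with infinite stock of each product and profits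 $r_{ij}^{L+1}=0$ is added; $\mathcal L_+=\mathcal L\cup\{L+1\}$. Start with inventory $c_i^\ell$ of product $i$ at warehouse $\ell\in\mathcal L$. On the arrival of a type-$j$ customer in period $t$, the policy (knowing the type, the period and the history/current inventory $\boldsymbol x$, and possibly randomizing) offers an assortment $S\subseteq\mathcal N$ and decides, for each $i\in S$, a warehouse $f(i)\in\mathcal L_+$ from which $i$ is served if chosen, where $f(i)\in\mathcal L$ is allowed only if $x_i^{f(i)}>0$. If product $i$ is chosen, the profit $r_{ij}^{f(i)}$ is earned and, when $f(i)\in\mathcal L$, the stock $x_i^{f(i)}$ decreases by one. $J_1^*(\boldsymbol c)$ denotes the maximum expected total profit over the $T$ periods among all such policies. Computational model. There is a polynomial-time oracle which, given a customer type $j$ and per-product rewards $(\rho_i)_{i\in\mathcal N}$, returns $S\subseteq\mathcal N$ maximizing $\sum_{i\in S}\rho_i\phi_{ij}(S)$. Polynomial time is with respect to the input size (including $n,m,L,T$).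
   Formalization: The arrival probabilities, choice probabilities and profits are taken rational so that input size is defined, and the algorithm may also query the choice probabilities φ_ij(S) of an assortment, since answers of the maximizing oracle alone do not determine φ. *)

(* Defs.v *)
From HB Require Import structures.
From mathcomp Require Import all_boot all_order all_algebra.
From mathcomp Require Import all_classical all_reals.

Set Implicit Arguments.
Unset Strict Implicit.
Unset Printing Implicit Defensive.

Import Order.TTheory GRing.Theory Num.Theory.

Local Open Scope ring_scope.

(* The numerical data are rational, since they are handed to an algorithm.
   Indices run from 0: product i, customer type j, warehouse l, period t. *)
Record market := Market {
  nprod : nat;
  ntype : nat;
  nware : nat;
  nper  : nat;
  arr : 'I_ntype -> 'I_nper -> rat;
  phi : 'I_ntype -> {set 'I_nprod} -> 'I_nprod -> rat;
  profit : 'I_nprod -> 'I_ntype -> 'I_nware -> rat }.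

Definition placement (I : market) := 'I_(nprod I) -> 'I_(nware I) -> nat.

Definition valid_market (I : market) : Prop :=
  [/\ (forall (j : 'I_(ntype I)) t, 0 <= arr j t),
      (forall t : 'I_(nper I), \sum_j arr j t <= 1),
      (forall (j : 'I_(ntype I)) S i, 0 <= phi j S i),
      (forall (j : 'I_(ntype I)) S, \sum_i phi j S i <= 1) &
      (forall (j : 'I_(ntype I)) (S : {set 'I_(nprod I)}) k,
         k \notin S -> phi j S k = 0) /\
      (forall (j : 'I_(ntype I)) (S : {set 'I_(nprod I)}) i k,
         i \in S -> k \notin S -> phi j (k |: S) i <= phi j S i)].

(* An assortment S and a warehouse for every product: [Some l] is a real
   warehouse, [None] the virtual one.  Values of the map outside S are never
   used. *)
Definition decision (I : market) : finType :=
  ({set 'I_(nprod I)} * {ffun 'I_(nprod I) -> option 'I_(nware I)})%type.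

(* What happens in one period: [None] if nobody arrives, otherwise the type of
   the customer, the decision taken, and her choice ([None]: no purchase). *)
Definition event (I : market) : finType :=
  option ('I_(ntype I) * decision I * option 'I_(nprod I)).

Definition served (I : market) (i : 'I_(nprod I)) (l : 'I_(nware I))
    (e : event I) : bool :=
  if e is Some (_, d, Some k) then (k == i) && (d.2 k == Some l) else false.

Definition event_profit (I : market) (e : event I) : rat :=
  if e is Some (j, d, Some i)
  then (if d.2 i is Some l then profit i j l else 0)
  else 0.

Definition stock (I : market) (c : placement I) (h : seq (event I)) :
  placement I := fun i l => (c i l - count (served i l) h)%N.

(* The default value \sum c is at least every entry, so this is the least
   positive entry as soon as there is one. *)
Definition cmin (I : market) (c : placement I) : nat :=
  (\big[minn/(\sum_i \sum_l c i l)]_(p : 'I_(nprod I) * 'I_(nware I)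
                                     | 0 < c p.1 p.2) c p.1 p.2)%N.

Section Policies.
Variables (R : realType) (I : market).

(* [pi t h j d]: probability of the decision d for a customer of type j who
   arrives in period t after the history h of the periods before t; only
   histories of length t matter. *)
Definition policy :=
  'I_(nper I) -> seq (event I) -> 'I_(ntype I) -> decision I -> R.

Definition admissible (c : placement I) (pi : policy) : Prop :=
  forall (t : 'I_(nper I)) (h : seq (event I)) (j : 'I_(ntype I)),
  size h = t ->
  [/\ (forall d, 0 <= pi t h j d),
      \sum_d pi t h j d = 1 &
      (forall d, pi t h j d != 0 -> forall i l,
         i \in d.1 -> d.2 i = Some l -> (0 < stock c h i l)%N)].

Definition event_prob (pi : policy) (t : 'I_(nper I)) (h : seq (event I))
    (e : event I) : R :=
  match e with
  | None => ratr (1 - \sum_j arr j t)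
  | Some (j, d, None) =>
      ratr (arr j t) * pi t h j d * ratr (1 - \sum_i phi j d.1 i)
  | Some (j, d, Some i) =>
      ratr (arr j t) * pi t h j d * ratr (phi j d.1 i)
  end.

Definition expected_profit (pi : policy) : R :=
  \sum_(w : (nper I).-tuple (event I))
    (\prod_(t < nper I) event_prob pi t (take t w) (tnth w t))
    * (\sum_(t < nper I) ratr (event_profit (tnth w t))).

Definition J1star (c : placement I) : R :=
  sup [set v | exists2 pi, admissible c pi & v = expected_profit pi]%classic.

End Policies.

Inductive data := Leaf of rat | Node of data & data.

Definition nbits (k : nat) : nat := (trunc_log 2 k).+1.

Definition qbits (q : rat) : nat := (nbits `|numq q| + nbits `|denq q|)%N.

Fixpoint dsize (d : data) : nat :=
  match d with
  | Leaf q => qbits q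
  | Node a b => (dsize a + dsize b).+1
  end.

Inductive unop := Fst | Snd | IsNode | Numer | Denom | Floor.
Inductive binop := Cons | Add | Sub | Mul | Div | Leq.

Inductive expr :=
  | Var of nat
  | Cst of rat
  | Un of unop & expr
  | Bin of binop & expr & expr.

Definition eval_unop (o : unop) (a : data) : data :=
  match o, a with
  | Fst, Node x _ => x
  | Snd, Node _ y => y
  | IsNode, Node _ _ => Leaf 1
  | Numer, Leaf q => Leaf (numq q)%:~R
  | Denom, Leaf q => Leaf (denq q)%:~R
  | Floor, Leaf q => Leaf (Num.floor q)%:~R
  | _, _ => Leaf 0
  end.

Definition eval_binop (o : binop) (a b : data) : data :=
  match o, a, b with
  | Cons, _, _ => Node a b
  | Add, Leaf p, Leaf q => Leaf (p + q)
  | Sub, Leaf p, Leaf q => Leaf (p - q)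
  | Mul, Leaf p, Leaf q => Leaf (p * q)
  | Div, Leaf p, Leaf q => Leaf (p / q)
  | Leq, Leaf p, Leaf q => Leaf (p <= q)%R%:R
  | _, _, _ => Leaf 0
  end.

Definition store := nat -> data.

Definition update (s : store) (x : nat) (d : data) : store :=
  fun y => if y == x then d else s y.

Fixpoint eval (s : store) (e : expr) : data :=
  match e with
  | Var x => s x
  | Cst q => Leaf q
  | Un o a => eval_unop o (eval s a)
  | Bin o a b => eval_binop o (eval s a) (eval s b)
  end.

(* The sizes of all intermediate values, so that the cost is polynomially
   related to the running time of a Turing machine. *)
Fixpoint eval_cost (s : store) (e : expr) : nat :=
  (dsize (eval s e) +
   match e with
   | Un _ a => eval_cost s a
   | Bin _ a b => eval_cost s a + eval_cost s b
   | _ => 0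
   end)%N.

Definition truthy (d : data) : bool := if d is Leaf q then q != 0 else true.

Inductive cmd :=
  | Assign of nat & expr
  | Ask of nat & expr
  | Seq of cmd & cmd
  | If of expr & cmd & cmd
  | While of expr & cmd.

(* [exec O p s k s']: with the oracle O, the program p started in s stops in s'
   at cost k.  An oracle call is charged the size of its query and answer. *)
Inductive exec (O : data -> data) : cmd -> store -> nat -> store -> Prop :=
  | ExecAssign x e s :
      exec O (Assign x e) s (eval_cost s e) (update s x (eval s e))
  | ExecAsk x e s :
      exec O (Ask x e) s (eval_cost s e + dsize (O (eval s e)))
        (update s x (O (eval s e)))
  | ExecSeq p q s1 s2 s3 k1 k2 :
      exec O p s1 k1 s2 -> exec O q s2 k2 s3 ->
      exec O (Seq p q) s1 (k1 + k2) s3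
  | ExecIf e p q s k s' :
      exec O (if truthy (eval s e) then p else q) s k s' ->
      exec O (If e p q) s (eval_cost s e + k) s'
  | ExecWhileStop e p s :
      ~~ truthy (eval s e) ->
      exec O (While e p) s (eval_cost s e) s
  | ExecWhileStep e p s1 s2 s3 k1 k2 :
      truthy (eval s1 e) ->
      exec O p s1 k1 s2 -> exec O (While e p) s2 k2 s3 ->
      exec O (While e p) s1 (eval_cost s1 e + k1 + k2) s3.

(* Input and output in variable 0; the other variables start at 0. *)
Definition returns_within (O : data -> data) (p : cmd) (input : data)
    (bound : nat) (output : data) : Prop :=
  exists k s, [/\ exec O p (update (fun=> Leaf 0) 0 input) k s,
                  (k <= bound)%N & s 0 = output].

Definition enc_nat (k : nat) : data := Leaf k%:R.

Definition enc_seq (s : seq data) : data := foldr Node (Leaf 0) s.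

Definition enc_fun (k : nat) (F : 'I_k -> data) : data :=
  enc_seq [seq F i | i <- enum 'I_k].

Definition enc_set (k : nat) (S : {set 'I_k}) : data :=
  enc_fun (fun i => Leaf (i \in S)%:R).

Definition enc_opt (k : nat) (x : option 'I_k) : data :=
  if x is Some i then Node (enc_nat i) (Leaf 0) else Leaf 0.

Definition enc_decision (I : market) (d : decision I) : data :=
  Node (enc_set d.1) (enc_fun (fun i => enc_opt (d.2 i))).

Definition enc_event (I : market) (e : event I) : data :=
  if e is Some (j, d, x)
  then Node (enc_nat j) (Node (enc_decision d) (enc_opt x))
  else Leaf 0.

Definition enc_placement (I : market) (c : placement I) : data :=
  enc_fun (fun i => enc_fun (fun l => enc_nat (c i l))).

(* The choice model has 2 ^ n assortments; it is not listed but accessed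
   through the oracle. *)
Definition enc_instance (I : market) (c : placement I) : data :=
  enc_seq [:: enc_nat (nprod I); enc_nat (ntype I); enc_nat (nware I);
              enc_nat (nper I);
              enc_fun (fun j : 'I_(ntype I) => enc_fun (fun t => Leaf (arr j t)));
              enc_fun (fun i : 'I_(nprod I) => enc_fun (fun j => enc_fun (fun l =>
                Leaf (profit i j l))));
              enc_placement c].

(* The dimensions count in unary, and so do the bits of the choice
   probabilities that the oracle returns. *)
Definition input_size (I : market) (c : placement I) : nat :=
  (dsize (enc_instance c) + nprod I + ntype I + nware I + nper I
   + \max_(j < ntype I) \max_S \max_i qbits (phi j S i))%N.

(* Two kinds of queries: an optimal assortment for a customer type and
   rewards rho, and the choice probabilities of an assortment. *)
Definition choice_oracle (I : market) (O : data -> data) : Prop :=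
  (forall (j : 'I_(ntype I)) (rho : 'I_(nprod I) -> rat),
     exists S : {set 'I_(nprod I)},
       O (Node (Leaf 0) (Node (enc_nat j) (enc_fun (fun i => Leaf (rho i)))))
         = enc_set S
       /\ forall S' : {set 'I_(nprod I)},
            \sum_(i in S') rho i * phi j S' i
              <= \sum_(i in S) rho i * phi j S i) /\
  (forall (j : 'I_(ntype I)) (S : {set 'I_(nprod I)}),
     O (Node (Leaf 1) (Node (enc_nat j) (enc_set S)))
       = enc_fun (fun i => Leaf (phi j S i))).

Definition enc_state (I : market) (c : placement I) (t : 'I_(nper I))
    (h : seq (event I)) (j : 'I_(ntype I)) : data :=
  enc_seq [:: enc_instance c; enc_nat t; enc_nat j; enc_placement (stock c h);
              enc_seq [seq enc_event e | e <- h]].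

(* In every state, the program [range] returns some Q > 0; a seed u is then
   drawn uniformly from {0, ..., Q - 1}, and the program [act] turns the state
   and u into the decision.  The range Q may have polynomially many bits, so
   this covers any polynomial number of draws of rational biases, and
   exponentially large supports. *)
Definition computes_policy (R : realType) (I : market) (c : placement I)
    (O : data -> data) (range act : cmd) (bound : nat) (pi : policy R I) :
    Prop :=
  forall (t : 'I_(nper I)) (h : seq (event I)) (j : 'I_(ntype I)),
  size h = t ->
  exists (Q : nat) (g : 'I_Q -> decision I),
    [/\ (0 < Q)%N,
        returns_within O range (enc_state c t h j) bound (enc_nat Q),
        (forall u : 'I_Q,
           returns_within O act (Node (enc_state c t h j) (enc_nat u))
             bound (enc_decision (g u))) &
        (forall d, pi t h j d = #|[pred u | g u == d]|%:R / Q%:R)].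

(* Main.v *)
Require Import Defs.
From mathcomp Require Import all_boot all_order all_algebra.
From mathcomp Require Import all_classical all_reals.
From mathcomp Require Import ring lra zify.
Set Implicit Arguments.
Unset Strict Implicit.
Unset Printing Implicit Defensive.
Import Order.TTheory GRing.Theory Num.Theory.
Local Open Scope ring_scope.

(* Put a price [theta_il >= 0] on every unit of stock and let [D theta] be the
   Lagrangian dual of the fluid relaxation: evaluating it, with a best response,
   takes one oracle call per customer type.  A potential argument along histories
   gives [J* <= D theta] for all prices.

   A projected subgradient method on the prices, started at [0], averages its
   best responses into a fluid plan whose revenue, minus a penalty for
   overloading the stock, is at least [(1 - 1/(7T)) min D].  A resource with
   [c_il >= T] cannot run out and keeps the price [0], so nothing is lost at all
   when [c_min >= T]; otherwise [1/T <= 1/sqrt c_min], which the slack between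
   [1/sqrt c_min] and [(m+1)/sqrt c_min] absorbs.  This replaces an exact LP
   solver.

   The policy is deterministic: it is greedy for the separable value function
   [sum_il R_il * h (x_il, M_il)], where [R] and [M] are the revenue and the load
   that the plan still assigns to the resource and [h (x, M)] is one minus the
   Erlang loss probability.  Since [h] decreases in the load at rate
   [h (x, M) * (h (x, M) - h (x-1, M))] and [1/h] is convex in the load, this is a
   subsolution of the Bellman equation, so the policy earns at least its initial
   value.  The loss [z = 1 - h (c, c)] satisfies [c z^2 + z <= 1], whence
   [h (c, c) >= 0.38] and [h (c, c) >= 1 - 1/sqrt c].

   Programs are obtained from closure properties of polynomial-time
   computability.  Loops are harmless because every accumulator grows by a
   polynomial number of bits per round. *)

(** * Bit sizes of rationals *)

(** The constants leave room for the solver. At [c = 1] the inequality for [z] gives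
    [h >= (3 - sqrt 5) / 2 = 0.3819...], rounded to 0.38. The solver costs the factor [1 - 1/(7T)],
    at least 6/7, and 0.38 times 6/7 still exceeds 0.322; this fixes the 7. In the other branch the
    Erlang loss and the solver error are each at most [1/sqrt c_min]. Together they need
    [m + 1 >= 2], so a market without customer types is treated apart.

    Two quantities may be exponential: the number of assortments and the values [c_il]. The former
    are met only through best responses. The cutoff [c_il >= T] handles the latter, because it keeps
    the Erlang recursion shorter than the horizon.

    The regret of the price iteration is additive, in units of the value at price 0. That value is
    at most [T] times any dual value, which turns the regret into a relative error. The averaged
    plan may still overload a resource. The Erlang value then drops by at most a linear amount, and
    a penalty whose rate is the whole value at price 0 dominates this drop. *)

Lemma leq_nbits a b : (a <= b)%N -> (nbits a <= nbits b)%N.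
Proof. by move=> ab; rewrite ltnS leq_trunc_log. Qed.

Lemma nbits_leqP a d : (0 < d)%N -> (nbits a <= d)%N = (a < 2 ^ d)%N.
Proof.
case: d => // d _; rewrite /nbits ltnS.
case: a => [|a]; first by rewrite trunc_log0 leq0n expn_gt0.
apply/idP/idP => [h|h].
  by apply: (leq_trans (trunc_log_ltn _ (isT : 1 < 2)%N)); rewrite leq_exp2l.
rewrite leqNgt; apply/negP => dl.
have := trunc_logP (isT : 1 < 2)%N (ltn0Sn a).
by rewrite leqNgt (leq_trans h) // leq_exp2l.
Qed.

Lemma ltn_nbits a : (a < 2 ^ nbits a)%N.
Proof. by rewrite -nbits_leqP. Qed.

Lemma nbits_le a : (nbits a <= a.+1)%N.
Proof. by rewrite nbits_leqP // (ltn_trans (ltnSn a)) // ltn_expl. Qed.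

Lemma nbitsM a b : (nbits (a * b) <= nbits a + nbits b)%N.
Proof.
rewrite nbits_leqP // expnD.
case: a => [|a]; first by rewrite mul0n muln_gt0 !expn_gt0.
by rewrite ltn_mul // ltn_nbits.
Qed.

Lemma nbitsD a b : (nbits (a + b) <= (maxn (nbits a) (nbits b)).+1)%N.
Proof.
rewrite nbits_leqP // expnS mul2n -addnn.
have h x : (nbits x <= maxn (nbits a) (nbits b) -> x < 2 ^ maxn (nbits a) (nbits b))%N.
  by rewrite nbits_leqP // leq_max.
have := h a (leq_maxl _ _); have := h b (leq_maxr _ _); lia.
Qed.

(* Unlike [qbits], subadditive up to a constant under sums. *)
Definition mbits (q : rat) : nat := maxn (nbits `|numq q|) (nbits `|denq q|).

Lemma qbits_mbits q : (qbits q <= mbits q + mbits q)%N.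
Proof. by rewrite leq_add // leq_max leqnn ?orbT. Qed.

Lemma mbits_qbits q : (mbits q <= qbits q)%N.
Proof. by rewrite geq_max leq_addr leq_addl. Qed.

(** Reduction to lowest terms divides both parts by a common factor, so any representation of a
    number as a fraction bounds its size. *)
Lemma mbits_frac (n d : int) k : d != 0 ->
  (nbits `|n| <= k)%N -> (nbits `|d| <= k)%N -> (mbits (n%:~R / d%:~R) <= k)%N.
Proof.
rewrite /mbits; case: divqP => [//|e x e0 _]; rewrite !abszM => hn hd.
have e1 : (0 < `|e|)%N by rewrite absz_gt0.
rewrite geq_max; apply/andP; split.
  by apply: leq_trans hn; apply: leq_nbits; rewrite leq_pmull.
by apply: leq_trans hd; apply: leq_nbits; rewrite leq_pmull.
Qed.

Lemma nbits_num q : (nbits `|numq q| <= mbits q)%N.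
Proof. by rewrite leq_max leqnn. Qed.

Lemma nbits_den q : (nbits `|denq q| <= mbits q)%N.
Proof. by rewrite leq_max leqnn orbT. Qed.

Lemma mbitsM p q : (mbits (p * q) <= mbits p + mbits q)%N.
Proof.
rewrite -[p]divq_num_den -[q]divq_num_den mulf_div -!intrM !divq_num_den.
apply: mbits_frac; first by rewrite mulf_neq0 ?denq_neq0.
  by rewrite abszM (leq_trans (nbitsM _ _)) // leq_add // nbits_num.
by rewrite abszM (leq_trans (nbitsM _ _)) // leq_add // nbits_den.
Qed.

Lemma mbitsD p q : (mbits (p + q) <= (mbits p + mbits q).+1)%N.
Proof.
rewrite -[p]divq_num_den -[q]divq_num_den addf_div ?intr_eq0 ?denq_neq0 //.
rewrite -!intrM -intrD !divq_num_den.
apply: mbits_frac; first by rewrite mulf_neq0 ?denq_neq0.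
  have tri (a b : int) : (absz (a + b)%R <= absz a + absz b)%N by lia.
  apply: leq_trans (leq_nbits (tri _ _)) _.
  apply: leq_trans (nbitsD _ _) _; rewrite ltnS geq_max !abszM.
  rewrite !(leq_trans (nbitsM _ _)) //.
    by rewrite addnC leq_add // ?nbits_num ?nbits_den.
  by rewrite leq_add // ?nbits_num ?nbits_den.
by rewrite abszM (leq_trans (nbitsM _ _)) // leqW // leq_add // nbits_den.
Qed.

Lemma mbitsN q : mbits (- q) = mbits q.
Proof. by rewrite /mbits numqN denqN abszN. Qed.

Lemma mbitsV q : (mbits q^-1 <= mbits q)%N.
Proof.
have [->|q0] := eqVneq q 0; first by rewrite invr0.
rewrite -{1}[q]divq_num_den invf_div.
by apply: mbits_frac; rewrite ?numq_eq0 ?nbits_num ?nbits_den.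
Qed.

Lemma mbitsB p q : (mbits (p - q) <= (mbits p + mbits q).+1)%N.
Proof. by rewrite (leq_trans (mbitsD _ _)) ?mbitsN. Qed.

Lemma mbits_div p q : (mbits (p / q) <= mbits p + mbits q)%N.
Proof. by rewrite (leq_trans (mbitsM _ _)) // leq_add2l mbitsV. Qed.

Lemma mbits_nat k : mbits k%:R = nbits k.
Proof.
rewrite /mbits pmulrn numq_int denq_int /=.
by apply/maxn_idPl; rewrite /nbits trunc_log1.
Qed.

Lemma mbits_bool (b : bool) : mbits b%:R = 1%N.
Proof. by rewrite mbits_nat; case: b; rewrite /nbits ?trunc_log0 ?trunc_log1. Qed.

(** * Polynomial-time computability *)

Lemma dsize_rat q : (dsize (Leaf q) <= mbits q + mbits q)%N.
Proof. exact: qbits_mbits. Qed.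

Lemma mbits_dsize q : (mbits q <= dsize (Leaf q))%N.
Proof. exact: mbits_qbits. Qed.

Lemma dsize_bool (b : bool) : (dsize (Leaf b%:R) <= 2)%N.
Proof. by rewrite (leq_trans (dsize_rat _)) // mbits_bool. Qed.

Lemma dsize0 : (dsize (Leaf 0) <= 2)%N.
Proof. exact: (dsize_bool false). Qed.

Lemma dsize_fst d : (dsize (eval_unop Fst d) <= dsize d + 2)%N.
Proof.
case: d => [q|a b]; first by apply: leq_trans dsize0 _; rewrite leq_addl.
by rewrite [dsize (Node _ _)]/=; rewrite /eval_unop; lia.
Qed.

Lemma dsize_snd d : (dsize (eval_unop Snd d) <= dsize d + 2)%N.
Proof.
case: d => [q|a b]; first by apply: leq_trans dsize0 _; rewrite leq_addl.
by rewrite [dsize (Node _ _)]/=; rewrite /eval_unop; lia.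
Qed.

Lemma dsize_binop o a b :
  (dsize (eval_binop o a b) <= 2 * (dsize a + dsize b) + 2)%N.
Proof.
have h0 n : (dsize (Leaf 0) <= n + 2)%N by apply: leq_trans dsize0 _; rewrite leq_addl.
case: o; first by rewrite [dsize _]/=; lia.
all: case: a => [p|? ?]; last exact: h0.
all: case: b => [q|? ?]; last exact: h0.
all: rewrite /eval_binop; have := mbits_dsize p; have := mbits_dsize q.
- by move: (mbitsD p q) => h1 h2 h3; apply: leq_trans (dsize_rat _) _;
    apply: leq_trans (leq_add h1 h1) _; lia.
- by move: (mbitsB p q) => h1 h2 h3; apply: leq_trans (dsize_rat _) _;
    apply: leq_trans (leq_add h1 h1) _; lia.
- by move: (mbitsM p q) => h1 h2 h3; apply: leq_trans (dsize_rat _) _;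
    apply: leq_trans (leq_add h1 h1) _; lia.
- by move: (mbits_div p q) => h1 h2 h3; apply: leq_trans (dsize_rat _) _;
    apply: leq_trans (leq_add h1 h1) _; lia.
- by move=> h1 h2; apply: leq_trans (dsize_bool _) _; lia.
Qed.

(* All bounds are polynomial in [psz], the size of the input.  The body of a loop
   is a program for the problem extended by the loop index, with the same oracle
   and the same [psz]. *)
Record prob := Prob {
  config :> Type;
  orac : config -> data -> data;
  psz : config -> nat }.

Definition extp (X : prob) (A : X -> Type) : prob :=
  @Prob {x : X & A x} (fun y => orac (projT1 y)) (fun y => psz (projT1 y)).

Definition ext_in (X : prob) (A : X -> Type) (x : X) (a : A x) : extp A :=
  existT A x a.

(** The base is at least 2, so that a single exponent also absorbs constant factors and additive
    terms. *)
Definition polyb (X : prob) (b : X -> nat) : Prop :=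
  exists d, forall x, (b x <= (psz x + 2) ^ d)%N.

Section Polyb.
Variable X : prob.
Implicit Types a b : X -> nat.

Lemma polyb_le a b : (forall x, a x <= b x)%N -> polyb b -> polyb a.
Proof. by move=> ab [d hd]; exists d => x; apply: leq_trans (ab x) (hd x). Qed.

Lemma polyb_cst k : polyb (fun _ : X => k).
Proof.
exists k => x; apply: leq_trans (ltnW (ltn_expl k (isT : 1 < 2)%N)) _.
by case: k => [|k]; rewrite // leq_exp2r // leq_addl.
Qed.

Lemma polyb_psz : polyb (@psz X).
Proof. by exists 1%N => x; rewrite expn1 leq_addr. Qed.

Lemma polybD a b : polyb a -> polyb b -> polyb (fun x => a x + b x)%N.
Proof.
move=> [d hd] [e he]; exists (d + e).+1 => x.
have h2 : (1 < psz x + 2)%N by rewrite addn2.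
have hm f : (f <= d + e)%N -> ((psz x + 2) ^ f <= (psz x + 2) ^ (d + e))%N.
  by move=> ?; rewrite leq_exp2l.
have := leq_trans (hd x) (hm _ (leq_addr e d)).
have := leq_trans (he x) (hm _ (leq_addl d e)).
rewrite expnS; move: (_ ^ _)%N h2 => u h2 h3 h4.
by apply: (@leq_trans (2 * u)); [lia | rewrite leq_mul2r h2 orbT].
Qed.

Lemma polybM a b : polyb a -> polyb b -> polyb (fun x => a x * b x)%N.
Proof.
move=> [d hd] [e he]; exists (d + e)%N => x.
by rewrite expnD leq_mul.
Qed.

Lemma polybX a k : polyb a -> polyb (fun x => a x ^ k)%N.
Proof.
move=> ha; elim: k => [|k IH]; first exact: (polyb_cst 1).
by apply: polyb_le (polybM ha IH) => x; rewrite expnS.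
Qed.

(** [extp] leaves [psz] unchanged, so a bound on the extended problem is uniform in the summation
    index. *)
Lemma polyb_sum (n : X -> nat) (b : forall x, 'I_(n x) -> nat) :
  polyb n -> @polyb (extp (fun x => 'I_(n x))) (fun y => b _ (projT2 y)) ->
  polyb (fun x => \sum_(i < n x) b x i)%N.
Proof.
move=> hn [d hd].
have hb : polyb (fun x : X => (psz x + 2) ^ d)%N.
  exact: polybX (polybD polyb_psz (polyb_cst 2)).
apply: polyb_le (polybM hn hb) => x.
rewrite -[X in (_ <= X * _)%N]card_ord -sum_nat_const leq_sum // => i _.
exact: (hd (ext_in i)).
Qed.
End Polyb.

Lemma polyb_ext (X : prob) (A : X -> Type) (a : X -> nat) :
  polyb a -> polyb (fun y : extp A => a (projT1 y)).
Proof. by move=> [d hd]; exists d => y; apply: hd. Qed.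

Section Pt.
Variable X : prob.
Implicit Types e f g : X -> data.

Definition small f := polyb (fun x => dsize (f x)).

(* [pt e f]: from an encoding [e x] of the configuration, one computes [f x] in
   polynomial time.  The program reads and writes variable [k], and leaves the
   variables below [k] alone. *)
Definition pt e f : Prop :=
  [/\ small e, small f &
   exists (p : nat -> cmd) (b : X -> nat), polyb b /\
   forall x k s, s k = e x -> exists c s',
     [/\ exec (orac x) (p k) s c s', (c <= b x)%N, s' k = f x &
         forall y, (y < k)%N -> s' y = s y]].

Lemma pt_small e f : pt e f -> small f. Proof. by case. Qed.
Lemma pt_src e f : pt e f -> small e. Proof. by case. Qed.

Lemma update_eq s k d : update s k d k = d.
Proof. by rewrite /update eqxx. Qed.

Lemma update_ne s k d y : y != k -> update s k d y = s y.
Proof. by rewrite /update => /negPf ->. Qed.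

Lemma update_lt s k d y : (y < k)%N -> update s k d y = s y.
Proof. by move=> h; rewrite update_ne // neq_ltn h. Qed.

Lemma pt_refl e : small e -> pt e e.
Proof.
move=> he; split => //; exists (fun k => Assign k (Var k)), (fun x => dsize (e x) + 0)%N.
split; first by apply: polybD => //; exact: polyb_cst.
move=> x k s sk; exists (eval_cost s (Var k)), (update s k (s k)); split.
- exact: ExecAssign.
- by rewrite /= sk.
- by rewrite update_eq.
- by move=> y yk; rewrite update_lt.
Qed.

Lemma pt_trans e f g : pt e f -> pt f g -> pt e g.
Proof.
move=> [he hf [p [b [hb hp]]]] [_ hg [q [b' [hb' hq]]]]; split => //.
exists (fun k => Seq (p k) (q k)), (fun x => b x + b' x)%N; split; first exact: polybD.
move=> x k s sk; have [c [s1 [h1 h2 h3 h4]]] := hp x k s sk.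
have [c' [s2 [h1' h2' h3' h4']]] := hq x k s1 h3.
exists (c + c')%N, s2; split => //; first exact: ExecSeq h1 h1'.
  by rewrite leq_add.
by move=> y yk; rewrite h4' // h4.
Qed.

Lemma pt_cst e q : small e -> pt e (fun _ => Leaf q).
Proof.
move=> he; split => //; first exact: polyb_cst.
exists (fun k => Assign k (Cst q)), (fun x => dsize (Leaf q) + 0)%N.
split; first exact: polyb_cst.
move=> x k s sk; exists (eval_cost s (Cst q)), (update s k (Leaf q)); split => //.
- exact: ExecAssign.
- by rewrite update_eq.
- by move=> y yk; rewrite update_lt.
Qed.

Lemma pt_un o e f :
  (forall d, dsize (eval_unop o d) <= dsize d + 2)%N ->
  pt e f -> pt e (fun x => eval_unop o (f x)).
Proof.
move=> ho ef; have hf := pt_small ef; apply: (pt_trans ef).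
have hof : small (fun x => eval_unop o (f x)).
  by apply: polyb_le (polybD hf (polyb_cst X 2)) => x.
split => //.
exists (fun k => Assign k (Un o (Var k))),
  (fun x => dsize (eval_unop o (f x)) + (dsize (f x) + 0))%N; split.
  by do ?apply: polybD => //; exact: polyb_cst.
move=> x k s sk; exists (eval_cost s (Un o (Var k))), (update s k (eval s (Un o (Var k)))).
split.
- exact: ExecAssign.
- by rewrite /= sk.
- by rewrite update_eq /= sk.
- by move=> y yk; rewrite update_lt.
Qed.

Definition pt_fst e f (H : pt e f) := pt_un dsize_fst H.
Definition pt_snd e f (H : pt e f) := pt_un dsize_snd H.

(** Each program works on a copy of the input in a fresh variable. The input in [k] and the first
    result in [k.+1] survive because a program spares all variables below its own. *)
Lemma pt_bin o e f g :
  pt e f -> pt e g -> pt e (fun x => eval_binop o (f x) (g x)).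
Proof.
move=> [he hf [p [b [hb hp]]]] [_ hg [q [b' [hb' hq]]]].
have ho : small (fun x => eval_binop o (f x) (g x)).
  apply: polyb_le (fun x => dsize_binop o (f x) (g x)) _.
  by do ?[apply: polybD | apply: polybM] => //; exact: polyb_cst.
split => //.
exists (fun k => Seq (Seq (Assign k.+1 (Var k)) (p k.+1))
   (Seq (Seq (Assign k.+2 (Var k)) (q k.+2)) (Assign k (Bin o (Var k.+1) (Var k.+2))))).
exists (fun x => (dsize (e x) + 0 + b x) + ((dsize (e x) + 0 + b' x) +
   (dsize (eval_binop o (f x) (g x)) + ((dsize (f x) + 0) + (dsize (g x) + 0)))))%N.
split; first by do ?[apply: polybD] => //; exact: polyb_cst.
move=> x k s sk.
have [|c [s1 [h1 h2 h3 h4]]] := hp x k.+1 (update s k.+1 (s k)).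
  by rewrite update_eq.
have s1k : s1 k = e x by rewrite h4 // update_lt.
have [|c' [s2 [h1' h2' h3' h4']]] := hq x k.+2 (update s1 k.+2 (s1 k)).
  by rewrite update_eq.
exists (eval_cost s (Var k) + c +
  ((eval_cost s1 (Var k) + c') + eval_cost s2 (Bin o (Var k.+1) (Var k.+2))))%N.
exists (update s2 k (eval s2 (Bin o (Var k.+1) (Var k.+2)))).
have s2k : s2 k.+1 = f x by rewrite h4' // update_lt // h3.
split.
- apply: ExecSeq; first by apply: ExecSeq h1; exact: ExecAssign.
  apply: ExecSeq; last exact: ExecAssign.
  by apply: ExecSeq h1'; exact: ExecAssign.
- by rewrite /= sk s1k s2k h3' !leq_add.
- by rewrite update_eq /= s2k h3'.
- move=> y yk; rewrite update_lt // h4' ?update_lt ?h4 ?update_lt //; lia.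
Qed.

Lemma pt_pair e f g : pt e f -> pt e g -> pt e (fun x => Node (f x) (g x)).
Proof. exact: (@pt_bin Defs.Cons). Qed.

Lemma pt_if e b f g : pt e b -> pt e f -> pt e g ->
  pt e (fun x => if truthy (b x) then f x else g x).
Proof.
move=> [he hb [p [n [hn hp]]]] [_ hf [q [n' [hn' hq]]]] [_ hg [r [n'' [hn'' hr]]]].
split => //.
  apply: polyb_le (polybD hf hg) => x; case: truthy; [exact: leq_addr|exact: leq_addl].
exists (fun k => Seq (Seq (Assign k.+1 (Var k)) (p k.+1))
   (If (Var k.+1) (q k) (r k))).
exists (fun x => (dsize (e x) + 0 + n x) + ((dsize (b x) + 0) + (n' x + n'' x)))%N.
split; first by do ?[apply: polybD] => //; exact: polyb_cst.
move=> x k s sk.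
have [|c [s1 [h1 h2 h3 h4]]] := hp x k.+1 (update s k.+1 (s k)).
  by rewrite update_eq.
have s1k : s1 k = e x by rewrite h4 // update_lt.
have h5 y : (y < k)%N -> s1 y = s y by move=> yk; rewrite h4 ?update_lt //; lia.
have h6 : exec (orac x) (Seq (Assign k.+1 (Var k)) (p k.+1)) s (eval_cost s (Var k) + c) s1.
  by apply: ExecSeq h1; exact: ExecAssign.
have [tb|tb] := boolP (truthy (b x)).
  have [c' [s2 [h1' h2' h3' h4']]] := hq x k s1 s1k.
  exists (eval_cost s (Var k) + c + (eval_cost s1 (Var k.+1) + c'))%N, s2; split => //.
  - by apply: ExecSeq h6 _; apply: ExecIf; rewrite /= h3 tb.
  - by rewrite /= sk h3 !leq_add // (leq_trans h2') // leq_addr.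
  - by move=> y yk; rewrite h4' // h5.
have [c' [s2 [h1' h2' h3' h4']]] := hr x k s1 s1k.
exists (eval_cost s (Var k) + c + (eval_cost s1 (Var k.+1) + c'))%N, s2; split => //.
- by apply: ExecSeq h6 _; apply: ExecIf; rewrite /= h3 (negPf tb).
- by rewrite /= sk h3 !leq_add // (leq_trans h2') // leq_addl.
- by move=> y yk; rewrite h4' // h5.
Qed.

(** Nothing limits the answers of an oracle to arbitrary queries, so their size is a separate
    premise. *)
Lemma pt_ask e f : pt e f -> small (fun x => orac x (f x)) ->
  pt e (fun x => orac x (f x)).
Proof.
move=> ef ho; have hf := pt_small ef; apply: (pt_trans ef); split => //.
exists (fun k => Ask k (Var k)), (fun x => dsize (f x) + 0 + dsize (orac x (f x)))%N; split.
  by do ?apply: polybD => //; exact: polyb_cst.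
move=> x k s sk; exists (eval_cost s (Var k) + dsize (orac x (eval s (Var k))))%N.
exists (update s k (orac x (eval s (Var k)))).
split.
- exact: ExecAsk.
- by rewrite /= sk.
- by rewrite update_eq /= sk.
- by move=> y yk; rewrite update_lt.
Qed.
End Pt.


Lemma dsize_nat a : dsize (enc_nat a) = (nbits a + 1)%N.
Proof. by rewrite /enc_nat /= /qbits pmulrn numq_int denq_int /= /nbits trunc_log1. Qed.

Lemma dsize_nat_le a b : (a <= b)%N -> (dsize (enc_nat a) <= dsize (enc_nat b))%N.
Proof. by move=> ab; rewrite !dsize_nat leq_add2r leq_nbits. Qed.

Lemma polyb_extP (X : prob) (A : X -> Type) (b : extp A -> nat) : polyb b ->
  exists B : X -> nat, polyb B /\ forall x (a : A x), (b (ext_in a) <= B x)%N.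
Proof.
move=> [d hd]; exists (fun x => ((psz x + 2) ^ d)%N); split; first by exists d.
by move=> x a; exact: (hd (ext_in a)).
Qed.

(** * Bounded loops *)

Section Iter.
Variables (X : prob) (e : X -> data) (n : X -> nat) (acc : X -> nat -> data).

Definition loop_src (y : extp (fun x => 'I_(n x))) :=
  Node (e (projT1 y)) (Node (enc_nat (projT2 y)) (acc (projT1 y) (projT2 y))).

(** Layout: [k] holds the input, [k.+1] the number of rounds, [k.+2] the accumulator, [k.+3] the
    index; the body works from [k.+4] on. As [Leq] is the only comparison, [i < n] is coded as
    [1 - (n <= i)]. *)
Definition loop_cond (k : nat) : expr :=
  Bin Defs.Sub (Cst 1) (Bin Leq (Var k.+1) (Var k.+3)).

Definition loop_body (k : nat) (q : cmd) : cmd :=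
  Seq (Seq (Assign k.+4 (Bin Defs.Cons (Var k) (Bin Defs.Cons (Var k.+3) (Var k.+2)))) q)
      (Seq (Assign k.+2 (Var k.+4)) (Assign k.+3 (Bin Defs.Add (Var k.+3) (Cst 1)))).

Lemma loop_condE k s x i : s k.+1 = enc_nat (n x) -> s k.+3 = enc_nat i ->
  eval s (loop_cond k) = Leaf (i < n x)%:R.
Proof.
move=> h1 h3; rewrite /= h1 h3 /= ler_nat ltnNge.
by case: leq; rewrite ?subrr ?subr0.
Qed.

(** Iterating a polynomial-time map can blow sizes up exponentially. Here the last premise contains,
    through [pt], a bound on [acc] that is uniform in the index, so every round costs at most the
    same [Bd]. *)
Lemma pt_iter : pt e (fun x => enc_nat (n x)) -> polyb n ->
  pt e (fun x => acc x 0%N) ->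
  pt loop_src (fun y => acc (projT1 y) (projT2 y).+1) ->
  pt e (fun x => acc x (n x)).
Proof.
move=> [he hen [pn [bn [hbn hpn]]]] hn [_ ha0 [p0 [b0 [hb0 hp0]]]].
move=> [hsrc haS [q [bq [hbq hq]]]].
have [Sr [hS hS']] := polyb_extP hsrc.
have [R [hR hR']] := polyb_extP haS.
have [Q [hQ hQ']] := polyb_extP hbq.
(* Later accumulators are bounded as outputs of the body; this includes the final [acc x (n x)],
   which is never an input of it. *)
have hacc x i : (i <= n x)%N -> (dsize (acc x i) <= dsize (acc x 0%N) + R x)%N.
  case: i => [_|i ni]; first exact: leq_addr.
  by apply: leq_trans (hR' x (Ordinal ni)) _; exact: leq_addl.
split => //.
  by apply: polyb_le (fun x => hacc x _ (leqnn _)) _; exact: polybD.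
pose N x := dsize (enc_nat (n x)).
have [NE hN] : (forall x, N x = dsize (enc_nat (n x))) /\ polyb N by [].
clearbody N.
pose Cd x := (8 + 2 * N x)%N.
pose Bd x := (Cd x + (3 * Sr x + Q x + (R x + (2 * N x + 2))))%N.
exists (fun k => Seq (Seq (Assign k.+1 (Var k)) (pn k.+1))
  (Seq (Seq (Assign k.+2 (Var k)) (p0 k.+2))
  (Seq (Assign k.+3 (Cst 0)) (Seq (While (loop_cond k) (loop_body k (q k.+4)))
    (Assign k (Var k.+2)))))).
exists (fun x => (dsize (e x) + 0 + bn x) + ((dsize (e x) + 0 + b0 x) + (2 +
  ((n x * Bd x + Cd x) + (dsize (acc x 0%N) + R x)))))%N; split.
  have hCd : polyb Cd.
    by apply: polybD; [exact: polyb_cst | apply: polybM => //; exact: polyb_cst].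
  have hBd : polyb Bd.
    by rewrite /Bd; do ?[apply: polybD | apply: polybM] => //; exact: polyb_cst.
  by do ?[apply: polybD | apply: polybM] => //; exact: polyb_cst.
have condC x k s i : (i <= n x)%N -> s k.+1 = enc_nat (n x) -> s k.+3 = enc_nat i ->
    (eval_cost s (loop_cond k) <= Cd x)%N.
  move=> ni h1 h3; have := loop_condE h1 h3; rewrite /loop_cond => h.
  have b1 : (dsize (eval s (Bin Defs.Sub (Cst 1) (Bin Leq (Var k.+1) (Var k.+3)))) <= 2)%N.
    by rewrite h dsize_bool.
  have b2 : (dsize (eval s (Bin Leq (Var k.+1) (Var k.+3))) <= 2)%N.
    by rewrite /= h1 h3 dsize_bool.
  have b3 : (dsize (Leaf 1) <= 2)%N by exact: (dsize_bool true).
  have b4 := dsize_nat_le ni.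
  change (dsize (eval s (Bin Defs.Sub (Cst 1) (Bin Leq (Var k.+1) (Var k.+3)))) +
    (dsize (Leaf 1) + 0 + (dsize (eval s (Bin Leq (Var k.+1) (Var k.+3))) +
      ((dsize (s k.+1) + 0) + (dsize (s k.+3) + 0)))) <= Cd x)%N.
  by rewrite h1 h3 /Cd NE; lia.
have loop x k m i s : (i + m = n x)%N -> s k = e x -> s k.+1 = enc_nat (n x) ->
   s k.+2 = acc x i -> s k.+3 = enc_nat i ->
   exists c s', [/\ exec (orac x) (While (loop_cond k) (loop_body k (q k.+4))) s c s',
     (c <= m * Bd x + Cd x)%N, s' k.+2 = acc x (n x) & forall y, (y < k)%N -> s' y = s y].
  elim: m i s => [|m IH] i s im sk s1 s2 s3.
    rewrite addn0 in im; exists (eval_cost s (loop_cond k)), s; split => //.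
    - by apply: ExecWhileStop; rewrite (loop_condE s1 s3) im ltnn.
    - by apply: condC s1 s3; rewrite im.
    - by rewrite s2 im.
  have ni : (i < n x)%N by rewrite -im addnS ltnS leq_addr.
  pose y := Ordinal ni.
  pose E4 := Bin Defs.Cons (Var k) (Bin Defs.Cons (Var k.+3) (Var k.+2)).
  have [|c [t [h1 h2 h3 h4]]] := hq (ext_in y) k.+4 (update s k.+4 (eval s E4)).
    by rewrite update_eq /= sk s2 s3.
  pose t1 := update t k.+2 (eval t (Var k.+4)).
  pose t2 := update t1 k.+3 (eval t1 (Bin Defs.Add (Var k.+3) (Cst 1))).
  have tl z : (z < k.+4)%N -> t z = s z by move=> zk; rewrite h4 // update_lt.
  have t13 : t1 k.+3 = enc_nat i.
    by rewrite /t1 update_ne ?tl ?s3 // neq_ltn ltnSn orbT.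
  have t2l z : (z < k.+2)%N -> t2 z = s z.
    move=> zk; rewrite /t2 update_lt; last exact: leq_trans zk _.
    by rewrite /t1 update_lt // tl // (leq_trans zk) // ltnW.
  have [||||| c' [s' [g1 g2 g3 g4]]] := IH i.+1 t2.
  - by rewrite addSnnS.
  - by rewrite t2l.
  - by rewrite t2l.
  - by rewrite /t2 update_lt // /t1 update_eq /= h3.
  - by rewrite /t2 update_eq /= t13 /= natr1.
  have bodyE : exec (orac x) (loop_body k (q k.+4)) s ((eval_cost s E4 + c) +
     (eval_cost t (Var k.+4) + eval_cost t1 (Bin Defs.Add (Var k.+3) (Cst 1)))) t2.
    apply: ExecSeq; first by apply: ExecSeq h1; exact: ExecAssign.
    by apply: ExecSeq; exact: ExecAssign.
  exists (eval_cost s (loop_cond k) + ((eval_cost s E4 + c) +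
     (eval_cost t (Var k.+4) + eval_cost t1 (Bin Defs.Add (Var k.+3) (Cst 1)))) + c')%N, s';
       split => //.
  - by apply: ExecWhileStep bodyE g1; rewrite (loop_condE s1 s3) ni.
  - rewrite mulSn; apply: leq_trans (_ : _ <= Bd x + (m * Bd x + Cd x))%N _; last by rewrite addnA.
    rewrite leq_add // /Bd leq_add // ?(condC _ _ _ i) //; first exact: ltnW.
    rewrite leq_add //; first last.
      have b1 : (eval_cost t (Var k.+4) <= R x)%N by rewrite /= h3 addn0 (hR' x y).
      have b2 : (eval_cost t1 (Bin Defs.Add (Var k.+3) (Cst 1)) <= 2 * N x + 2)%N.
        have b3 : (dsize (Leaf 1) <= 2)%N by exact: (dsize_bool true).
        have b4 := dsize_nat_le ni; have b5 := dsize_nat_le (ltnW ni).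
        rewrite /= t13 /= natr1 addn0.
        by move: b3 b4 b5; rewrite NE /=; move: (qbits _) => u0; lia.
      exact: leq_add.
    rewrite leq_add ?(leq_trans h2) ?hQ' //.
    have := hS' x y; rewrite /loop_src /E4 /= sk s2 s3 /=; move: (qbits _) => u0; lia.
  - by move=> z zk; rewrite g4 // t2l // (leq_trans zk) // ltnW.
move=> x k s sk.
have [|c [s1 [h1 h2 h3 h4]]] := hpn x k.+1 (update s k.+1 (s k)).
  by rewrite update_eq.
have s1k : s1 k = e x by rewrite h4 // update_lt.
have [|c' [s2 [h1' h2' h3' h4']]] := hp0 x k.+2 (update s1 k.+2 (s1 k)).
  by rewrite update_eq.
pose s3 := update s2 k.+3 (Leaf 0).
have [|||||c3 [s4 [g1 g2 g3 g4]]] := loop x k (n x) 0%N s3.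
- by [].
- by rewrite /s3 update_lt ?h4' ?update_lt //; lia.
- by rewrite /s3 update_lt ?h4' ?update_lt //; lia.
- by rewrite /s3 update_lt.
- by rewrite /s3 update_eq.
exists (eval_cost s (Var k) + c + (eval_cost s1 (Var k) + c' + (eval_cost s2 (Cst 0) +
  (c3 + eval_cost s4 (Var k.+2)))))%N, (update s4 k (eval s4 (Var k.+2))); split.
- apply: ExecSeq; first by apply: ExecSeq h1; exact: ExecAssign.
  apply: ExecSeq; first by apply: ExecSeq h1'; exact: ExecAssign.
  apply: ExecSeq; first exact: ExecAssign.
  by apply: ExecSeq g1 _; exact: ExecAssign.
- have z0 := dsize0.
  have zR := hacc x _ (leqnn _).
  by rewrite /= sk s1k g3 !addn0 !leq_add.
- by rewrite update_eq /= g3.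
- move=> y yk; rewrite update_lt // g4 // /s3 update_lt ?h4' ?update_lt ?h4 ?update_lt //; lia.
Qed.
End Iter.

(** The program stays the same and only the family of inputs is reparametrized. This serves to
    forget a loop index, or to run a body at the reversed index. *)
Lemma pt_subst (X Y : prob) (sg : X -> Y) (e f : Y -> data) :
  (forall x, orac (sg x) = orac x) -> (forall x, psz (sg x) = psz x) ->
  pt e f -> pt (fun x => e (sg x)) (fun x => f (sg x)).
Proof.
move=> ho hz [he hf [p [b [hb hp]]]].
have tr (c : Y -> nat) : polyb c -> polyb (fun x => c (sg x)).
  by move=> [d hd]; exists d => x; rewrite -hz.
split; [exact: tr he|exact: tr hf|].
exists p, (fun x => b (sg x)); split; first exact: tr.
move=> x k s sk; have [c [s' h]] := hp (sg x) k s sk.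
by exists c, s'; rewrite -ho.
Qed.

Lemma small_ext (X : prob) (A : X -> Type) (e : X -> data) :
  small e -> small (fun y : extp A => e (projT1 y)).
Proof. exact: polyb_ext. Qed.

Lemma pt_lift (X : prob) (A : X -> Type) (e f : X -> data) :
  pt e f -> pt (fun y : extp A => e (projT1 y)) (fun y => f (projT1 y)).
Proof. exact: (pt_subst (sg := fun y : extp A => projT1 y)). Qed.

Lemma small_node (X : prob) (f g : X -> data) :
  small f -> small g -> small (fun x => Node (f x) (g x)).
Proof.
move=> hf hg; apply: (polyb_le _ (polybD (polybD hf hg) (polyb_cst X 1))) => x.
by rewrite /= addn1.
Qed.

Lemma pt_weak (X : prob) (A : X -> Type) (e f : X -> data) (g : extp A -> data) :
  small g -> pt e f -> pt (fun y : extp A => Node (e (projT1 y)) (g y)) (fun y => f (projT1 y)).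
Proof.
move=> hg ef; have he := small_ext A (pt_src ef).
have h0 := pt_refl (small_node he hg).
have h1 : pt (fun y : extp A => Node (e (projT1 y)) (g y)) (fun y => e (projT1 y)) := pt_fst h0.
exact: (pt_trans h1 (pt_lift A ef)).
Qed.

Lemma pt_ind (X : prob) (A : X -> Type) (e : X -> data) (g : extp A -> data) :
  small e -> small g -> pt (fun y : extp A => Node (e (projT1 y)) (g y)) g.
Proof.
by move=> he hg; exact: (pt_snd (pt_refl (small_node (small_ext A he) hg))).
Qed.

(** * Arithmetic, tables and folds *)

Lemma pt_eq (X : prob) (e f g : X -> data) : pt e f -> f =1 g -> pt e g.
Proof. by move=> h /funext <-. Qed.

Lemma small_eq (X : prob) (f g : X -> data) : small f -> f =1 g -> small g.
Proof. by move=> h /funext <-. Qed.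

Notation ptq e f := (pt e (fun x => Leaf (f x))).
Notation ptn e f := (pt e (fun x => enc_nat (f x))).
Notation ptb e b := (pt e (fun x => Leaf (b x)%:R)).

Section Ops.
Variables (X : prob) (e : X -> data).
Implicit Types (f g : X -> rat) (a b : X -> bool).

Lemma ptqD f g : ptq e f -> ptq e g -> ptq e (fun x => f x + g x).
Proof. exact: (@pt_bin _ Defs.Add). Qed.
Lemma ptqB f g : ptq e f -> ptq e g -> ptq e (fun x => f x - g x).
Proof. exact: (@pt_bin _ Defs.Sub). Qed.
Lemma ptqM f g : ptq e f -> ptq e g -> ptq e (fun x => f x * g x).
Proof. exact: (@pt_bin _ Mul). Qed.
Lemma ptq_div f g : ptq e f -> ptq e g -> ptq e (fun x => f x / g x).
Proof. exact: (@pt_bin _ Div). Qed.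
Lemma ptb_le f g : ptq e f -> ptq e g -> ptb e (fun x => f x <= g x).
Proof. exact: (@pt_bin _ Leq). Qed.

Lemma ptb_and a b : ptb e a -> ptb e b -> ptb e (fun x => a x && b x).
Proof.
move=> ha hb; apply: pt_eq (ptqM ha hb) _ => x.
by case: (a x); case: (b x); rewrite ?mulr1 ?mulr0.
Qed.

Lemma ptb_not a : ptb e a -> ptb e (fun x => ~~ a x).
Proof.
move=> ha; apply: pt_eq (ptqB (pt_cst 1 (pt_src ha)) ha) _ => x.
by case: (a x); rewrite ?subrr ?subr0.
Qed.

Lemma ptb_lt f g : ptq e f -> ptq e g -> ptb e (fun x => f x < g x).
Proof.
move=> hf hg; apply: pt_eq (ptb_not (ptb_le hg hf)) _ => x.
by rewrite -ltNge.
Qed.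

Lemma ptb_eq f g : ptq e f -> ptq e g -> ptb e (fun x => f x == g x).
Proof.
move=> hf hg; apply: pt_eq (ptb_and (ptb_le hf hg) (ptb_le hg hf)) _ => x.
by rewrite eq_le.
Qed.

Lemma ptn_le (m n : X -> nat) : ptn e m -> ptn e n -> ptb e (fun x => m x <= n x)%N.
Proof.
by move=> hm hn; apply: pt_eq (ptb_le hm hn) _ => x; rewrite ler_nat.
Qed.

Lemma ptn_eq (m n : X -> nat) : ptn e m -> ptn e n -> ptb e (fun x => m x == n x)%N.
Proof.
by move=> hm hn; apply: pt_eq (ptb_eq hm hn) _ => x; rewrite eqr_nat.
Qed.

Lemma ptnD (m n : X -> nat) : ptn e m -> ptn e n -> ptn e (fun x => m x + n x)%N.
Proof.
by move=> hm hn; apply: pt_eq (ptqD hm hn) _ => x; rewrite -natrD.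
Qed.

Lemma ptnM (m n : X -> nat) : ptn e m -> ptn e n -> ptn e (fun x => m x * n x)%N.
Proof.
by move=> hm hn; apply: pt_eq (ptqM hm hn) _ => x; rewrite -natrM.
Qed.

Lemma ptn_cst k : small e -> ptn e (fun _ => k).
Proof. exact: pt_cst. Qed.

Lemma pt_ifb b (f g : X -> data) : ptb e b -> pt e f -> pt e g ->
  pt e (fun x => if b x then f x else g x).
Proof.
move=> hb hf hg; apply: pt_eq (pt_if hb hf hg) _ => x.
by case: (b x) => /=; rewrite ?oner_eq0 ?eqxx.
Qed.

Lemma ptq_if b f g : ptb e b -> ptq e f -> ptq e g ->
  ptq e (fun x => if b x then f x else g x).
Proof.
by move=> hb hf hg; apply: pt_eq (pt_ifb hb hf hg) _ => x; case: (b x).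
Qed.

Lemma ptn_if b (f g : X -> nat) : ptb e b -> ptn e f -> ptn e g ->
  ptn e (fun x => if b x then f x else g x).
Proof.
by move=> hb hf hg; apply: pt_eq (pt_ifb hb hf hg) _ => x; case: (b x).
Qed.

Lemma ptnB (m n : X -> nat) : ptn e m -> ptn e n -> ptn e (fun x => m x - n x)%N.
Proof.
move=> hm hn.
apply: pt_eq (pt_ifb (ptn_le hn hm) (ptqB hm hn) (pt_cst 0 (pt_src hm))) _ => x.
case: leqP => h; first by rewrite /enc_nat natrB.
by rewrite /enc_nat (eqP (ltnW h)).
Qed.

Lemma ptq_max f g : ptq e f -> ptq e g -> ptq e (fun x => Num.max (f x) (g x)).
Proof.
move=> hf hg; apply: pt_eq (ptq_if (ptb_lt hf hg) hg hf) _ => x.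
by rewrite maxElt.
Qed.

Lemma ptq_min f g : ptq e f -> ptq e g -> ptq e (fun x => Num.min (f x) (g x)).
Proof.
move=> hf hg; apply: pt_eq (ptq_if (ptb_lt hf hg) hf hg) _ => x.
by rewrite minElt.
Qed.
End Ops.

Lemma mbits_max p q : (mbits (Num.max p q) <= (mbits p + mbits q).+1)%N.
Proof. by rewrite maxElt; case: ifP => _; rewrite leqW ?leq_addr ?leq_addl. Qed.

Lemma mbits_min p q : (mbits (Num.min p q) <= (mbits p + mbits q).+1)%N.
Proof. by rewrite minElt; case: ifP => _; rewrite leqW ?leq_addr ?leq_addl. Qed.

Lemma dsize_enc_seq s : dsize (enc_seq s) = (\sum_(d <- s) (dsize d).+1 + dsize (Leaf 0))%N.
Proof.
elim: s => [|d s IH]; first by rewrite big_nil.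
by rewrite big_cons -addnA -IH addSn.
Qed.

Lemma dsize_enc_fun k (F : 'I_k -> data) :
  dsize (enc_fun F) = (\sum_i (dsize (F i)).+1 + dsize (Leaf 0))%N.
Proof. by rewrite /enc_fun dsize_enc_seq big_map big_enum. Qed.

Lemma dsize_drop i s : (dsize (enc_seq (drop i s)) <= dsize (enc_seq s))%N.
Proof.
rewrite -{2}[s](cat_take_drop i) !dsize_enc_seq big_cat /= -addnA leq_addl //.
Qed.

Lemma small_ord (X : prob) (n : X -> nat) : small (fun x => enc_nat (n x)) ->
  small (fun y : extp (fun x => 'I_(n x)) => enc_nat (projT2 y)).
Proof.
move=> h; apply: polyb_le (small_ext _ h) => y.
exact: dsize_nat_le (ltnW (ltn_ord _)).
Qed.

Lemma small_fun (X : prob) (n : X -> nat) (F : forall x, 'I_(n x) -> data) :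
  polyb n -> small (fun y : extp (fun x => 'I_(n x)) => F (projT1 y) (projT2 y)) ->
  small (fun x => enc_fun (F x)).
Proof.
move=> hn hF.
have h : polyb (fun x => (\sum_(i < n x) (dsize (F x i)).+1 + 2)%N).
  apply: polybD (polyb_cst X 2); apply: polyb_sum => //.
  by apply: polyb_le (polybD hF (polyb_cst _ 1)) => y; rewrite addn1.
by apply: polyb_le h => x; rewrite dsize_enc_fun leq_add2l dsize0.
Qed.

Section Loops.
Variables (X : prob) (e : X -> data) (n : X -> nat).
Local Notation Y := (extp (fun x => 'I_(n x))).

Definition idx_src (y : Y) := Node (e (projT1 y)) (enc_nat (projT2 y)).

Lemma pt_loop_src (acc : X -> nat -> data) :
  small e -> small (fun x => enc_nat (n x)) ->
  small (fun y : Y => acc (projT1 y) (projT2 y)) ->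
  @pt Y (@loop_src X e n acc) idx_src /\
  @pt Y (@loop_src X e n acc) (fun y : Y => acc (projT1 y) (projT2 y)).
Proof.
move=> he hn hacc.
have h : @pt Y (@loop_src X e n acc) (@loop_src X e n acc).
  apply: pt_refl; apply: small_node; first exact: small_ext he.
  by apply: small_node; first exact: small_ord.
have h2 : @pt Y (@loop_src X e n acc) (fun y => Node (enc_nat (projT2 y)) (acc (projT1 y) (projT2
  y))).
  exact: (pt_snd h).
split; last exact: (pt_snd h2).
by apply: pt_pair; [exact: (pt_fst h) | exact: (pt_fst h2)].
Qed.

(** Lists grow at the head, so the table is filled from its last entry: after [i] rounds the
    accumulator holds the last [i] entries, and round [i] computes entry [n x - i.+1]. *)
Lemma pt_tab (F : forall x, 'I_(n x) -> data) :
  ptn e n -> polyb n ->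
  pt idx_src (fun y => F (projT1 y) (projT2 y)) ->
  pt e (fun x => enc_fun (F x)).
Proof.
move=> hn pn hF; have he := pt_src hn.
pose acc x i := enc_seq (drop (n x - i) [seq F x j | j <- enum 'I_(n x)]).
have sF : small (fun x => enc_fun (F x)) by exact: small_fun pn (pt_small hF).
have sacc : small (fun y : Y => acc (projT1 y) (projT2 y)).
  by apply: polyb_le (small_ext _ sF) => y; exact: dsize_drop.
have [h1 h2] := pt_loop_src he (pt_small hn) sacc.
suff : pt e (fun x => acc x (n x)).
  by move=> h; apply: pt_eq h _ => x; rewrite /acc subnn drop0.
apply: pt_iter => //.
  apply: pt_eq (pt_cst 0 he) _ => x.
  by rewrite /acc subn0 drop_oversize // size_map size_enum_ord.
have h3 : ptn (@loop_src X e n acc) (fun y : Y => rev_ord (projT2 y)).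
  have hi := pt_eq (ptnD (pt_snd h1) (ptn_cst 1 (pt_src h1)))
    (fun y : Y => congr1 enc_nat (addn1 (projT2 y))).
  exact: (ptnB (pt_trans h1 (pt_weak (pt_small (pt_snd h1)) hn)) hi).
pose sg (y : Y) : Y := ext_in (rev_ord (projT2 y)).
have h4 : pt (@loop_src X e n acc) (fun y => idx_src (sg y)).
  exact: pt_pair (pt_fst h1) h3.
have h5 : pt (@loop_src X e n acc) (fun y => F (projT1 y) (rev_ord (projT2 y))).
  exact: pt_trans h4 (pt_subst (sg := sg) (fun=> erefl) (fun=> erefl) hF).
apply: pt_eq (pt_pair h5 h2) _ => -[x i] /=.
rewrite /acc.
have lt : (n x - i.+1 < size [seq F x j | j <- enum 'I_(n x)])%N.
  by rewrite size_map size_enum_ord (ltn_ord (rev_ord i)).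
rewrite [in RHS](drop_nth (Leaf 0) lt) /= subnSK //.
rewrite (nth_map (rev_ord i)) ?size_enum_ord ?(ltn_ord (rev_ord i)) //.
by rewrite (nth_ord_enum (rev_ord i) (rev_ord i)).
Qed.

(** The list is walked down with [Snd]; the accumulators are its suffixes, hence small. *)
Lemma pt_lookup (F : forall x, 'I_(n x) -> data) (i : forall x, 'I_(n x)) :
  pt e (fun x => enc_fun (F x)) -> ptn e (fun x => i x) ->
  pt e (fun x => F x (i x)).
Proof.
move=> hF hi; have he := pt_src hi.
pose acc x k := enc_seq (drop k [seq F x j | j <- enum 'I_(n x)]).
pose m x := nat_of_ord (i x).
(* The loop runs [i x] times, a value and not a bit size; it is polynomial because the encoded list
   has more than [i x] cells. *)
have pm : polyb m.
  apply: polyb_le (pt_small hF) => x; rewrite dsize_enc_fun.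
  apply: leq_trans (leq_addr _ _); apply: leq_trans (ltnW (ltn_ord (i x))) _.
  by rewrite -[X in (X <= _)%N]card_ord -sum1_card leq_sum.
suff h : pt e (fun x => acc x (m x)).
  apply: pt_eq (pt_fst h) _ => x; rewrite /acc.
  have lt : (m x < size [seq F x j | j <- enum 'I_(n x)])%N.
    by rewrite size_map size_enum_ord ltn_ord.
  by rewrite (drop_nth (Leaf 0) lt) /= (nth_map (i x)) ?size_enum_ord ?ltn_ord // nth_ord_enum.
have sacc : small (fun y : extp (fun x => 'I_(m x)) => acc (projT1 y) (projT2 y)).
  by apply: polyb_le (small_ext _ (pt_small hF)) => y; exact: dsize_drop.
apply: pt_iter => //; first by apply: pt_eq hF _ => x; rewrite /acc drop0.
have h := pt_refl (small_node (small_ext _ he)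
  (small_node (small_ord (pt_small hi)) sacc)).
apply: pt_eq (pt_snd (pt_snd (pt_snd h))) _ => -[x k] /=; rewrite /acc.
by rewrite -addn1 addnC -drop_drop drop1; case: drop.
Qed.
End Loops.
Arguments idx_src {X} e {n} y.

Section Folds.
Variables (X : prob) (e : X -> data) (n : X -> nat).
Local Notation Y := (extp (fun x => 'I_(n x))).

Lemma take_enum_ordS k (i : 'I_k) :
  take i.+1 (enum 'I_k) = rcons (take i (enum 'I_k)) i.
Proof. by rewrite (take_nth i) ?size_enum_ord // nth_ord_enum. Qed.

(** Each application adds the sizes up to one bit, so the result is linear in the total size of the
    terms. *)
Lemma mbits_foldl (op : rat -> rat -> rat) (T : Type) (F : T -> rat) q s :
  (forall a b, mbits (op a b) <= (mbits a + mbits b).+1)%N ->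
  (mbits (foldl (fun a j => op a (F j)) q s)
     <= mbits q + \sum_(j <- s) (mbits (F j)).+1)%N.
Proof.
move=> hop; elim: s q => [|j s IH] q; first by rewrite big_nil addn0.
rewrite big_cons /=; apply: leq_trans (IH _) _.
by rewrite addnA leq_add2r addnS.
Qed.

Lemma ptq_foldl (op : rat -> rat -> rat) q (F : forall x, 'I_(n x) -> rat) :
  (forall a b, mbits (op a b) <= (mbits a + mbits b).+1)%N ->
  (forall (Z : prob) (s : Z -> data) f g, ptq s f -> ptq s g ->
     ptq s (fun z => op (f z) (g z))) ->
  ptn e n -> polyb n -> ptq (idx_src e) (fun y : Y => F (projT1 y) (projT2 y)) ->
  ptq e (fun x => foldl (fun a j => op a (F x j)) q (enum 'I_(n x))).
Proof.
move=> mop pop hn pn hF; have he := pt_src hn.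
pose acc x i := Leaf (foldl (fun a j => op a (F x j)) q (take i (enum 'I_(n x)))).
suff h : pt e (fun x => acc x (n x)).
  by apply: pt_eq h _ => x; rewrite /acc take_oversize // size_enum_ord.
have sacc : small (fun y : Y => acc (projT1 y) (projT2 y)).
  pose B x := (mbits q + \sum_(j < n x) (mbits (F x j)).+1)%N.
  have pB : polyb (fun x => B x + B x)%N.
    suff h : polyb B by exact: polybD.
    apply: polybD (polyb_cst _ _) _; apply: polyb_sum => //.
    apply: polyb_le (polybD (pt_small hF) (polyb_cst _ 1)) => y.
    by rewrite addn1 ltnS mbits_dsize.
  apply: polyb_le (polyb_ext _ pB) => y; apply: leq_trans (dsize_rat _) _.
  suff h : (mbits (foldl (fun a j => op a (F (projT1 y) j)) q
     (take (projT2 y) (enum 'I_(n (projT1 y))))) <= B (projT1 y))%N by exact: leq_add.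
  apply: leq_trans (mbits_foldl _ _ _ mop) _; rewrite leq_add2l.
  rewrite -[X in (_ <= X)%N]big_enum -{2}(cat_take_drop (projT2 y) (enum _)).
  by rewrite big_cat leq_addr.
have [h1 h2] := pt_loop_src he (pt_small hn) sacc.
apply: pt_iter => //; first by apply: pt_eq (pt_cst q he) _ => x; rewrite /acc take0.
apply: pt_eq (pop _ _ _ _ h2 (pt_trans h1 hF)) _ => -[x i] /=.
by rewrite /acc take_enum_ordS foldl_rcons.
Qed.

Lemma foldl_sum (T : Type) (F : T -> rat) s :
  foldl (fun a j => a + F j) 0 s = \sum_(j <- s) F j.
Proof.
elim/last_ind: s => [|s j IH]; first by rewrite big_nil.
by rewrite foldl_rcons IH -cats1 big_cat big_seq1.
Qed.

Lemma ptq_sum (F : forall x, 'I_(n x) -> rat) :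
  ptn e n -> polyb n -> ptq (idx_src e) (fun y : Y => F (projT1 y) (projT2 y)) ->
  ptq e (fun x => \sum_j F x j).
Proof.
move=> hn pn hF.
apply: pt_eq (@ptq_foldl +%R 0 F mbitsD _ hn pn hF) _; first by move=> *; exact: ptqD.
by move=> x; rewrite foldl_sum big_enum.
Qed.
End Folds.

(** The starting value 0 stands for the profit of the virtual warehouse. *)
Definition bmax k (F : 'I_k -> rat) := foldl (fun a j => Num.max a (F j)) 0 (enum 'I_k).

Definition bfind k (P : pred 'I_k) : option 'I_k := ohead [seq j <- enum 'I_k | P j].

Section Folds2.
Variables (X : prob) (e : X -> data) (n : X -> nat).
Local Notation Y := (extp (fun x => 'I_(n x))).

Lemma ptq_bmax (F : forall x, 'I_(n x) -> rat) :
  ptn e n -> polyb n -> ptq (idx_src e) (fun y : Y => F (projT1 y) (projT2 y)) ->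
  ptq e (fun x => bmax (F x)).
Proof.
by apply: ptq_foldl => [|*]; [exact: mbits_max | exact: ptq_max].
Qed.

Lemma pt_bfind (P : forall x, pred 'I_(n x)) :
  ptn e n -> polyb n -> ptb (idx_src e) (fun y : Y => P (projT1 y) (projT2 y)) ->
  pt e (fun x => enc_opt (bfind (P x))).
Proof.
move=> hn pn hP; have he := pt_src hn.
pose acc x i := enc_opt (ohead [seq j <- take i (enum 'I_(n x)) | P x j]).
suff h : pt e (fun x => acc x (n x)).
  by apply: pt_eq h _ => x; rewrite /acc take_oversize // size_enum_ord.
have sacc : small (fun y : Y => acc (projT1 y) (projT2 y)).
  have h := polybD (pt_small hn) (polyb_cst X 3).
  apply: polyb_le (polyb_ext _ h) => y; rewrite /acc.
  case: ohead => [j|]; last by apply: leq_trans dsize0 _; rewrite /= !addnS.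
  have h1 := dsize_nat_le (ltnW (ltn_ord j)).
  have h2 : (dsize (enc_opt (Some j)) = (dsize (enc_nat j) + dsize (Leaf 0)).+1)%N by [].
  by rewrite h2 -addnS leq_add // ltnS dsize0.
have [h1 h2] := pt_loop_src he (pt_small hn) sacc.
apply: pt_iter => //; first by apply: pt_eq (pt_cst 0 he) _ => x; rewrite /acc take0.
have h3 := pt_ifb (pt_trans h1 hP) (pt_pair (pt_snd h1) (pt_cst 0 (pt_src h1)))
  (pt_cst 0 (pt_src h1)).
apply: pt_eq (pt_if h2 h2 h3) _ => -[x i] /=.
rewrite /acc take_enum_ordS filter_rcons.
by case: [seq j <- take i _ | P x j] => [|? ?] //=; case: (P x i) => /=; rewrite ?oner_eq0 ?eqxx.
Qed.
End Folds2.

Lemma bmax_ge0 k (F : 'I_k -> rat) : 0 <= bmax F.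
Proof.
rewrite /bmax; elim/last_ind: (enum _) => // s j IH.
by rewrite foldl_rcons le_max IH.
Qed.

Lemma bmax_ge k (F : 'I_k -> rat) j : F j <= bmax F.
Proof.
rewrite /bmax; have : j \in enum 'I_k by rewrite mem_enum.
elim/last_ind: (enum _) => // s i IH; rewrite mem_rcons in_cons foldl_rcons le_max.
by case/orP => [/eqP ->|/IH ->//]; rewrite lexx orbT.
Qed.

Lemma bmax_attained k (F : 'I_k -> rat) : 0 < bmax F -> exists j, F j = bmax F.
Proof.
rewrite /bmax; elim/last_ind: (enum _) => [|s i IH]; first by rewrite ltxx.
rewrite foldl_rcons maxElt; case: ifP => _ h; first by exists i.
exact: IH.
Qed.

Lemma bfind_some k (P : pred 'I_k) j : bfind P = Some j -> P j.
Proof.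
rewrite /bfind; case E : [seq _ <- _ | _] => [//|i s] /= [<-].
have : i \in [seq j <- enum 'I_k | P j] by rewrite E mem_head.
by rewrite mem_filter => /andP[].
Qed.

Lemma bfind_none k (P : pred 'I_k) j : bfind P = None -> ~~ P j.
Proof.
rewrite /bfind; case E : [seq _ <- _ | _] => [|//] _.
apply/negP => Pj; have : j \in [seq j <- enum 'I_k | P j] by rewrite mem_filter Pj mem_enum.
by rewrite E.
Qed.

(** * The Erlang loss function *)

(* One minus the Erlang loss probability of [x] servers under offered load [M]. *)
Fixpoint erl (M : rat) (x : nat) : rat :=
  if x is y.+1 then y.+1%:R / (y.+1%:R + M * (1 - erl M y)) else 0.

Section Erlang.
Implicit Types (M p : rat) (x : nat).

Lemma erl_bounds M x : 0 <= M -> 0 <= erl M x <= 1.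
Proof.
move=> M0; elim: x => [|x /andP[h0 h1]] /=; first by rewrite ler01.
have x0 : 0 < x.+1%:R :> rat by rewrite ltr0n.
have d0 : 0 <= M * (1 - erl M x) by rewrite mulr_ge0 // subr_ge0.
by rewrite divr_ge0 ?addr_ge0 ?ler0n //= ler_pdivrMr ?mul1r ?lerDl // ltr_wpDr.
Qed.

Lemma erl_den M x : 0 <= M -> 0 < x.+1%:R + M * (1 - erl M x).
Proof.
move=> M0; have /andP[_ h1] := erl_bounds x M0.
by rewrite ltr_wpDr ?ltr0n // mulr_ge0 // subr_ge0.
Qed.

Lemma erl_ge0 M x : 0 <= M -> 0 <= erl M x.
Proof. by move=> /(erl_bounds x)/andP[]. Qed.

Lemma erl_le1 M x : 0 <= M -> erl M x <= 1.
Proof. by move=> /(erl_bounds x)/andP[]. Qed.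

Lemma erlS M x : 0 <= M ->
  erl M x.+1 * (x.+1%:R + M * (1 - erl M x)) = x.+1%:R.
Proof. by move=> M0; rewrite /= divfK // gt_eqF // erl_den. Qed.

Lemma erl_load M x : 0 <= M -> M * erl M x <= x%:R.
Proof.
move=> M0; elim: x => [|x IH] /=; first by rewrite mulr0.
rewrite mulrA ler_pdivrMr ?erl_den // mulrC ler_pM2l ?ltr0n //.
by rewrite -natr1; nra.
Qed.

(** In terms of the loss [z], the recurrence turns the claim at [x.+1] into a bound on the overflow
    [M * z]. That bound follows from [M] times the induction hypothesis together with [erl_load]. *)
Lemma erl_quadratic M x : 0 <= M ->
  M * (1 - erl M x) ^+ 2 + (x.+1%:R - M) * (1 - erl M x) <= 1.
Proof.
move=> M0; elim: x => [|x IH]; first by rewrite /= subr0; lra.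
have dp := erl_den x M0; have b := erl_load x M0.
have h1 := erl_le1 x M0.
have -> : 1 - erl M x.+1 = M * (1 - erl M x) / (x.+1%:R + M * (1 - erl M x)).
  have D0 := lt0r_neq0 dp; apply: (mulIf D0).
  by rewrite /= mulrBl divfK // mul1r divfK //; ring.
have ez : erl M x = 1 - (1 - erl M x) by ring.
rewrite ez in b; move: (1 - erl M x) IH dp b => z {h1 ez}.
rewrite -!natr1; move: (x%:R) (ler0n rat x) => n n0 IH dp b.
have key : (M * z) ^+ 2 + (n - M) * (M * z) <= n + 1.
  have h : M * (M * z ^+ 2 + (n + 1 - M) * z) <= M * 1 by rewrite ler_wpM2l.
  by rewrite [X in X <= _](_ : _ = M * (M * z ^+ 2 + (n + 1 - M) * z) - M * z); [lra|ring].
rewrite -subr_ge0 (_ : _ - _ = (n + 1) * (n + 1 - ((M * z) ^+ 2 + (n - M) * (M * z)))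
  / (n + 1 + M * z) ^+ 2); last by field; rewrite gt_eqF.
apply: divr_ge0; last exact: sqr_ge0.
by apply: mulr_ge0; [apply: addr_ge0 | rewrite subr_ge0].
Qed.

Lemma erl_nondecr M x : 0 <= M -> erl M x <= erl M x.+1.
Proof.
move=> M0; rewrite /= ler_pdivlMr ?erl_den //.
have b := erl_load x M0; have h1 := erl_le1 x M0.
by rewrite -natr1; nra.
Qed.

(* Convexity of [1 / erl] in the load, in difference form. *)
Lemma erl_load_step M p x : 0 <= M -> 0 <= p ->
  (1 + p * (erl M x.+1 - erl M x)) * erl (M + p) x.+1 <= erl M x.+1.
Proof.
move=> M0 p0; have Mp0 : 0 <= M + p by rewrite addr_ge0.
elim: x => [|x IH].
  rewrite /= !subr0 !mulr1 le_eqVlt; apply/orP; left; apply/eqP; field.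
  by rewrite !gt_eqF ?ltr_pwDl // -?addrA ltr_pwDl.
have := erlS x.+1 M0; have := erlS x.+1 Mp0; have := erlS x M0.
have := erl_den x.+1 M0; have := erl_den x.+1 Mp0.
have := erl_quadratic x.+1 M0; have := erl_nondecr x M0; have := erl_le1 x.+1 M0.
have := erl_ge0 x.+1 M0; have := erl_le1 x.+1 Mp0.
move: (erl M x) (erl M x.+1) (erl (M + p) x.+1) (erl M x.+2) (erl (M + p) x.+2) IH => b a a' c c'.
rewrite -!natr1; move: (x%:R) (ler0n rat x) => m m0; set n := m + 1.
move=> IH a'1 a0 a1 ab Q dp d ea ec' ec.
set u := p * (a - b) in IH.
have u0 : 0 <= u by rewrite mulr_ge0 // subr_ge0.
(* Both values at [x.+2] are written through the recurrence and the denominators cleared. *)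
suff suf : (n + 1 + M * (1 - a)) + p * (n + 1) - p * a * (n + 1 + M * (1 - a))
    <= n + 1 + (M + p) * (1 - a').
  have E1 : (1 + p * (c - a)) * (n + 1 + M * (1 - a)) <= n + 1 + (M + p) * (1 - a').
    by rewrite (_ : _ * _ = (n + 1 + M * (1 - a)) + p * (c * (n + 1 + M * (1 - a)))
      - p * a * (n + 1 + M * (1 - a))); [rewrite ec; exact: suf | ring].
  have n1 : 0 < n + 1 by rewrite /n; lra.
  have E0 : c' = (n + 1) / (n + 1 + (M + p) * (1 - a')) by apply: (canRL (mulfK (lt0r_neq0 dp))).
  have E2 : c = (n + 1) / (n + 1 + M * (1 - a)) by apply: (canRL (mulfK (lt0r_neq0 d))).
  rewrite E0 {2}E2 mulrCA ler_pM2l // ler_pdivrMr // [X in _ <= X]mulrC ler_pdivlMr //.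
have u1 : 0 < 1 + u by lra.
rewrite -(ler_pM2l u1).
have h : (M + p) * ((1 + u) * a') <= (M + p) * a by rewrite ler_wpM2l.
(* After multiplication by [1 + u] the induction hypothesis controls [a']. What remains is [p * u]
   times the slack of [erl_quadratic], plus a term that vanishes by the recurrence for [a]. *)
have key : (1 + u) * (n + 1 + (M + p)) - (M + p) * a -
   (1 + u) * ((n + 1 + M * (1 - a)) + p * (n + 1) - p * a * (n + 1 + M * (1 - a))) =
   p * u * (1 - (M * (1 - a) ^+ 2 + (n + 1 - M) * (1 - a)))
   + p * (a * (n + M * (1 - b)) - n).
  by rewrite /u; ring.
have key2 : 0 <= p * u * (1 - (M * (1 - a) ^+ 2 + (n + 1 - M) * (1 - a))).
  by rewrite mulr_ge0 ?mulr_ge0 ?subr_ge0.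
rewrite ea subrr mulr0 addr0 in key.
have -> : (1 + u) * (n + 1 + (M + p) * (1 - a')) =
  (1 + u) * (n + 1 + (M + p)) - (M + p) * ((1 + u) * a') by ring.
lra.
Qed.

Lemma erl_antitone M M' x : 0 <= M -> M <= M' -> erl M' x <= erl M x.
Proof.
move=> M0 MM; have M'0 := le_trans M0 MM.
elim: x => [|x IH]; first by rewrite lexx.
rewrite /= ler_pM2l ?ltr0n // lef_pV2 ?posrE ?erl_den // lerD2l.
by rewrite ler_pM // ?subr_ge0 ?erl_le1 // lerD2l lerN2.
Qed.

(** This is monotonicity of the carried load: load times [erl] does not decrease when the load is
    multiplied by [k]. *)
Lemma erl_scale k M x : 0 <= M -> 1 <= k -> erl M x <= k * erl (k * M) x.
Proof.
move=> M0 k1; have k0 : 0 < k by lra.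
have kM0 : 0 <= k * M by rewrite mulr_ge0 // ltW.
elim: x => [|x IH]; first by rewrite /= mulr0.
have d := erl_den x M0; have d' := erl_den x kM0; have b := erl_load x M0.
rewrite /= mulrCA ler_pM2l ?ltr0n // ler_pdivlMr // mulrC ler_pdivrMr //.
move: b IH; rewrite -natr1; move: (x%:R) (erl M x) (erl (k * M) x) => n a a' b IH.
have h : 0 <= (k - 1) * (n + 1 - M * a) by rewrite mulr_ge0; lra.
have h2 : M * a <= M * (k * a') by rewrite ler_wpM2l.
by nra.
Qed.

(** At load [k * c] with [k > 1], [erl_scale] leaves a factor [1 / k], and [1 / k >= 1 - (k - 1)].
    The linear form is what the penalty of the fluid plan can be compared with. *)
Lemma erl_overload (c : nat) M : (0 < c)%N -> 0 <= M ->
  erl c%:R c * (1 - Num.max 0 (M / c%:R - 1)) <= erl M c.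
Proof.
move=> c0 M0; have cr : 0 < c%:R :> rat by rewrite ltr0n.
have g0 := erl_ge0 c (ltW cr).
case: (leP M c%:R) => h.
  rewrite (_ : Num.max _ _ = 0) ?subr0 ?mulr1 ?erl_antitone //.
  by apply/max_idPl; rewrite subr_le0 ler_pdivrMr // mul1r.
have k1 : 1 < M / c%:R by rewrite ltr_pdivlMr // mul1r.
rewrite (_ : Num.max _ _ = M / c%:R - 1); last by apply/max_idPr; lra.
have := erl_scale c (ltW cr) (ltW k1); rewrite divfK ?gt_eqF //.
move: (M / c%:R) k1 (erl c%:R c) g0 (erl M c) => k k1 a a0 a' aa.
have k0 : 0 < k by lra.
rewrite -(ler_pM2l k0); apply: le_trans aa.
have h2 : 0 <= a * (k - 1) ^+ 2 by apply: mulr_ge0 => //; exact: sqr_ge0.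
have -> : k * (a * (1 - (k - 1))) = a - a * (k - 1) ^+ 2 by ring.
by rewrite gerBl.
Qed.

Lemma erl_ratio (c : nat) : (0 < c)%N ->
  c%:R * (1 - erl c%:R c) ^+ 2 + (1 - erl c%:R c) <= 1.
Proof.
move=> c0; have := erl_quadratic c (ler0n rat c).
by rewrite -natr1 (addrC c%:R) addrK mul1r.
Qed.

(** The worst case is [c = 1], where [z ^ 2 + z <= 1] forces [z <= (sqrt 5 - 1) / 2 < 0.62]. *)
Lemma erl_ratio_const (c : nat) : (0 < c)%N -> 19%:R / 50%:R <= erl c%:R c.
Proof.
move=> c0; have := erl_ratio c0; have := erl_le1 c (ler0n rat c).
have : 1 <= c%:R :> rat by rewrite ler1n.
by move: (c%:R) (erl _ _) => n a n1 a1; nra.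
Qed.

(* One step of the value function [R * erl M x]; [A] is the fluid revenue and [p]
   the fluid consumption of the period. *)
Lemma erl_value_step M p r A x : 0 <= M -> 0 <= p -> 0 <= r -> 0 <= A ->
  (r + A) * erl (M + p) x.+1 <=
  r * erl M x.+1 + Num.max 0 (A - p * (r * (erl M x.+1 - erl M x))).
Proof.
move=> M0 p0 r0 A0; have st := erl_load_step x M0 p0.
have h1 := erl_le1 x.+1 (addr_ge0 M0 p0); have h0 := erl_ge0 x.+1 (addr_ge0 M0 p0).
move: (erl (M + p) x.+1) (erl M x.+1) (erl M x) st h1 h0 => h a b st h1 h0.
(* By [erl_load_step], the value that [r] loses to the extra load [p] is covered by the opportunity
   cost [r * (a - b)] per unit; the rest is scaled by [h], which lies in [0, 1]. *)
have key : r * ((1 + p * (a - b)) * h) <= r * a by rewrite ler_wpM2l.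
have e1 : (r + A) * h = r * ((1 + p * (a - b)) * h) + (A - p * (r * (a - b))) * h by ring.
rewrite e1 lerD //; move: (A - _) => w.
rewrite le_max; case: (leP w 0) => w0; apply/orP; [left|right].
  exact: mulr_le0_ge0.
by rewrite ger_pMr.
Qed.
End Erlang.

(** * Potentials along histories *)

(** Histories grow at their end, so sums over paths are split at the last period. *)
Lemma big_tuple_rcons (R : zmodType) (E : finType) n (F : n.+1.-tuple E -> R) :
  \sum_w F w = \sum_(w : n.-tuple E) \sum_e F [tuple of rcons w e].
Proof.
rewrite pair_big /=.
pose g (p : n.-tuple E * E) : n.+1.-tuple E := [tuple of rcons p.1 p.2].
pose g' (w : n.+1.-tuple E) : n.-tuple E * E :=
  ([tuple tnth w (widen_ord (leqnSn n) i) | i < n], tnth w ord_max).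
rewrite (reindex g) //; exists g' => [[w e] _|w _].
  rewrite /g' /g; congr pair; last first.
    by rewrite (tnth_nth e) /= nth_rcons size_tuple ltnn eqxx.
  apply: eq_from_tnth => i; rewrite tnth_mktuple !(tnth_nth e) /=.
  by rewrite nth_rcons size_tuple ltn_ord.
apply: eq_from_tnth => i; have e0 := tnth w i.
have sg : size (g' w).1 = n by rewrite size_tuple.
have g1 j : tnth (g' w).1 j = tnth w (widen_ord (leqnSn n) j) by rewrite tnth_mktuple.
have g2 : (g' w).2 = tnth w ord_max by [].
move: (g' w) sg g1 g2 => [v e] /= sg g1 g2.
rewrite (tnth_nth e0) /= nth_rcons sg.
case: ltnP => h.
  have -> : i = widen_ord (leqnSn n) (Ordinal h) by apply: val_inj.
  by rewrite -g1 (tnth_nth e0).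
have -> : i = ord_max by apply/val_inj/eqP; rewrite eqn_leq h -ltnS ltn_ord.
by rewrite /= eqxx.
Qed.

Section Paths.
Variables (R : realType) (E : finType) (P : nat -> seq E -> E -> R) (f : E -> R).

(** Expected total reward plus a terminal value; carrying the latter is what allows the last period
    to be peeled off. *)
Definition path_sum n (Phi : seq E -> R) : R :=
  \sum_(w : n.-tuple E) (\prod_(t < n) P t (take t w) (tnth w t))
     * (\sum_(t < n) f (tnth w t) + Phi w).

Lemma path_sumS n Phi :
  (forall h : seq E, size h = n -> \sum_e P n h e = 1) ->
  path_sum n.+1 Phi =
  path_sum n (fun h => \sum_e P n h e * (f e + Phi (rcons h e))).
Proof.
move=> hP; rewrite /path_sum big_tuple_rcons; apply: eq_bigr => w _.
under eq_bigr => e _.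
  rewrite big_ord_recr big_ord_recr /=.
  have -> : tnth [tuple of rcons w e] ord_max = e.
    by rewrite (tnth_nth e) /= nth_rcons size_tuple ltnn eqxx.
  have -> : take n (rcons w e) = w.
    by rewrite -cats1 take_size_cat // size_tuple.
  have tw (i : 'I_n) : tnth [tuple of rcons w e] (widen_ord (leqnSn n) i) = tnth w i.
    by rewrite !(tnth_nth e) /= nth_rcons size_tuple ltn_ord.
  under eq_bigr => i _.
    rewrite tw -cats1 takel_cat; last by rewrite size_tuple ltnW.
    over.
  under [X in _ * (X + _ + _)]eq_bigr => i _ do rewrite tw.
  rewrite -mulrA -addrA mulrDr.
  over.
rewrite -mulr_sumr big_split /= -mulr_suml hP ?size_tuple // mul1r.
by [].
Qed.

Lemma path_sum_le n Phi Psi :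
  (forall t (h : seq E) e, (t < n)%N -> size h = t -> 0 <= P t h e) ->
  (forall h : seq E, size h = n -> Phi h <= Psi h) ->
  path_sum n Phi <= path_sum n Psi.
Proof.
move=> P0 le; apply: ler_sum => w _; rewrite ler_wpM2l //.
  apply: prodr_ge0 => t _; apply: P0 => //.
  by rewrite size_takel // size_tuple ltnW.
by rewrite lerD2l le // size_tuple.
Qed.

Lemma path_sum0 Phi : path_sum 0 Phi = Phi [::].
Proof.
rewrite /path_sum (big_pred1 [tuple]) => [|w]; last by rewrite /= (tuple0 w) /= eqxx.
by rewrite !big_ord0 mul1r add0r.
Qed.

(** The last period is folded into the terminal value, which the supersolution property then bounds
    by the potential one period earlier. *)
Lemma path_sum_ub n (Phi : nat -> seq E -> R) :
  (forall t (h : seq E) e, (t < n)%N -> size h = t -> 0 <= P t h e) ->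
  (forall t (h : seq E), (t < n)%N -> size h = t -> \sum_e P t h e = 1) ->
  (forall t (h : seq E), (t < n)%N -> size h = t ->
     \sum_e P t h e * (f e + Phi t.+1 (rcons h e)) <= Phi t h) ->
  path_sum n (Phi n) <= Phi 0%N [::].
Proof.
elim: n => [|n IH] P0 P1 st; first by rewrite path_sum0.
rewrite path_sumS => [|h hn]; last exact: P1.
apply: le_trans (IH _ _ _); last first.
- by move=> t h tn; apply: st; exact: ltnW.
- by move=> t h tn; apply: P1; exact: ltnW.
- by move=> t h e tn; apply: P0; exact: ltnW.
apply: path_sum_le => [t h e tn|h hn]; first by apply: P0; exact: ltnW.
exact: st.
Qed.

Lemma path_sum_lb n (Phi : nat -> seq E -> R) :
  (forall t (h : seq E) e, (t < n)%N -> size h = t -> 0 <= P t h e) ->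
  (forall t (h : seq E), (t < n)%N -> size h = t -> \sum_e P t h e = 1) ->
  (forall t (h : seq E), (t < n)%N -> size h = t ->
     Phi t h <= \sum_e P t h e * (f e + Phi t.+1 (rcons h e))) ->
  Phi 0%N [::] <= path_sum n (Phi n).
Proof.
elim: n => [|n IH] P0 P1 st; first by rewrite path_sum0.
rewrite path_sumS => [|h hn]; last exact: P1.
apply: le_trans (IH _ _ _) _.
- by move=> t h e tn; apply: P0; exact: ltnW.
- by move=> t h tn; apply: P1; exact: ltnW.
- by move=> t h tn; apply: st; exact: ltnW.
apply: path_sum_le => [t h e tn|h hn]; first by apply: P0; exact: ltnW.
exact: st.
Qed.
End Paths.

Lemma big_option (V : zmodType) (A : finType) (F : option A -> V) :
  \sum_x F x = F None + \sum_a F (Some a).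
Proof.
rewrite (bigD1 None) //=; congr (_ + _).
rewrite (reindex_omap Some id) => [|[a|] //].
by apply: eq_bigl => a; rewrite eqxx.
Qed.

(** * One period of the selling process, and bounds over the horizon *)

Section Market.
Variables (R : realType) (I : market).
Hypothesis validI : valid_market I.
Variable c : placement I.

Let arr_ge0 (j : 'I_(ntype I)) t : 0 <= arr j t. Proof. by case: validI. Qed.
Let arr_le1 (t : 'I_(nper I)) : \sum_j arr j t <= 1. Proof. by case: validI. Qed.
Let phi_ge0 (j : 'I_(ntype I)) S i : 0 <= phi j S i. Proof. by case: validI. Qed.
Let phi_le1 (j : 'I_(ntype I)) S : \sum_i phi j S i <= 1. Proof. by case: validI. Qed.
Let phi_out (j : 'I_(ntype I)) (S : {set 'I_(nprod I)}) k : k \notin S -> phi j S k = 0.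
Proof. by case: validI => ? ? ? ? [h _] /h. Qed.

Lemma big_event (F : event I -> R) :
  \sum_e F e = F None + \sum_j \sum_d
    (F (Some (j, d, None)) + \sum_i F (Some (j, d, Some i))).
Proof.
rewrite big_option; congr (_ + _).
transitivity (\sum_p \sum_x F (Some (p, x))).
  by rewrite pair_bigA /=; apply: eq_bigr => -[p x].
transitivity (\sum_j \sum_d \sum_x F (Some (j, d, x))).
  by rewrite [in RHS]pair_bigA /=; apply: eq_bigr => -[j d].
by apply: eq_bigr => j _; apply: eq_bigr => d _; rewrite big_option.
Qed.

Section Policy.
Variable pi : policy R I.
Hypothesis adm : admissible c pi.

Lemma event_prob_ge0 (t : 'I_(nper I)) (h : seq (event I)) e : size h = t ->
  0 <= event_prob pi t h e.
Proof.
move=> ht; case: e => [[[j d] [i|]]|] /=; last by rewrite ler0q subr_ge0.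
  by have [p0 _ _] := @adm t h j ht; apply: mulr_ge0; [apply: mulr_ge0|]; rewrite ?ler0q.
by have [p0 _ _] := @adm t h j ht; apply: mulr_ge0; [apply: mulr_ge0|]; rewrite ?ler0q ?subr_ge0.
Qed.

(** If [W] does not distinguish a missing arrival from a missing purchase, both collapse into the
    baseline [W None], and only purchases contribute a change. *)
Lemma event_mean (t : 'I_(nper I)) (h : seq (event I)) (W : event I -> R) : size h = t ->
  (forall j d, W (Some (j, d, None)) = W None) ->
  \sum_e event_prob pi t h e * W e = W None + \sum_j ratr (arr j t) * \sum_d pi t h j d *
     \sum_i ratr (phi j d.1 i) * (W (Some (j, d, Some i)) - W None).
Proof.
move=> ht hW; rewrite big_event.
have E j d : event_prob pi t h (Some (j, d, None)) * W (Some (j, d, None)) +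
    \sum_i event_prob pi t h (Some (j, d, Some i)) * W (Some (j, d, Some i)) =
    pi t h j d * (ratr (arr j t) * W None) + ratr (arr j t) *
    (pi t h j d * \sum_i ratr (phi j d.1 i) * (W (Some (j, d, Some i)) - W None)).
  rewrite hW /= rmorphB rmorph1 rmorph_sum /=.
  have -> : \sum_i ratr (phi j d.1 i) * (W (Some (j, d, Some i)) - W None) =
      \sum_i ratr (phi j d.1 i) * W (Some (j, d, Some i)) -
      (\sum_i ratr (phi j d.1 i)) * W None.
    rewrite mulr_suml -sumrB; apply: eq_bigr => i _; exact: mulrBr.
  have -> : \sum_i ratr (arr j t) * pi t h j d * ratr (phi j d.1 i) * W (Some (j, d, Some i)) =
      ratr (arr j t) * pi t h j d * \sum_i ratr (phi j d.1 i) * W (Some (j, d, Some i)).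
    by rewrite mulr_sumr; apply: eq_bigr => i _; rewrite mulrA.
  ring.
have E2 j : \sum_d (event_prob pi t h (Some (j, d, None)) * W (Some (j, d, None)) +
    \sum_i event_prob pi t h (Some (j, d, Some i)) * W (Some (j, d, Some i))) =
    ratr (arr j t) * W None + ratr (arr j t) * \sum_d
    (pi t h j d * \sum_i ratr (phi j d.1 i) * (W (Some (j, d, Some i)) - W None)).
  rewrite (eq_bigr _ (fun d _ => E j d)) big_split /= -mulr_suml -mulr_sumr.
  by have [_ -> _] := @adm t h j ht; rewrite mul1r.
rewrite (eq_bigr _ (fun j _ => E2 j)) big_split /= -mulr_suml rmorphB rmorph1 rmorph_sum /=.
ring.
Qed.

Lemma event_prob_sum (t : 'I_(nper I)) (h : seq (event I)) : size h = t ->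
  \sum_e event_prob pi t h e = 1.
Proof.
move=> ht; have := @event_mean t h (fun=> 1) ht (fun _ _ => erefl).
under eq_bigr => e _ do rewrite mulr1.
move=> ->; rewrite big1 ?addr0 // => j _; rewrite big1 ?mulr0 // => d _.
by rewrite big1 ?mulr0 // => i _; rewrite subrr mulr0.
Qed.

(** [event_prob] takes a period of the horizon and [path_sum] any natural number; the value 0 beyond
    the horizon is a dummy. *)
Definition trans (t : nat) (h : seq (event I)) (e : event I) : R :=
  oapp (fun t' => event_prob pi t' h e) 0 (insub t).

Lemma transE (t : 'I_(nper I)) h e : trans t h e = event_prob pi t h e.
Proof. by rewrite /trans valK. Qed.

Lemma expected_profitE : expected_profit pi =
  path_sum trans (fun e => ratr (event_profit e)) (nper I) (fun=> 0).
Proof.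
apply: eq_bigr => w _; rewrite addr0; congr (_ * _).
by apply: eq_bigr => t _; rewrite transE.
Qed.

Lemma trans_ge0 t (h : seq (event I)) e : (t < nper I)%N -> size h = t -> 0 <= trans t h e.
Proof.
move=> tn ht; rewrite -[t]/(nat_of_ord (Ordinal tn)) transE.
exact: event_prob_ge0.
Qed.

Lemma trans_sum t (h : seq (event I)) : (t < nper I)%N -> size h = t ->
  \sum_e trans t h e = 1.
Proof.
move=> tn ht; rewrite -[t]/(nat_of_ord (Ordinal tn)).
by under eq_bigr => e _ do rewrite transE; rewrite event_prob_sum.
Qed.

Definition potential (psi : 'I_(nprod I) -> 'I_(nware I) -> nat -> R) (h : seq (event I)) : R :=
  \sum_i \sum_l psi i l (stock c h i l).

Lemma potential_none psi h : potential psi (rcons h None) = potential psi h.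
Proof.
apply: eq_bigr => i _; apply: eq_bigr => l _.
by rewrite /stock -cats1 count_cat /= !addn0.
Qed.

Lemma potential_nobuy psi h j d :
  potential psi (rcons h (Some (j, d, None))) = potential psi h.
Proof.
apply: eq_bigr => i _; apply: eq_bigr => l _.
by rewrite /stock -cats1 count_cat /= !addn0.
Qed.

Lemma potential_buy psi h j (d : decision I) i :
  potential psi (rcons h (Some (j, d, Some i))) = potential psi h +
    (if d.2 i is Some l
     then psi i l (stock c h i l).-1 - psi i l (stock c h i l) else 0).
Proof.
have st i' l' : stock c (rcons h (Some (j, d, Some i))) i' l' =
   (stock c h i' l' - ((i == i') && (d.2 i == Some l')))%N.
  by rewrite /stock -cats1 count_cat /= addn0 subnDA.
case E: (d.2 i) => [l|]; last first.
  rewrite addr0; apply: eq_bigr => i' _; apply: eq_bigr => l' _.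
  by rewrite st E andbF subn0.
rewrite /potential (bigD1 i) //= (bigD1 l) //= [in RHS](bigD1 i) //= [in RHS](bigD1 l) //=.
rewrite st E !eqxx subn1.
under eq_bigr => l' h1.
  rewrite st E (_ : (Some l == Some l') = false) ?andbF ?subn0; last first.
    by apply/negbTE; apply: contra h1 => /eqP[->].
  over.
under [X in _ + _ + X = _]eq_bigr => i' h1.
  under eq_bigr => l' _.
    rewrite st (_ : (i == i') = false) ?subn0; last first.
      by rewrite eq_sym; apply/negbTE.
    over.
  over.
by rewrite /=; ring.
Qed.

Lemma step_mean (t : 'I_(nper I)) (h : seq (event I)) (k : R) psi : size h = t ->
  \sum_e trans t h e * (ratr (event_profit e) + (k + potential psi (rcons h e))) =
  k + potential psi h + \sum_j ratr (arr j t) * \sum_d pi t h j d *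
    \sum_i ratr (phi j d.1 i) * (if d.2 i is Some l
      then ratr (profit i j l) - (psi i l (stock c h i l) - psi i l (stock c h i l).-1)
      else 0).
Proof.
move=> ht; under eq_bigr => e _ do rewrite transE.
rewrite event_mean //= => [|j d]; last first.
  by rewrite potential_nobuy potential_none.
rewrite potential_none rmorph0 add0r; congr (_ + _).
apply: eq_bigr => j _; congr (_ * _); apply: eq_bigr => d _; congr (_ * _).
apply: eq_bigr => i _; congr (_ * _); rewrite potential_buy.
by case: (d.2 i) => [l|]; rewrite ?rmorph0; ring.
Qed.
End Policy.

(** Weak duality. The potential is the stock valued at its prices plus the largest gains [m] of the
    remaining periods. Decisions need only be tested against the initial stock, since stock never
    grows. *)
Lemma profit_ub (pi : policy R I) (theta : 'I_(nprod I) -> 'I_(nware I) -> rat)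
    (m : 'I_(ntype I) -> rat) :
  admissible c pi -> (forall i l, 0 <= theta i l) ->
  (forall j (d : decision I),
     (forall i l, i \in d.1 -> d.2 i = Some l -> (0 < c i l)%N) ->
     \sum_i phi j d.1 i * (if d.2 i is Some l then profit i j l - theta i l else 0) <= m j) ->
  expected_profit pi <=
    ratr (\sum_t \sum_j arr j t * m j + \sum_i \sum_l theta i l * (c i l)%:R).
Proof.
move=> adm th0 hm; rewrite expected_profitE.
pose K (t : nat) : R := \sum_(s < nper I | (t <= s)%N) ratr (\sum_j arr j s * m j).
pose psi i l (x : nat) : R := ratr (theta i l) * x%:R.
pose Phi t h := K t + potential psi h.
have KS (t : 'I_(nper I)) : K t = ratr (\sum_j arr j t * m j) + K t.+1.
  rewrite /K (bigD1 t) //=; congr (_ + _); apply: eq_bigl => s.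
  by rewrite ltn_neqAle eq_sym andbC.
have -> : ratr (\sum_t \sum_j arr j t * m j + \sum_i \sum_l theta i l * (c i l)%:R) = Phi 0%N [::].
  rewrite rmorphD /Phi /K /potential !rmorph_sum /=; congr (_ + _).
  apply: eq_bigr => i _; rewrite rmorph_sum; apply: eq_bigr => l _.
  by rewrite /psi /stock /= subn0 rmorphM rmorph_nat.
have P0 := trans_ge0 adm; have P1 := trans_sum adm.
apply: le_trans (path_sum_ub (n := nper I) (Phi := Phi) _ _ _).
- apply: path_sum_le => // h _; rewrite /Phi addr_ge0 ?sumr_ge0 //; last first.
    by move=> i _; apply: sumr_ge0 => l _; rewrite mulr_ge0 ?ler0n ?ler0q.
  by move=> s; rewrite leqNgt ltn_ord.
- by move=> *; apply: P0.
- by move=> *; apply: P1.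
move=> t h tn ht; rewrite -[t]/(nat_of_ord (Ordinal tn)) in ht *.
move: (Ordinal tn) ht => {tn} {}t ht.
rewrite /Phi (step_mean adm) // KS -[X in _ <= X]addrA [X in _ <= X]addrC lerD2l rmorph_sum /=;
  apply: ler_sum => j _.
rewrite rmorphM /= ler_wpM2l ?ler0q //.
have [p0 p1 pS] := @adm t h j ht.
(* A randomized decision is an average, so each decision of nonzero probability is bounded
   separately. *)
rewrite -[X in _ <= X]mul1r -p1 mulr_suml; apply: ler_sum => d _.
have [->|pd] := eqVneq (pi t h j d) 0; first by rewrite !mul0r.
rewrite ler_wpM2l //.
have cpos i l : i \in d.1 -> d.2 i = Some l -> (0 < c i l)%N.
  by move=> iS dl; apply: leq_trans (pS d pd i l iS dl) (leq_subr _ _).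
apply: le_trans (_ : ratr _ <= _); last by rewrite ler_rat; exact: hm cpos.
rewrite rmorph_sum; apply: ler_sum => i _; rewrite rmorphM /=.
have [iS|iS] := boolP (i \in d.1); last by rewrite phi_out // rmorph0 !mul0r.
case E : (d.2 i) => [l|]; last by rewrite rmorph0.
(* Admissibility makes the stock positive, so a sale lowers the linear potential by exactly the
   price. *)
have := pS d pd i l iS E; case: (stock c h i l) => // x _ /=.
by rewrite /psi rmorphB /= -mulrBr -natr1 addrAC subrr add0r mulr1.
Qed.

Lemma profit_lb (dec : 'I_(nper I) -> seq (event I) -> 'I_(ntype I) -> decision I)
    (w : nat -> 'I_(nprod I) -> 'I_(nware I) -> nat -> rat) :
  let pi : policy R I := fun t h j d => (dec t h j == d)%:R in
  admissible c pi -> (forall i l x, w (nper I) i l x = 0) ->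
  (forall (t : 'I_(nper I)) h, size h = t ->
     \sum_i \sum_l w t i l (stock c h i l) <=
     \sum_i \sum_l w t.+1 i l (stock c h i l) +
     \sum_j arr j t * \sum_i phi j (dec t h j).1 i *
       (if (dec t h j).2 i is Some l then profit i j l -
          (w t.+1 i l (stock c h i l) - w t.+1 i l (stock c h i l).-1) else 0)) ->
  ratr (\sum_i \sum_l w 0%N i l (c i l)) <= expected_profit pi.
Proof.
move=> pi adm wT hw; rewrite expected_profitE.
pose psi t i l (x : nat) : R := ratr (w t i l x).
pose Phi t h := 0 + potential (psi t) h.
have potE t h : Phi t h = ratr (\sum_i \sum_l w t i l (stock c h i l)).
  rewrite /Phi add0r rmorph_sum; apply: eq_bigr => i _.
  by rewrite rmorph_sum.
have -> : ratr (\sum_i \sum_l w 0%N i l (c i l)) = Phi 0%N [::].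
  rewrite potE; congr ratr; apply: eq_bigr => i _; apply: eq_bigr => l _.
  by rewrite /stock /= subn0.
have P0 := trans_ge0 adm; have P1 := trans_sum adm.
apply: le_trans (path_sum_lb (P := trans pi) (f := fun e => ratr (event_profit e))
  (n := nper I) (Phi := Phi) _ _ _) _.
- by move=> *; apply: P0.
- by move=> *; apply: P1.
- move=> t h tn ht; rewrite -[t]/(nat_of_ord (Ordinal tn)) in ht *.
  move: (Ordinal tn) ht => {tn} {}t ht.
  rewrite potE /Phi (step_mean adm) //.
  apply: le_trans (_ : ratr _ <= _); first by rewrite ler_rat; exact: hw ht.
  rewrite rmorphD /= le_eqVlt; apply/orP; left; apply/eqP; congr (_ + _).
    by rewrite -potE.
  rewrite rmorph_sum; apply: eq_bigr => j _; rewrite rmorphM /=; congr (_ * _).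
  rewrite [in RHS](bigD1 (dec t h j)) //= [X in _ = _ + X]big1 => [|d dn]; last first.
    by rewrite /pi eq_sym (negPf dn) mul0r.
  rewrite /pi eqxx mul1r addr0 rmorph_sum; apply: eq_bigr => i _; rewrite rmorphM /=.
  by case: ((dec t h j).2 i) => [l|]; rewrite ?rmorph0 // !rmorphB.
apply: path_sum_le => [t h e tn ht|h _]; first exact: P0.
by rewrite potE big1 ?rmorph0 // => i _; rewrite big1.
Qed.
End Market.

(** * The fluid plan and the greedy policy *)

(** Unit steps, with the squared distance to the comparator [b] as potential: the start at 0
    contributes [b ^+ 2] and each step at most [T ^+ 2]. *)
Lemma projected_gradient_regret (K : nat) (a u : nat -> rat) (c b B T : rat) :
  a 0%N = 0 -> (forall k, a k.+1 = Num.max 0 (Num.min B (a k + u k - c))) ->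
  0 <= b <= B -> (forall k, `|u k - c| <= T) ->
  \sum_(k < K) a k * (c - u k) <= b * (\sum_(k < K) (c - u k)) + (b ^+ 2 + K%:R * T ^+ 2) / 2%:R.
Proof.
move=> a0 aS /andP[b0 bB] uT.
suff h : \sum_(k < K) (a k - b) * (c - u k) <= (b ^+ 2 - (a K - b) ^+ 2 + K%:R * T ^+ 2) / 2%:R.
  have e : \sum_(k < K) (a k - b) * (c - u k) =
      \sum_(k < K) a k * (c - u k) - b * (\sum_(k < K) (c - u k)).
    by rewrite mulr_sumr -sumrB; apply: eq_bigr => k _; rewrite mulrBl.
  have : 0 <= (a K - b) ^+ 2 by exact: sqr_ge0.
  by rewrite e in h; lra.
elim: K => [|K IH]; first by rewrite big_ord0 a0 sub0r sqrrN subrr mul0r addr0 mul0r.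
rewrite big_ord_recr /=.
(* Projection onto [0, B] never moves a point away from [b], which lies in that interval. *)
have h : (a K.+1 - b) ^+ 2 <= (a K + u K - c - b) ^+ 2.
  rewrite aS; move: (_ - c) => v.
  case: (leP B v) => vB; first by case: (leP 0 B) => B0; nra.
  by case: (leP 0 v) => v0; nra.
have h2 : (u K - c) ^+ 2 <= T ^+ 2.
  by rewrite -[X in X <= _]real_normK ?num_real // lerXn2r ?nnegrE // (le_trans _ (uT K)).
rewrite -[K.+1%:R]natr1.
have -> : (a K - b) * (c - u K) = ((a K - b) ^+ 2 + (u K - c) ^+ 2 - (a K + u K - c - b) ^+ 2) /
  2%:R by field.
lra.
Qed.

Section Algo.
Variables (I : market) (c : placement I).
Variable Sel : 'I_(ntype I) -> ('I_(nprod I) -> rat) -> {set 'I_(nprod I)}.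
Implicit Types (av : 'I_(nprod I) -> 'I_(nware I) -> bool).
Implicit Types (pr a : 'I_(nprod I) -> 'I_(nware I) -> rat).

Definition best_margin av pr j i : rat :=
  bmax (fun l => if av i l then profit i j l - pr i l else 0).

(** Zero margins are left to the virtual warehouse. A sale from a real one therefore has positive
    profit as soon as the price is nonnegative, which keeps all revenues of the plan nonnegative. *)
Definition best_ware av pr j i : option 'I_(nware I) :=
  bfind (fun l => av i l && ((0 < profit i j l - pr i l) &&
                             (profit i j l - pr i l == best_margin av pr j i))).

Definition sel av pr j := Sel j (best_margin av pr j).

Definition prob_serve av pr j i l : rat :=
  phi j (sel av pr j) i * (best_ware av pr j i == Some l)%:R.

Definition gain av pr j : rat := \sum_i phi j (sel av pr j) i * best_margin av pr j i.

Definition stocked i l : bool := (0 < c i l)%N.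

Definition arr_total j : rat := \sum_t @arr I j t.

(** The dual value at price 0, when stocked resources never run out. It sets the scale of the prices
    and of the overload penalty. *)
Definition free_value : rat := \sum_j arr_total j * gain stocked (fun _ _ => 0) j.

(** With [T = nper I], the regrets add up to at most [nprod I * nware I * free_value * T /
    step_scale], and [free_value] is at most [T] times any dual value. This choice makes the sum at
    most [1 / (7 T)] of the dual value; the 1 added keeps it positive. *)
Definition step_scale : nat := (7 * (nprod I * (nware I * nper I ^ 3)) + 1)%N.

(** Its square is [nsteps * nper I ^ 2], which balances the two regret terms at the largest
    weight. *)
Definition weight_max : nat := (nper I * step_scale)%N.

(* The weight [a] ranges over [0, weight_max], so the price over
   [0, free_value / c].  Division by zero gives price 0 where [c i l = 0]. *)
Definition theta a i l : rat := free_value * a i l / (c i l * weight_max)%:R.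

Definition usage a i l : rat := \sum_j arr_total j * prob_serve stocked (theta a) j i l.

Definition step a i l : rat :=
  Num.max 0 (Num.min weight_max%:R (a i l + usage a i l - (c i l)%:R)).

Definition weight k := iter k step (fun _ _ => 0).

Definition nsteps : nat := (step_scale * step_scale)%N.

(** The share of type-[j] customers to whom the plan sells [i] from [l]. It does not depend on the
    period, so one plan serves non-stationary arrivals; it only feeds the value function and is
    never sampled. *)
Definition serve_rate i l j : rat := (\sum_(k < nsteps) prob_serve stocked (theta (weight k)) j i
  l) / nsteps%:R.

Definition arr_from j t : rat := \sum_(s < nper I) if (t <= s)%N then @arr I j s else 0.

Definition load_from t i l : rat := \sum_j arr_from j t * serve_rate i l j.

Definition revenue_from t i l : rat := \sum_j arr_from j t * serve_rate i l j * profit i j l.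

(** With at most one sale per period, a stock of at least [nper I] cannot run out, so its value
    ignores the stock. Elsewhere [erl] recurses fewer than [nper I] times, although [c i l] is given
    in binary. *)
Definition value_fn t i l x : rat :=
  if (nper I <= c i l)%N then revenue_from t i l else revenue_from t i l * erl (load_from t i l) x.

Definition price t (x : placement I) i l : rat := value_fn t.+1 i l (x i l) - value_fn t.+1 i l
  (x i l).-1.

Definition instock (x : placement I) i l : bool := (0 < x i l)%N.

Definition greedy t (x : placement I) j : decision I :=
  (sel (instock x) (price t x) j, [ffun i => best_ware (instock x) (price t x) j i]).

Hypothesis validI : valid_market I.
Hypothesis Sel_opt : forall j (r : 'I_(nprod I) -> rat) (S : {set 'I_(nprod I)}),
  \sum_(i in S) r i * phi j S i <= \sum_(i in Sel j r) r i * phi j (Sel j r) i.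

Let arr_ge0 (j : 'I_(ntype I)) t : 0 <= arr j t. Proof. by case: validI. Qed.
Let arr_le1 (t : 'I_(nper I)) : \sum_j arr j t <= 1. Proof. by case: validI. Qed.
Let phi_ge0 (j : 'I_(ntype I)) S i : 0 <= phi j S i. Proof. by case: validI. Qed.
Let phi_le1 (j : 'I_(ntype I)) S : \sum_i phi j S i <= 1. Proof. by case: validI. Qed.
Let phi_out (j : 'I_(ntype I)) (S : {set 'I_(nprod I)}) k : k \notin S -> phi j S k = 0.
Proof. by case: validI => ? ? ? ? [h _] /h. Qed.

Lemma best_margin_ge0 av pr j i : 0 <= best_margin av pr j i.
Proof. exact: bmax_ge0. Qed.

Lemma best_margin_ge av pr j i l : av i l -> profit i j l - pr i l <= best_margin av pr j i.
Proof.
move=> h; have := bmax_ge (fun l => if av i l then profit i j l - pr i l else 0) l.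
by rewrite h.
Qed.

Lemma best_ware_some av pr j i l : best_ware av pr j i = Some l ->
  [/\ av i l, 0 < profit i j l - pr i l & profit i j l - pr i l = best_margin av pr j i].
Proof. by move=> /bfind_some /andP[h /andP[h1 /eqP h2]]. Qed.

Lemma best_margin_best_ware av pr j i :
  best_margin av pr j i = if best_ware av pr j i is Some l then profit i j l - pr i l else 0.
Proof.
case E : (best_ware av pr j i) => [l|]; first by have [] := best_ware_some E.
apply: le_anti; rewrite best_margin_ge0 andbT leNgt; apply/negP => h.
have [l hl] := bmax_attained h.
have avl : av i l.
  by case: (av i l) hl => // hl; move: h; rewrite /best_margin -hl ltxx.
rewrite avl in hl; have := bfind_none l E.
by rewrite avl hl h eqxx.
Qed.

Lemma gain_sel av pr j :
  gain av pr j = \sum_(i in sel av pr j) best_margin av pr j i * phi j (sel av pr j) i.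
Proof.
rewrite /gain [in RHS]big_mkcond; apply: eq_bigr => i _ /=.
by case: ifPn => [_|/(phi_out j) ->]; rewrite ?mul0r // mulrC.
Qed.

Lemma gain_ge0 av pr j : 0 <= gain av pr j.
Proof. by apply: sumr_ge0 => i _; rewrite mulr_ge0 // best_margin_ge0. Qed.

(** The choice of warehouses separates from that of the assortment: once every product carries its
    best margin as reward, the oracle optimizes the rest. *)
Lemma gain_opt av pr j (S : {set 'I_(nprod I)}) (f : 'I_(nprod I) -> option 'I_(nware I)) :
  (forall i l, i \in S -> f i = Some l -> av i l) ->
  \sum_i phi j S i * (if f i is Some l then profit i j l - pr i l else 0) <= gain av pr j.
Proof.
move=> h; rewrite gain_sel; apply: le_trans (Sel_opt _ _ S).
rewrite [in X in _ <= X]big_mkcond; apply: ler_sum => i _ /=.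
case: ifPn => [iS|/(phi_out j) ->]; last by rewrite mul0r.
rewrite mulrC ler_wpM2r //; case E : (f i) => [l|]; last exact: best_margin_ge0.
exact: best_margin_ge (h _ _ iS E).
Qed.

Lemma gainE av pr j :
  gain av pr j = \sum_i \sum_l prob_serve av pr j i l * (profit i j l - pr i l).
Proof.
apply: eq_bigr => i _; rewrite best_margin_best_ware /prob_serve.
case: (best_ware av pr j i) => [l|]; last by rewrite mulr0 big1 // => l _; rewrite /= mul0r.
rewrite (bigD1 l) //= eqxx mulr1n mulr1 big1 ?addr0 // => l' h.
by rewrite (_ : (Some l == Some l') = false) ?mulr0n ?mulr0 ?mul0r //; apply/negbTE;
  apply: contra h => /eqP[->].
Qed.

Lemma prob_serve_ge0 av pr j i l : 0 <= prob_serve av pr j i l.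
Proof. by rewrite mulr_ge0 ?ler0n. Qed.

Lemma prob_serve_le1 av pr j i l : prob_serve av pr j i l <= 1.
Proof.
have h : phi j (sel av pr j) i <= 1.
  apply: le_trans (phi_le1 j (sel av pr j)); rewrite (bigD1 i) //= lerDl.
  exact: sumr_ge0.
by rewrite /prob_serve; case: (_ == _); rewrite ?mulr1n ?mulr0n ?mulr1 ?mulr0 ?ler01.
Qed.

Lemma prob_serve_av av pr j i l : ~~ av i l -> prob_serve av pr j i l = 0.
Proof.
move=> h; rewrite /prob_serve; case: eqP => [/best_ware_some[avl]|_]; last by rewrite mulr0n mulr0.
by rewrite avl in h.
Qed.

Lemma prob_serve_profit av pr j i l : 0 <= pr i l ->
  0 <= prob_serve av pr j i l * profit i j l.
Proof.
move=> p0; rewrite /prob_serve; case: eqP => [/best_ware_some[_ h _]|_];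
  last by rewrite mulr0n mulr0 mul0r.
by rewrite mulr1n mulr1 mulr_ge0 //; lra.
Qed.

Lemma arr_total_ge0 j : 0 <= arr_total j. Proof. exact: sumr_ge0. Qed.

Lemma arr_total_sum : \sum_j arr_total j <= (nper I)%:R.
Proof.
rewrite exchange_big /= -[X in X%:R]card_ord -sum1_card natr_sum.
exact: ler_sum.
Qed.

Lemma free_value_ge0 : 0 <= free_value.
Proof. by apply: sumr_ge0 => j _; rewrite mulr_ge0 ?arr_total_ge0 ?gain_ge0. Qed.

Lemma weight_ge0 k i l : 0 <= weight k i l.
Proof. by case: k => [|k]; rewrite //= /step le_max lexx. Qed.

Lemma theta_ge0 k i l : 0 <= theta (weight k) i l.
Proof. by rewrite divr_ge0 ?ler0n // mulr_ge0 ?free_value_ge0 ?weight_ge0. Qed.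

Lemma usage_ge0 a i l : 0 <= usage a i l.
Proof. by apply: sumr_ge0 => j _; rewrite mulr_ge0 ?arr_total_ge0 ?prob_serve_ge0. Qed.

Lemma usage_le a i l : usage a i l <= (nper I)%:R.
Proof.
apply: le_trans arr_total_sum; apply: ler_sum => j _.
by rewrite -[X in _ <= X]mulr1 ler_wpM2l ?arr_total_ge0 ?prob_serve_le1.
Qed.
Lemma nsteps_gt0 : 0 < nsteps%:R :> rat.
Proof. by rewrite ltr0n /nsteps /step_scale addn1. Qed.

Lemma serve_rate_ge0 i l j : 0 <= serve_rate i l j.
Proof.
rewrite divr_ge0 ?ler0n //; apply: sumr_ge0 => k _; exact: prob_serve_ge0.
Qed.

Lemma serve_rate_av i l j : ~~ stocked i l -> serve_rate i l j = 0.
Proof.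
by move=> h; rewrite /serve_rate big1 ?mul0r // => k _; rewrite prob_serve_av.
Qed.

Lemma serve_rate_profit i l j : 0 <= serve_rate i l j * profit i j l.
Proof.
rewrite mulrAC mulr_suml divr_ge0 ?ler0n //; apply: sumr_ge0 => k _.
by apply: prob_serve_profit; exact: theta_ge0.
Qed.

Lemma arr_from_ge0 j t : 0 <= arr_from j t.
Proof. by apply: sumr_ge0 => s _; case: ifP. Qed.

Lemma arr_fromS j (t : 'I_(nper I)) : arr_from j t = @arr I j t + arr_from j t.+1.
Proof.
rewrite /arr_from (bigD1 t) //= leqnn [in RHS](bigD1 t) //= ltnn add0r; congr (_ + _).
by apply: eq_bigr => s st; rewrite [in RHS]ltn_neqAle eq_sym st.
Qed.

Lemma arr_from_end j : arr_from j (nper I) = 0.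
Proof. by rewrite /arr_from big1 // => s _; rewrite leqNgt ltn_ord. Qed.

Lemma arr_from0 j : arr_from j 0 = arr_total j. Proof. by []. Qed.

Lemma load_from_ge0 t i l : 0 <= load_from t i l.
Proof. by apply: sumr_ge0 => j _; rewrite mulr_ge0 ?arr_from_ge0 ?serve_rate_ge0. Qed.

Lemma revenue_from_ge0 t i l : 0 <= revenue_from t i l.
Proof. by apply: sumr_ge0 => j _; rewrite -mulrA mulr_ge0 ?arr_from_ge0 ?serve_rate_profit. Qed.

Lemma value_fn_end i l x : value_fn (nper I) i l x = 0.
Proof.
have h : revenue_from (nper I) i l = 0 by rewrite /revenue_from big1 // => j _;
  rewrite arr_from_end !mul0r.
by rewrite /value_fn h mul0r; case: ifP.
Qed.

(* The greedy decision competes with each best response of the plan, cut down to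
   its sales that are still possible and profitable. *)
Lemma gain_serve_rate av pr j :
  \sum_i \sum_l serve_rate i l j * (if av i l then Num.max 0 (profit i j l - pr i l) else 0)
    <= gain av pr j.
Proof.
pose G i l := if av i l then Num.max 0 (profit i j l - pr i l) else 0.
suff h k : \sum_i \sum_l prob_serve stocked (theta (weight k)) j i l * G i l <= gain av pr j.
  have -> : \sum_i \sum_l serve_rate i l j * G i l =
    (\sum_(k < nsteps) \sum_i \sum_l prob_serve stocked (theta (weight k)) j i l * G i l) /
      nsteps%:R.
    rewrite [in RHS]exchange_big mulr_suml; apply: eq_bigr => i _ /=.
    rewrite [in RHS]exchange_big mulr_suml; apply: eq_bigr => l _ /=.
    by rewrite mulrAC !mulr_suml.
  rewrite ler_pdivrMr ?nsteps_gt0 // mulr_natr -[X in _ *+ X]card_ord -sumr_const.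
  exact: ler_sum.
pose f i := if best_ware stocked (theta (weight k)) j i is Some l
  then (if av i l && (0 <= profit i j l - pr i l) then Some l else None) else None.
apply: le_trans (@gain_opt av pr j (sel stocked (theta (weight k)) j) f _); last first.
  move=> i l _; rewrite /f; case: best_ware => // l'.
  by case: ifP => // /andP[avl _] [<-].
apply: ler_sum => i _; rewrite /prob_serve /f.
case: (best_ware stocked (theta (weight k)) j i) => [l|]; last first.
  by rewrite big1 => [|l _]; rewrite /= mulr0 ?mul0r.
rewrite (bigD1 l) //= eqxx mulr1 big1 => [|l' h]; last first.
  rewrite (_ : (Some l == Some l') = false) ?mulr0n ?mulr0 ?mul0r //.
  by apply/negbTE; apply: contra h => /eqP[->].
rewrite addr0 ler_wpM2l // /G.
case: (av i l) => /=; last by [].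
by case: (leP 0 (profit i j l - pr i l)).
Qed.

(** The Bellman inequality for a single resource: load and revenue are split into this period and
    the later ones, and [erl_value_step] applies. *)
Lemma value_fn_step_res (t : 'I_(nper I)) (x : placement I) i l :
  ((nper I <= c i l)%N -> (0 < x i l)%N) ->
  value_fn t i l (x i l) <= value_fn t.+1 i l (x i l) + \sum_j @arr I j t * (serve_rate i l j *
    (if instock x i l then Num.max 0 (profit i j l - price t x i l) else 0)).
Proof.
move=> hx; pose A := \sum_j @arr I j t * serve_rate i l j * profit i j l.
pose p := \sum_j @arr I j t * serve_rate i l j.
have RE : revenue_from t i l = revenue_from t.+1 i l + A.
  rewrite -big_split; apply: eq_bigr => j _ /=.
  by rewrite arr_fromS; ring.
have ME : load_from t i l = load_from t.+1 i l + p.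
  rewrite -big_split; apply: eq_bigr => j _ /=.
  by rewrite arr_fromS; ring.
have A0 : 0 <= A by apply: sumr_ge0 => j _; rewrite -mulrA mulr_ge0 ?serve_rate_profit.
have p0 : 0 <= p by apply: sumr_ge0 => j _; rewrite mulr_ge0 ?serve_rate_ge0.
(* The positive part of a sum is at most the sum of the positive parts, so the aggregate margin is
   recovered customer type by customer type. *)
have low (q : rat) : Num.max 0 (A - p * q) <= \sum_j @arr I j t * (serve_rate i l j *
    Num.max 0 (profit i j l - q)).
  rewrite ge_max; apply/andP; split.
    apply: sumr_ge0 => j _; apply: mulr_ge0 => //; apply: mulr_ge0; first exact: serve_rate_ge0.
    by rewrite le_max lexx.
  rewrite /A /p mulr_suml -sumrB; apply: ler_sum => j _.
  have -> : @arr I j t * serve_rate i l j * profit i j l - @arr I j t * serve_rate i l j * q =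
    @arr I j t * (serve_rate i l j * (profit i j l - q)) by ring.
  apply: ler_wpM2l => //; apply: ler_wpM2l; first exact: serve_rate_ge0.
  by rewrite le_max lexx orbT.
rewrite /price /instock; have := low (value_fn t.+1 i l (x i l) - value_fn t.+1 i l (x i l).-1).
rewrite /value_fn; case: (leqP (nper I) (c i l)) => hc lo.
  rewrite hx //; move: lo; rewrite subrr mulr0 subr0 => h.
  by rewrite RE lerD2l; apply: le_trans h; rewrite le_max lexx orbT.
case E : (x i l) lo => [|y] lo.
  by rewrite /= !mulr0 add0r; apply: sumr_ge0 => j _; rewrite !mulr0.
rewrite RE ME; apply: le_trans (erl_value_step _ (load_from_ge0 _ _ _) p0 (revenue_from_ge0 _ _
  _) A0) _.
by rewrite lerD2l; move: lo; rewrite [_.-1]/= -mulrBr.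
Qed.

Lemma value_fn_step (t : 'I_(nper I)) (h : seq (event I)) : size h = t ->
  \sum_i \sum_l value_fn t i l (stock c h i l) <=
  \sum_i \sum_l value_fn t.+1 i l (stock c h i l) +
  \sum_j @arr I j t * \sum_i phi j (greedy t (stock c h) j).1 i *
    (if (greedy t (stock c h) j).2 i is Some l then profit i j l -
      (value_fn t.+1 i l (stock c h i l) - value_fn t.+1 i l (stock c h i l).-1) else 0).
Proof.
move=> ht; set x := stock c h.
(* The history has fewer than [nper I] events, each selling at most one unit. *)
have hx i l : (nper I <= c i l)%N -> (0 < x i l)%N.
  move=> cT; rewrite /x /stock subn_gt0; apply: leq_ltn_trans (count_size _ _) _.
  by rewrite ht (leq_trans (ltn_ord t)).
have E j : \sum_i phi j (greedy t x j).1 i *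
    (if (greedy t x j).2 i is Some l then profit i j l -
      (value_fn t.+1 i l (x i l) - value_fn t.+1 i l (x i l).-1) else 0) =
    gain (instock x) (price t x) j.
  by apply: eq_bigr => i _; rewrite ffunE best_margin_best_ware.
rewrite (eq_bigr _ (fun j _ => congr1 (fun z => @arr I j t * z) (E j))).
apply: le_trans (_ : _ <= \sum_i \sum_l value_fn t.+1 i l (x i l) +
   \sum_j @arr I j t * \sum_i \sum_l serve_rate i l j *
    (if instock x i l then Num.max 0 (profit i j l - price t x i l) else 0)) _; last first.
  rewrite lerD2l; apply: ler_sum => j _; rewrite ler_wpM2l //; exact: gain_serve_rate.
have -> : \sum_j @arr I j t * \sum_i \sum_l serve_rate i l j *
    (if instock x i l then Num.max 0 (profit i j l - price t x i l) else 0) =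
   \sum_i \sum_l \sum_j @arr I j t * (serve_rate i l j *
    (if instock x i l then Num.max 0 (profit i j l - price t x i l) else 0)).
  under [RHS]eq_bigr => i _ do rewrite exchange_big.
  rewrite [RHS]exchange_big; apply: eq_bigr => j _ /=.
  rewrite mulr_sumr; apply: eq_bigr => i _; by rewrite mulr_sumr.
rewrite -big_split; apply: ler_sum => i _ /=; rewrite -big_split; apply: ler_sum => l _ /=.
exact: value_fn_step_res (hx i l).
Qed.

(** * Duality gap of the averaged plan *)

Definition dual_value k : rat :=
  \sum_j arr_total j * gain stocked (theta (weight k)) j + \sum_i \sum_l theta (weight k) i l *
    (c i l)%:R.

Definition revenue k i l : rat :=
  \sum_j arr_total j * (prob_serve stocked (theta (weight k)) j i l * profit i j l).

(** Regrouped by resource, the factor of each price is the slack [c - usage], a subgradient of the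
    dual, to which the regret bound applies. *)
Lemma dual_valueE k : dual_value k =
  \sum_i \sum_l (revenue k i l + theta (weight k) i l * ((c i l)%:R - usage (weight k) i l)).
Proof.
have -> : \sum_i \sum_l (revenue k i l + theta (weight k) i l * ((c i l)%:R - usage (weight k) i
  l)) =
  \sum_i \sum_l (revenue k i l - theta (weight k) i l * usage (weight k) i l) +
  \sum_i \sum_l theta (weight k) i l * (c i l)%:R.
  rewrite -big_split; apply: eq_bigr => i _; rewrite -big_split; apply: eq_bigr => l _ /=.
  by rewrite mulrBr addrA addrAC.
congr (_ + _).
rewrite (eq_bigr _ (fun j _ => congr1 (fun z => arr_total j * z) (gainE stocked (theta (weight
  k)) j))).
under eq_bigr => j _ do rewrite mulr_sumr.
rewrite exchange_big; apply: eq_bigr => i _ /=.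
under eq_bigr => j _ do rewrite mulr_sumr.
rewrite exchange_big; apply: eq_bigr => l _ /=.
rewrite /revenue /usage mulr_sumr -sumrB; apply: eq_bigr => j _.
by ring.
Qed.

Lemma revenue_from0E i l : revenue_from 0 i l = (\sum_(k < nsteps) revenue k i l) / nsteps%:R.
Proof.
rewrite [in RHS]exchange_big mulr_suml; apply: eq_bigr => j _ /=.
rewrite arr_from0 /serve_rate -mulr_sumr -mulr_suml; ring.
Qed.

Lemma load_from0E i l : load_from 0 i l = (\sum_(k < nsteps) usage (weight k) i l) / nsteps%:R.
Proof.
rewrite [in RHS]exchange_big mulr_suml; apply: eq_bigr => j _ /=.
rewrite arr_from0 /serve_rate -mulr_sumr; ring.
Qed.

Lemma load_from0_le i l : load_from 0 i l <= (nper I)%:R.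
Proof.
rewrite load_from0E ler_pdivrMr ?nsteps_gt0 // mulr_natr -[X in _ *+ X]card_ord -sumr_const.
by apply: ler_sum => k _; exact: usage_le.
Qed.

Lemma stockedN i l : ~~ stocked i l -> (c i l)%:R = 0 :> rat.
Proof. by rewrite /stocked -eqn0Ngt => /eqP ->. Qed.

Lemma usage_av a i l : ~~ stocked i l -> usage a i l = 0.
Proof. by move=> h; rewrite /usage big1 // => j _; rewrite prob_serve_av // mulr0. Qed.

Lemma revenue_le k : \sum_i \sum_l revenue k i l <= free_value.
Proof.
rewrite /revenue; under eq_bigr => i _ do rewrite exchange_big.
rewrite exchange_big; apply: ler_sum => j _ /=.
under eq_bigr => i _ do rewrite -mulr_sumr.
rewrite -mulr_sumr ler_wpM2l ?arr_total_ge0 //.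
apply: le_trans (@gain_opt stocked (fun _ _ => 0) j (sel stocked (theta (weight k)) j)
  (best_ware stocked (theta (weight k)) j) _); last first.
  by move=> i l _ /best_ware_some[].
apply: ler_sum => i _; rewrite /prob_serve.
case: (best_ware stocked (theta (weight k)) j i) => [l|]; last first.
  by rewrite big1 => [|l _]; rewrite /= mulr0 ?mul0r.
rewrite (bigD1 l) //= eqxx mulr1 big1 => [|l' h]; last first.
  rewrite (_ : (Some l == Some l') = false) ?mulr0n ?mulr0 ?mul0r //.
  by apply/negbTE; apply: contra h => /eqP[->].
by rewrite addr0 subr0.
Qed.

Lemma revenue_ge0 k i l : 0 <= revenue k i l.
Proof.
apply: sumr_ge0 => j _; rewrite mulr_ge0 ?arr_total_ge0 //.
by apply: prob_serve_profit; exact: theta_ge0.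
Qed.

Lemma revenue_from0_le i l : revenue_from 0 i l <= free_value.
Proof.
rewrite revenue_from0E ler_pdivrMr ?nsteps_gt0 // mulr_natr -[X in _ *+ X]card_ord -sumr_const.
apply: ler_sum => k _; apply: le_trans (revenue_le k).
rewrite (bigD1 i) //= (bigD1 l) //= -addrA lerDl addr_ge0 //.
  by apply: sumr_ge0 => l' _; exact: revenue_ge0.
by apply: sumr_ge0 => i' _; apply: sumr_ge0 => l' _; exact: revenue_ge0.
Qed.

Lemma dual_value_ge0 k : 0 <= dual_value k.
Proof.
apply: addr_ge0; first by apply: sumr_ge0 => j _; rewrite mulr_ge0 ?arr_total_ge0 ?gain_ge0.
by apply: sumr_ge0 => i _; apply: sumr_ge0 => l _; rewrite mulr_ge0 ?theta_ge0.
Qed.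

(* The best response at price 0, scaled down by the horizon, respects all stocks. *)
Lemma dual_value_ge k : (0 < nper I)%N -> free_value <= (nper I)%:R * dual_value k.
Proof.
move=> T0; set T : rat := (nper I)%:R; have T1 : 1 <= T by rewrite ler1n.
pose z (i : 'I_(nprod I)) (l : 'I_(nware I)) : rat := 0; set S0 := sel stocked z.
pose th := theta (weight k).
(* The response to price 0 is still available under the prices [th], where it loses only what it
   pays. *)
have h j : gain stocked z j - \sum_i \sum_l prob_serve stocked z j i l * th i l <= T * gain
  stocked th j.
  have g : gain stocked z j - \sum_i \sum_l prob_serve stocked z j i l * th i l <= gain stocked
    th j.
    apply: le_trans (@gain_opt stocked th j (S0 j) (best_ware stocked z j) _); last first.
      by move=> i l _ /best_ware_some[].
    rewrite gainE -sumrB; apply: ler_sum => i _; rewrite -sumrB.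
    under eq_bigr => l _ do rewrite subr0 -mulrBr.
    rewrite /prob_serve; case: (best_ware stocked z j i) => [l|]; last first.
      by rewrite big1 => [|l _]; rewrite /= mulr0 ?mul0r.
    rewrite (bigD1 l) //= eqxx mulr1 big1 => [|l' h]; last first.
      rewrite (_ : (Some l == Some l') = false) ?mulr0n ?mulr0 ?mul0r //.
      by apply/negbTE; apply: contra h => /eqP[->].
    by rewrite addr0.
  by apply: le_trans g _; rewrite ler_peMl ?gain_ge0.
pose u0 i l := \sum_j arr_total j * prob_serve stocked z j i l.
(* At most [T] arrivals are expected, and a stocked resource holds at least one unit. *)
have u0T i l : u0 i l <= T * (c i l)%:R.
  have [hc|hc] := boolP (stocked i l); last first.
    by rewrite /u0 big1 ?stockedN ?mulr0 // => j _; rewrite prob_serve_av ?mulr0.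
  apply: (@le_trans _ _ T); last by rewrite ler_peMr ?ler0n // ler1n.
  apply: le_trans arr_total_sum; apply: ler_sum => j _.
  by rewrite -[X in _ <= X]mulr1 ler_wpM2l ?arr_total_ge0 ?prob_serve_le1.
rewrite /dual_value mulrDr; apply: le_trans (_ : _ <= \sum_j arr_total j * (gain stocked z j -
    \sum_i \sum_l prob_serve stocked z j i l * th i l) + \sum_i \sum_l u0 i l * th i l) _.
  rewrite le_eqVlt; apply/orP; left; apply/eqP.
  have -> : \sum_i \sum_l u0 i l * th i l =
      \sum_j arr_total j * \sum_i \sum_l prob_serve stocked z j i l * th i l.
    under [RHS]eq_bigr => j _ do rewrite mulr_sumr.
    rewrite [RHS]exchange_big; apply: eq_bigr => i _ /=.
    under [RHS]eq_bigr => j _ do rewrite mulr_sumr.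
    rewrite [RHS]exchange_big; apply: eq_bigr => l _ /=.
    by rewrite mulr_suml; apply: eq_bigr => j _; rewrite mulrA.
  by rewrite -big_split; apply: eq_bigr => j _ /=; rewrite -mulrDr subrK.
apply: lerD.
  by rewrite mulr_sumr; apply: ler_sum => j _; rewrite mulrCA ler_wpM2l ?arr_total_ge0 ?h.
rewrite mulr_sumr; apply: ler_sum => i _; rewrite mulr_sumr; apply: ler_sum => l _.
by rewrite [X in _ <= X]mulrCA [X in X <= _]mulrC ler_wpM2l ?theta_ge0 ?u0T.
Qed.

Definition excess i l : rat := Num.max 0 (load_from 0 i l / (c i l)%:R - 1).

Definition regret i l : rat :=
  if (nper I <= c i l)%N then 0 else free_value * (nper I)%:R / step_scale%:R.

(** Usage never exceeds the horizon, so every update is nonpositive and the projection keeps the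
    weight at 0. *)
Lemma weight_big k i l : (nper I <= c i l)%N -> weight k i l = 0.
Proof.
move=> h; elim: k => [//|k IH]; rewrite [weight _]/= /step -/(weight k) IH add0r.
have u : usage (weight k) i l - (c i l)%:R <= 0.
  by rewrite subr_le0; apply: le_trans (usage_le _ _ _) _; rewrite ler_nat.
by apply/max_idPl; rewrite ge_min u orbT.
Qed.

(** The comparator is 0 if the plan does not overload the resource, and [weight_max] otherwise. The
    latter corresponds to the price [free_value / c], at which the comparator term is exactly the
    penalty [free_value * excess]. *)
Lemma regret_bound i l : (0 < c i l)%N ->
  \sum_(k < nsteps) theta (weight k) i l * ((c i l)%:R - usage (weight k) i l) <=
  nsteps%:R * (regret i l - free_value * excess i l).
Proof.
move=> c0; have cr : 0 < (c i l)%:R :> rat by rewrite ltr0n.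
have K0 := nsteps_gt0; rewrite /regret; case: leqP => hc.
  rewrite big1 => [|k _]; last by rewrite /theta weight_big // mulr0 !mul0r.
  rewrite /excess (_ : Num.max _ _ = 0) ?mulr0 ?subrr ?mulr0 //.
  apply/max_idPl; rewrite subr_le0 ler_pdivrMr // mul1r.
  by apply: le_trans (load_from0_le _ _) _; rewrite ler_nat.
have T0 : (0 < nper I)%N by apply: leq_ltn_trans hc.
set T : rat := (nper I)%:R; have Tr : 0 < T by rewrite ltr0n.
have s0 : 0 < step_scale%:R :> rat by rewrite ltr0n /step_scale addn1.
have KE : nsteps%:R = step_scale%:R ^+ 2 :> rat by rewrite /nsteps natrM expr2.
have BE : weight_max%:R = T * step_scale%:R :> rat by rewrite /weight_max natrM.
pose U := \sum_(k < nsteps) ((c i l)%:R - usage (weight k) i l).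
have UE : U = nsteps%:R * ((c i l)%:R - load_from 0 i l).
  rewrite /U sumrB sumr_const card_ord mulrBr load_from0E mulrCA divff ?gt_eqF // mulr1.
  by rewrite mulr_natl.
have uT k : `|usage (weight k) i l - (c i l)%:R| <= T.
  have h1 := usage_le (weight k) i l; have h2 := usage_ge0 (weight k) i l.
  have h3 : (c i l)%:R <= T by rewrite ler_nat ltnW.
  by rewrite ler_norml; lra.
have reg b := @projected_gradient_regret nsteps (fun k => weight k i l) (fun k =>
  usage (weight k) i l)
  (c i l)%:R b weight_max%:R T erefl (fun k => erefl).
pose C : rat := (c i l)%:R; pose q := free_value / (C * weight_max%:R).
have a0 : 0 < weight_max%:R :> rat by rewrite BE mulr_gt0.
have q0 : 0 <= q by rewrite divr_ge0 ?free_value_ge0 // mulr_ge0 // ltW.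
have -> : \sum_(k < nsteps) theta (weight k) i l * ((c i l)%:R - usage (weight k) i l) =
   q * \sum_(k < nsteps) weight k i l * ((c i l)%:R - usage (weight k) i l).
  rewrite mulr_sumr; apply: eq_bigr => k _; rewrite /theta /q natrM -/C.
  by rewrite !mulrA; congr (_ * _); rewrite mulrAC.
have qT : q * (T ^+ 2 * nsteps%:R) <= nsteps%:R * (free_value * T / step_scale%:R).
  have -> : q * (T ^+ 2 * nsteps%:R) = nsteps%:R * (free_value * T / step_scale%:R) / C.
    rewrite /q BE KE; field; rewrite ?gt_eqF //.
  rewrite ler_pdivrMr // ler_peMr ?ler1n //.
  by rewrite !mulr_ge0 ?invr_ge0 ?free_value_ge0 // ltW.
have aK : weight_max%:R ^+ 2 = nsteps%:R * T ^+ 2 by rewrite BE KE; ring.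
rewrite /excess mulrBr; case: (leP (load_from 0 i l) C) => hM.
  rewrite (_ : Num.max _ _ = 0) ?mulr0 ?subr0; last first.
    by apply/max_idPl; rewrite subr_le0 ler_pdivrMr // mul1r.
  apply: le_trans qT; rewrite ler_wpM2l //.
  have := reg 0; rewrite lexx ler0n mul0r add0r expr0n add0r => /(_ isT uT) h.
  apply: le_trans h _; rewrite ler_pdivrMr // [T ^+ 2 * _]mulrC ler_peMr //.
    by rewrite mulr_ge0 ?sqr_ge0 // ltW.
rewrite (_ : Num.max _ _ = load_from 0 i l / C - 1); last first.
  by apply/max_idPr; rewrite subr_ge0 ler_pdivlMr // mul1r ltW.
have := reg weight_max%:R; rewrite ler0n lexx -/U UE aK => /(_ isT uT) h.
apply: le_trans (ler_wpM2l q0 h) _.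
have -> : q * (weight_max%:R * (nsteps%:R * (C - load_from 0 i l)) + (nsteps%:R * T ^+ 2 +
  nsteps%:R * T ^+ 2) / 2%:R) =
   q * (T ^+ 2 * nsteps%:R) - nsteps%:R * (free_value * (load_from 0 i l / C - 1)).
  rewrite /q; field; rewrite ?gt_eqF //.
by rewrite lerD2r.
Qed.

Lemma revenue_from0_av i l : ~~ stocked i l -> revenue_from 0 i l = 0.
Proof. by move=> h; rewrite /revenue_from big1 // => j _; rewrite serve_rate_av // mulr0 mul0r. Qed.

(** The average of the dual values meets the bound, hence so does one of them. Its existence
    suffices: every dual value bounds [J1star], and the program never looks for this iterate. *)
Lemma dual_value_avg : exists k, dual_value k <= \sum_i \sum_l
  (revenue_from 0 i l + (if stocked i l then regret i l - free_value * excess i l else 0)).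
Proof.
pose B := \sum_i \sum_l
  (revenue_from 0 i l + (if stocked i l then regret i l - free_value * excess i l else 0)).
rewrite -/B.
have le : \sum_(k < nsteps) dual_value k <= nsteps%:R * B.
  have -> : \sum_(k < nsteps) dual_value k = \sum_i \sum_l \sum_(k < nsteps)
      (revenue k i l + theta (weight k) i l * ((c i l)%:R - usage (weight k) i l)).
    under eq_bigr => k _ do rewrite dual_valueE.
    by rewrite exchange_big; apply: eq_bigr => i _ /=; rewrite exchange_big.
  rewrite mulr_sumr; apply: ler_sum => i _; rewrite mulr_sumr; apply: ler_sum => l _.
  rewrite big_split /= mulrDr; apply: lerD.
    by rewrite revenue_from0E mulrCA divff ?mulr1 // gt_eqF // nsteps_gt0.
  case: ifPn => h; first exact: regret_bound.
  by rewrite mulr0 big1 // => k _; rewrite usage_av // stockedN // subrr mulr0.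
have [/existsP[k hk]|] := boolP [exists k : 'I_nsteps, dual_value k <= B]; first by exists k.
rewrite negb_exists => /forallP h.
suff : nsteps%:R * B < \sum_(k < nsteps) dual_value k by rewrite ltNge le.
rewrite mulr_natl -[X in _ *+ X]card_ord -sumr_const.
have k0 : (0 < nsteps)%N by have := nsteps_gt0; rewrite ltr0n.
rewrite (bigD1 (Ordinal k0)) //= [X in _ < X](bigD1 (Ordinal k0)) //=.
apply: ltr_leD; first by rewrite ltNge; exact: (h (Ordinal k0)).
by apply: ler_sum => k _; rewrite ltW // ltNge; exact: (h k).
Qed.

Lemma solver_uncap : (forall i l, (0 < c i l)%N -> (nper I <= c i l)%N) ->
  exists k, dual_value k <= \sum_i \sum_l value_fn 0 i l (c i l).
Proof.
move=> hc; have [k hk] := dual_value_avg; exists k; apply: le_trans hk _.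
apply: ler_sum => i _; apply: ler_sum => l _.
case: ifPn => h; last by rewrite revenue_from0_av // addr0 /value_fn revenue_from0_av // mul0r;
  case: ifP.
rewrite /value_fn hc // /regret hc // sub0r gerDl oppr_le0 mulr_ge0 ?free_value_ge0 //.
by rewrite /excess le_max lexx.
Qed.

(** Since [revenue_from] is at most [free_value], subtracting the penalty leaves at most the
    fraction [1 - excess] of the revenue, and [erl_overload] recovers that fraction up to [kap]. *)
Lemma solver_cap (kap : rat) : (0 < nper I)%N -> 0 <= kap <= 1 ->
  (forall i l, (0 < c i l)%N -> kap <= erl (c i l)%:R (c i l)) ->
  exists k, kap * (1 - (7 * nper I)%:R^-1) * dual_value k <= \sum_i \sum_l value_fn 0 i l (c i l).
Proof.
move=> T0 /andP[kap0 kap1] hk; have [k Dk] := dual_value_avg; exists k.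
set T : rat := (nper I)%:R; have Tr : 0 < T by rewrite ltr0n.
have s0 : 0 < step_scale%:R :> rat by rewrite ltr0n /step_scale addn1.
have regT : \sum_i \sum_l (if stocked i l then regret i l else 0) <= (7 * nper I)%:R^-1 *
  dual_value k.
  apply: (@le_trans _ _ ((nprod I * nware I)%:R * (free_value * T / step_scale%:R))).
    rewrite natrM -mulrA mulr_natl -[X in _ *+ X]card_ord -sumr_const; apply: ler_sum => i _.
    rewrite mulr_natl -[X in _ *+ X]card_ord -sumr_const; apply: ler_sum => l _.
    have z : 0 <= free_value * T / step_scale%:R by rewrite !mulr_ge0 ?invr_ge0 ?free_value_ge0
      // ltW.
    by rewrite /regret; case: ifP => // _; case: ifP.
  apply: (@le_trans _ _ ((nprod I * nware I)%:R * (T * dual_value k * T / step_scale%:R))).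
    rewrite ler_wpM2l ?ler0n // ler_wpM2r ?invr_ge0 ?ler0n // ler_wpM2r ?ler0n //.
    exact: dual_value_ge.
  have -> : (nprod I * nware I)%:R * (T * dual_value k * T / step_scale%:R) =
     ((7 * (nprod I * (nware I * nper I ^ 3)))%:R / step_scale%:R) * ((7 * nper I)%:R^-1 *
       dual_value k).
    by rewrite !natrM ?natrX -/T; field; rewrite ?gt_eqF.
  rewrite ler_piMl ?mulr_ge0 ?invr_ge0 ?ler0n ?dual_value_ge0 // ler_pdivrMr // mul1r ler_nat.
  by rewrite /step_scale leq_addr.
have key : dual_value k - (7 * nper I)%:R^-1 * dual_value k <= \sum_i \sum_l
    (revenue_from 0 i l - (if stocked i l then free_value * excess i l else 0)).
  rewrite lerBlDr; apply: le_trans Dk _.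
  apply: le_trans (lerD (lexx _) regT); rewrite -big_split; apply: ler_sum => i _ /=.
  rewrite -big_split; apply: ler_sum => l _ /=.
  by case: ifP => _; lra.
have -> : kap * (1 - (7 * nper I)%:R^-1) * dual_value k = kap * (dual_value k - (7 * nper
  I)%:R^-1 * dual_value k) by ring.
apply: le_trans (ler_wpM2l kap0 key) _; rewrite mulr_sumr; apply: ler_sum => i _.
rewrite mulr_sumr; apply: ler_sum => l _.
case: ifPn => h; last by rewrite revenue_from0_av // subr0 mulr0 /value_fn revenue_from0_av //
  mul0r; case: ifP.
have x0 : 0 <= excess i l by rewrite /excess le_max lexx.
have R0 := revenue_from_ge0 0 i l; have RZ := revenue_from0_le i l.
(* Beyond excess 1 [erl_overload] is vacuous, but there the penalty is at least the revenue and the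
   left side is nonpositive. *)
have w1 : kap * (revenue_from 0 i l * (1 - excess i l)) <= value_fn 0 i l (c i l) \/ 1 < excess i l.
  case: (leP (excess i l) 1) => e1; [left | by right].
  have h1 : kap * (revenue_from 0 i l * (1 - excess i l)) <= erl (c i l)%:R (c i l) *
    (revenue_from 0 i l * (1 - excess i l)).
    by rewrite ler_wpM2r ?hk // mulr_ge0 // subr_ge0.
  apply: le_trans h1 _; rewrite mulrCA /value_fn; case: ifP => hT.
    rewrite ler_piMr // -[X in _ <= X]mul1r; apply: ler_pM;
      rewrite ?erl_ge0 ?subr_ge0 ?erl_le1 ?ler0n //.
    by rewrite gerBl.
  rewrite ler_wpM2l //; exact: erl_overload h (load_from_ge0 _ _ _).
have w0 : 0 <= value_fn 0 i l (c i l).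
  by rewrite /value_fn; case: ifP => // _; rewrite mulr_ge0 // erl_ge0 // load_from_ge0.
have RZx : revenue_from 0 i l * excess i l <= free_value * excess i l by rewrite ler_wpM2r.
case: w1 => [w1|e1].
  by apply: le_trans w1; rewrite ler_wpM2l // mulrBr mulr1 lerD2l lerN2.
apply: le_trans w0; rewrite mulr_ge0_le0 // subr_le0.
by apply: le_trans RZx; rewrite ler_peMr // ltW.
Qed.
End Algo.

(** * The approximation ratio *)

Lemma bigminn_leq (T : finType) (P : pred T) (F : T -> nat) x p :
  P p -> (\big[minn/x]_(q | P q) F q <= F p)%N.
Proof.
move=> Pp; have : p \in index_enum T by exact: mem_index_enum.
elim: (index_enum T) => // q r IH; rewrite in_cons big_cons => /orP[/eqP <-|/IH h].
  by rewrite Pp geq_minl.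
by case: ifP => // _; rewrite geq_min h orbT.
Qed.

Lemma cmin_leq (I : market) (c : placement I) i l : (0 < c i l)%N -> (cmin c <= c i l)%N.
Proof. by move=> h; exact: (@bigminn_leq _ (fun p => 0 < c p.1 p.2)%N (fun p =>
  c p.1 p.2) _ (i, l)). Qed.

Lemma cmin_gt0 (I : market) (c : placement I) i l : (0 < c i l)%N -> (0 < cmin c)%N.
Proof.
move=> h; apply: (big_ind (fun x => 0 < x)%N) => [|x y x0 y0|p //].
  by apply: leq_trans h _; rewrite (bigD1 i) //= (bigD1 l) //= -addnA leq_addr.
by rewrite leq_min x0 y0.
Qed.

Section Ratio.
Variables (R : realType) (I : market) (c : placement I).
Variable Sel : 'I_(ntype I) -> ('I_(nprod I) -> rat) -> {set 'I_(nprod I)}.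
Hypothesis validI : valid_market I.
Hypothesis Sel_opt : forall j (r : 'I_(nprod I) -> rat) (S : {set 'I_(nprod I)}),
  \sum_(i in S) r i * phi j S i <= \sum_(i in Sel j r) r i * phi j (Sel j r) i.

Definition greedy_policy : policy R I :=
  fun t h j d => (greedy c Sel t (stock c h) j == d)%:R.

Lemma greedy_admissible : admissible c greedy_policy.
Proof.
move=> t h j ht; split=> [d||d].
- exact: ler0n.
- rewrite (bigD1 (greedy c Sel t (stock c h) j)) //= /greedy_policy eqxx big1 ?addr0 //.
  by move=> d dn; rewrite eq_sym (negPf dn).
- rewrite /greedy_policy.
  case: (greedy c Sel t (stock c h) j =P d) => [<- _|_]; last by rewrite eqxx.
  by move=> i l _; rewrite ffunE => /best_ware_some[].
Qed.

Lemma J1star_le k : J1star R c <= ratr (dual_value c Sel k).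
Proof.
apply: ge_sup.
  by exists (expected_profit greedy_policy), greedy_policy => //; exact: greedy_admissible.
move=> _ [pi adm ->].
have -> : dual_value c Sel k = \sum_t \sum_j arr j t * gain Sel (stocked c) (theta c Sel (weight
  c Sel k)) j +
   \sum_i \sum_l theta c Sel (weight c Sel k) i l * (c i l)%:R.
  rewrite /dual_value [in RHS]exchange_big /=; congr (_ + _).
  by apply: eq_bigr => j _; rewrite mulr_suml.
apply: profit_ub => // [i l|j d h]; first exact: theta_ge0.
exact: gain_opt.
Qed.

Lemma greedy_ge : ratr (\sum_i \sum_l value_fn c Sel 0 i l (c i l)) <= expected_profit
  greedy_policy.
Proof.
apply: (@profit_lb R I validI c (fun t h j => greedy c Sel t (stock c h) j) (value_fn c Sel)).
- exact: greedy_admissible.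
- exact: value_fn_end.
- by move=> t h ht; exact: value_fn_step.
Qed.

Lemma value_fn0_ge0 : 0 <= \sum_i \sum_l value_fn c Sel 0 i l (c i l).
Proof.
apply: sumr_ge0 => i _; apply: sumr_ge0 => l _; rewrite /value_fn.
have r0 := revenue_from_ge0 c Sel validI 0 i l.
by case: ifP => // _; rewrite mulr_ge0 ?erl_ge0 ?load_from_ge0.
Qed.

(** Here [q] is [cmin] and [n] the stock with the smallest [erl]. From [n * z ^ 2 <= 1] and [q <= n]
    the loss [z] is at most [1 / sqrt q]; [q < T] gives the same bound for the solver error. *)
Lemma ratio_cap (q n T m : nat) : (0 < q)%N -> (q <= n)%N -> (q < T)%N -> (0 < m)%N ->
  Num.max (322%:R / 1000%:R) (1 - m.+1%:R / Num.sqrt q%:R) <=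
  ratr (erl n%:R n * (1 - (7 * T)%:R^-1)) :> R.
Proof.
move=> q0 qn qT m0; have n0 : (0 < n)%N := leq_trans q0 qn.
have k38 := erl_ratio_const n0; have kq := erl_ratio n0.
have k1 := erl_le1 n (ler0n rat n).
rewrite rmorphM rmorphB rmorph1 fmorphV rmorph_nat /=.
have {}k38 : 19%:R / 50%:R <= ratr (erl n%:R n) :> R.
  by move: k38; rewrite -(ler_rat R) fmorph_div !rmorph_nat.
have {}k1 : ratr (erl n%:R n) <= 1 :> R by rewrite -[X in _ <= X](rmorph1 (@ratr R)) ler_rat.
have {}kq : n%:R * (1 - ratr (erl n%:R n)) ^+ 2 + (1 - ratr (erl n%:R n)) <= 1 :> R.
  rewrite -[X in _ <= X](rmorph1 (@ratr R)) -[X in X <= _](_ :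
    ratr (n%:R * (1 - erl n%:R n) ^+ 2 + (1 - erl n%:R n)) = _) ?ler_rat //.
  by rewrite rmorphD rmorphM rmorphXn !rmorphB rmorph1 !rmorph_nat.
move: (ratr (erl n%:R n)) k38 k1 kq => k k38 k1 kq.
have T0 : (0 < T)%N by apply: leq_ltn_trans qT.
have e7 : (7 * T)%:R^-1 <= 7%:R^-1 :> R.
  by rewrite lef_pV2 ?posrE ?ltr0n ?muln_gt0 // ler_nat leq_pmulr.
have e0 : 0 <= (7 * T)%:R^-1 :> R by rewrite invr_ge0 ler0n.
have qr : 0 < q%:R :> R by rewrite ltr0n.
have s0 : 0 < Num.sqrt q%:R :> R by rewrite sqrtr_gt0.
have sq : Num.sqrt q%:R ^+ 2 = q%:R :> R by rewrite sqr_sqrtr // ltW.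
have q1 : 1 <= q%:R :> R by rewrite ler1n.
set s := Num.sqrt q%:R in s0 sq *; set e := (7 * T)%:R^-1 in e7 e0 *.
have s1 : 1 <= s by nra.
have es : e <= s^-1.
  rewrite lef_pV2 ?posrE ?ltr0n ?muln_gt0 //.
  apply: (@le_trans _ _ q%:R); first by rewrite -sq expr2 ler_peMr // ltW.
  by rewrite ler_nat (leq_trans (ltnW qT)) // leq_pmull.
have zs : 1 - k <= s^-1.
  have z0 : 0 <= 1 - k by lra.
  rewrite -[s^-1]mul1r ler_pdivlMr //.
  have nq : q%:R <= n%:R :> R by rewrite ler_nat.
  have h : (s * (1 - k)) ^+ 2 <= 1.
    rewrite exprMn sq; apply: le_trans (_ : n%:R * (1 - k) ^+ 2 <= _).
      by rewrite ler_wpM2r ?sqr_ge0.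
    by apply: le_trans kq; rewrite lerDl.
  by rewrite mulrC -[X in _ <= X](expr1n _ 2) in h *;
    rewrite -(@ler_pXn2r _ 2) ?nnegrE ?mulr_ge0 // ltW.
rewrite ge_max; apply/andP; split.
  have k0 : 0 <= k by apply: le_trans k38; rewrite divr_ge0.
  apply: le_trans (_ : _ <= 19%:R / 50%:R * (1 - 7%:R^-1)) _; first lra.
  apply: ler_pM => //; first by rewrite divr_ge0.
    by rewrite subr_ge0; lra.
  by rewrite lerD2l lerN2.
have m2 : 2%:R / s <= m.+1%:R / s by rewrite ler_wpM2r ?invr_ge0 ?ler_nat // ltW.
have : k * e <= e by rewrite ler_piMl.
have : 2%:R / s = s^-1 + s^-1 by field; rewrite gt_eqF.
lra.
Qed.

Theorem greedy_ratio : (exists i l, (0 < c i l)%N) ->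
  Num.max (322%:R / 1000%:R) (1 - (ntype I).+1%:R / Num.sqrt (cmin c)%:R) * J1star R c
    <= expected_profit greedy_policy.
Proof.
move=> [i0 [l0 c0]]; set F := Num.max _ _.
have F0 : 0 <= F by rewrite /F le_max divr_ge0.
have F1 : F <= 1.
  rewrite /F ge_max gerBl divr_ge0 ?sqrtr_ge0 ?ler0n // andbT.
  by rewrite ler_pdivrMr ?ltr0n // mul1r ler_nat.
have E := greedy_ge; have q0 := cmin_gt0 c0.
(* With no customer types [m.+1 / sqrt q] would not cover two losses, but then the dual value at
   price 0 vanishes. *)
have [m0|m0] := posnP (ntype I).
  have J0 : J1star R c <= 0.
    apply: le_trans (J1star_le 0) _.
    suff -> : dual_value c Sel 0 = 0 by rewrite rmorph0.
    have nj (j : 'I_(ntype I)) : False by case: j => j; rewrite m0.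
    rewrite /dual_value big1 ?add0r => [|j]; last by case: (nj j).
    rewrite big1 // => i _; rewrite big1 // => l _.
    by rewrite /theta /= mulr0 !mul0r.
  apply: le_trans (mulr_ge0_le0 F0 J0) (le_trans _ E).
  by rewrite ler0q value_fn0_ge0.
case: (leqP (nper I) (cmin c)) => hT.
  have [|k hk] := @solver_uncap I c Sel validI.
    by move=> i l h; apply: leq_trans hT (cmin_leq h).
  apply: le_trans (ler_wpM2l F0 (J1star_le k)) _.
  apply: le_trans E; apply: (@le_trans _ _ (ratr (dual_value c Sel k))); last by rewrite ler_rat.
  by rewrite ler_piMl // ler0q dual_value_ge0.
pose P (p : 'I_(nprod I) * 'I_(nware I)) := (0 < c p.1 p.2)%N.
have P0 : P (i0, l0) by [].
(* Minimizing [erl] over the stocked resources avoids comparing its values at different stocks. *)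
case: (arg_minP (fun p => erl (c p.1 p.2)%:R (c p.1 p.2)) P0) => p Pp pmin.
have [||| k hk] := @solver_cap I c Sel validI Sel_opt (erl (c p.1 p.2)%:R (c p.1 p.2)).
- by apply: leq_ltn_trans hT.
- by rewrite erl_ge0 ?erl_le1 ?ler0n.
- by move=> i l h; exact: (pmin (i, l)).
apply: le_trans (ler_wpM2l F0 (J1star_le k)) _; apply: le_trans E.
apply: (@le_trans _ _ (ratr (erl (c p.1 p.2)%:R (c p.1 p.2) * (1 - (7 * nper I)%:R^-1)) * ratr
  (dual_value c Sel k))); last first.
  by rewrite -rmorphM ler_rat.
rewrite ler_wpM2r ?ler0q ?dual_value_ge0 //.
by apply: ratio_cap => //; exact: cmin_leq.
Qed.
End Ratio.

(** * Programs for the best response *)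

Definition enc_mx m n (M : 'I_m -> 'I_n -> rat) : data :=
  enc_fun (fun i => enc_fun (fun l => Leaf (M i l))).

Section Index.
Variables (X : prob) (e : X -> data) (n : X -> nat).

Lemma pt_wk (f : X -> data) : small (fun x => enc_nat (n x)) -> pt e f ->
  pt (@idx_src X e n) (fun y => f (projT1 y)).
Proof. by move=> hn; apply: pt_weak; exact: small_ord. Qed.

Lemma pt_ix : small e -> small (fun x => enc_nat (n x)) ->
  ptn (@idx_src X e n) (fun y => nat_of_ord (projT2 y)).
Proof. by move=> he hn; apply: pt_ind => //; exact: small_ord. Qed.
End Index.

Section Matrix.
Variables (X : prob) (e : X -> data) (m n : X -> nat).
Hypotheses (hm : ptn e m) (hn : ptn e n) (pm : polyb m) (pn : polyb n).

Definition mx_src := @idx_src _ (@idx_src X e m) (fun y => n (projT1 y)).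

Lemma mx_wk (f : X -> data) : pt e f -> pt mx_src (fun z => f (projT1 (projT1 z))).
Proof.
move=> hf; apply: (@pt_wk (extp (fun x => 'I_(m x))) (idx_src e) (fun y => n (projT1 y))
  (fun y => f (projT1 y))); first exact: small_ext (pt_small hn).
exact: pt_wk (pt_small hm) hf.
Qed.

Lemma mx_ix1 : ptn mx_src (fun z => nat_of_ord (projT2 (projT1 z))).
Proof.
apply: (@pt_wk (extp (fun x => 'I_(m x))) (idx_src e) (fun y => n (projT1 y))
  (fun y => enc_nat (projT2 y))).
  exact: small_ext (pt_small hn).
by apply: pt_ix; [exact: pt_src hm | exact: pt_small hm].
Qed.

Lemma mx_ix2 : ptn mx_src (fun z => nat_of_ord (projT2 z)).
Proof.
apply: pt_ix; last exact: small_ext (pt_small hn).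
by apply: pt_src (pt_wk (pt_small hm) hm).
Qed.

Lemma pt_tab_mx (M : forall x, 'I_(m x) -> 'I_(n x) -> rat) :
  ptq mx_src (fun z => M _ (projT2 (projT1 z)) (projT2 z)) ->
  pt e (fun x => enc_mx (M x)).
Proof.
move=> h; apply: pt_tab => //.
apply: (@pt_tab (extp (fun x => 'I_(m x))) (idx_src e) (fun y => n (projT1 y))
   (fun y l => Leaf (M (projT1 y) (projT2 y) l))) => //.
- exact: pt_wk (pt_small hm) hn.
- exact: polyb_ext.
Qed.
End Matrix.

Lemma pt_at (X : prob) (e : X -> data) (m n : X -> nat) (M : forall x, 'I_(m x) -> 'I_(n x) -> rat)
    (i : forall x, 'I_(m x)) (l : forall x, 'I_(n x)) :
  pt e (fun x => enc_mx (M x)) -> ptn e (fun x => nat_of_ord (i x)) ->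
  ptn e (fun x => nat_of_ord (l x)) -> ptq e (fun x => M x (i x) (l x)).
Proof.
move=> hM hi hl; have h := pt_lookup hM hi.
exact: (pt_lookup (F := fun x l => Leaf (M x (i x) l)) h hl).
Qed.

(** * Instances and oracle calls *)

Record instance := Instance {
  mkt : market;
  plc : placement mkt;
  orc : data -> data;
  valid_mkt : valid_market mkt;
  orc_ok : choice_oracle mkt orc }.
Arguments plc : clear implicits.
Arguments orc_ok : clear implicits.

(** The oracle only promises that some optimal set is encoded by its answer. Choice names that set
    for the analysis, while programs handle the answer itself. *)
Definition best_set (s : instance) (j : 'I_(ntype (mkt s))) (r : 'I_(nprod (mkt s)) -> rat) :
  {set 'I_(nprod (mkt s))} := projT1 (cid ((orc_ok s).1 j r)).

Lemma best_setP (s : instance) (j : 'I_(ntype (mkt s))) (r : 'I_(nprod (mkt s)) -> rat) :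
  orc s (Node (Leaf 0) (Node (enc_nat j) (enc_fun (fun i => Leaf (r i))))) = enc_set (best_set j r)
  /\ forall S' : {set 'I_(nprod (mkt s))},
     \sum_(i in S') r i * phi j S' i <= \sum_(i in best_set j r) r i * phi j (best_set j r) i.
Proof. by rewrite /best_set; case: cid. Qed.

Section Over.
Variables (X : prob) (g : X -> instance).

Definition instance_of := (forall x, orac x = orc (g x)) /\ forall x, psz x = input_size (plc (g
  x)).

Hypothesis ov : instance_of.

Local Notation n x := (nprod (mkt (g x))).
Local Notation m x := (ntype (mkt (g x))).
Local Notation L x := (nware (mkt (g x))).
Local Notation T x := (nper (mkt (g x))).

Lemma polyb_input (b : X -> nat) : (forall x, b x <= input_size (plc (g x)))%N -> polyb b.
Proof. by move=> h; apply: polyb_le (polyb_psz X) => x; rewrite ov.2. Qed.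

Lemma polyb_n : polyb (fun x => n x).
Proof. by apply: polyb_input => x; rewrite /input_size; lia. Qed.
Lemma polyb_m : polyb (fun x => m x).
Proof. by apply: polyb_input => x; rewrite /input_size; lia. Qed.
Lemma polyb_L : polyb (fun x => L x).
Proof. by apply: polyb_input => x; rewrite /input_size; lia. Qed.
Lemma polyb_T : polyb (fun x => T x).
Proof. by apply: polyb_input => x; rewrite /input_size; lia. Qed.

Lemma dsize_phi x (j : 'I_(m x)) S (i : 'I_(n x)) :
  (dsize (Leaf (phi j S i)) <= input_size (plc (g x)))%N.
Proof.
apply: leq_trans (leq_addl _ _).
rewrite (bigD1 j) //= leq_max; apply/orP; left.
rewrite (bigD1 S) //= leq_max; apply/orP; left.
by rewrite (bigD1 i) //= leq_max leqnn.
Qed.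

Lemma small_set (S : forall x, {set 'I_(n x)}) : small (fun x => enc_set (S x)).
Proof.
apply: small_fun polyb_n _; apply: polyb_le (polyb_cst _ 2) => y; exact: dsize_bool.
Qed.

Variable e : X -> data.

(** Everything in the instance except the choice model, which is reached through the oracle.
    [base_wk] carries these facts into loop bodies. *)
Record base : Prop := Base {
  base_n : ptn e (fun x => n x);
  base_m : ptn e (fun x => m x);
  base_L : ptn e (fun x => L x);
  base_T : ptn e (fun x => T x);
  base_arr : pt e (fun x => enc_mx (@arr (mkt (g x))));
  base_profit : pt e (fun x => enc_fun (fun i => enc_mx (@profit (mkt (g x)) i)));
  base_plc : pt e (fun x => enc_mx (fun i l => (plc (g x) i l)%:R)) }.

Hypothesis be : base.

Lemma pt_best (j : forall x, 'I_(m x)) (r : forall x, 'I_(n x) -> rat) :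
  ptn e (fun x => nat_of_ord (j x)) -> pt e (fun x => enc_fun (fun i => Leaf (r x i))) ->
  pt e (fun x => enc_set (best_set (j x) (r x))).
Proof.
move=> hj hr.
have hq := pt_pair (pt_cst 0 (pt_src hj)) (pt_pair hj hr).
have E x : orac x (Node (Leaf 0) (Node (enc_nat (j x)) (enc_fun (fun i => Leaf (r x i))))) =
  enc_set (best_set (j x) (r x)) by rewrite ov.1; exact: (best_setP (j x) (r x)).1.
apply: (pt_eq (pt_ask hq _) E).
by apply: small_eq (small_set (fun x => best_set (j x) (r x))) _ => x; rewrite E.
Qed.

(** The answer is small because [input_size] counts the bits of the choice probabilities. *)
Lemma pt_phi (j : forall x, 'I_(m x)) (S : forall x, {set 'I_(n x)}) :
  ptn e (fun x => nat_of_ord (j x)) -> pt e (fun x => enc_set (S x)) ->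
  pt e (fun x => enc_fun (fun i => Leaf (phi (j x) (S x) i))).
Proof.
move=> hj hS; have hq := pt_pair (pt_cst 1 (pt_src hj)) (pt_pair hj hS).
have E x : orac x (Node (Leaf 1) (Node (enc_nat (j x)) (enc_set (S x)))) =
  enc_fun (fun i => Leaf (phi (j x) (S x) i)).
  by rewrite ov.1; exact: (orc_ok (g x)).2.
apply: (pt_eq (pt_ask hq _) E).
have h : small (fun x => enc_fun (fun i => Leaf (phi (j x) (S x) i))).
  apply: small_fun polyb_n _; apply: polyb_le (polyb_ext _ (polyb_psz X)) => y.
  by rewrite ov.2; exact: dsize_phi.
by apply: small_eq h _ => x; rewrite E.
Qed.
End Over.

Lemma instance_of_ext (X : prob) (g : X -> instance) (A : X -> Type) :
  instance_of g -> instance_of (fun y : extp A => g (projT1 y)).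
Proof. by case=> h1 h2; split=> y; [exact: h1 | exact: h2]. Qed.

Lemma base_wk (X : prob) (g : X -> instance) (e : X -> data) (n : X -> nat) :
  small (fun x => enc_nat (n x)) -> base g e ->
  base (fun y : extp (fun x => 'I_(n x)) => g (projT1 y)) (@idx_src X e n).
Proof.
move=> sn [h1 h2 h3 h4 h5 h6 h7].
by split; [move: h1 | move: h2 | move: h3 | move: h4 | move: h5 | move: h6 | move: h7];
  exact: pt_wk.
Qed.

Section Best.
Variables (X : prob) (g : X -> instance) (e : X -> data).
Hypotheses (ov : instance_of g) (be : base g e).

Local Notation n x := (nprod (mkt (g x))).
Local Notation m x := (ntype (mkt (g x))).
Local Notation L x := (nware (mkt (g x))).
Local Notation T x := (nper (mkt (g x))).

Variables (av : forall x, 'I_(n x) -> 'I_(L x) -> bool).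
Variables (pr : forall x, 'I_(n x) -> 'I_(L x) -> rat) (j : forall x, 'I_(m x)).
Hypothesis hav : pt e (fun x => enc_mx (fun i l => (@av x i l)%:R : rat)).
Hypothesis hpr : pt e (fun x => enc_mx (@pr x)).
Hypothesis hj : ptn e (fun x => nat_of_ord (j x)).

Local Notation Y1 := (extp (fun x : X => 'I_(n x))).
Local Notation Y2 := (extp (fun y : Y1 => 'I_(L (projT1 y)))).
Local Notation src := (@mx_src X e (fun x => n x) (fun x => L x)).

Let wk f := mx_wk (base_n be) (base_L be) (f := f).
Let ix1 := mx_ix1 (base_n be) (base_L be).
Let ix2 := mx_ix2 (base_n be) (base_L be).

Lemma pt_margin : ptq src (fun z => profit (projT2 (projT1 z)) (j (projT1 (projT1 z))) (projT2 z)
   - pr (projT2 (projT1 z)) (projT2 z)).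
Proof.
apply: ptqB.
  have h := pt_lookup (wk (base_profit be)) ix1.
  exact: (pt_at (M := fun z : Y2 => @profit (mkt (g (projT1 (projT1 z)))) (projT2 (projT1 z))) h
    (wk hj) ix2).
exact: (pt_at (wk hpr) ix1 ix2).
Qed.

Lemma pt_avail : ptb src (fun z => av (projT2 (projT1 z)) (projT2 z)).
Proof. exact: (pt_at (wk hav) ix1 ix2). Qed.

Lemma pt_best_margin : pt e (fun x => enc_fun (fun i =>
  Leaf (best_margin (@av x) (@pr x) (j x) i))).
Proof.
apply: pt_tab (base_n be) (polyb_n ov) _.
apply: (@ptq_bmax (extp (fun x => 'I_(n x))) (idx_src e) (fun y => L (projT1 y))
  (fun y l => if av (projT2 y) l then profit (projT2 y) (j (projT1 y)) l - pr (projT2 y) l else 0)).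
- exact: pt_wk (pt_small (base_n be)) (base_L be).
- exact: polyb_ext (polyb_L ov).
exact: ptq_if pt_avail pt_margin (pt_cst 0 (pt_src pt_avail)).
Qed.

Lemma pt_best_ware : pt e (fun x => enc_fun (fun i => enc_opt (best_ware (@av x) (@pr x) (j x) i))).
Proof.
apply: pt_tab (base_n be) (polyb_n ov) _.
apply: (@pt_bfind (extp (fun x => 'I_(n x))) (idx_src e) (fun y => L (projT1 y))
  (fun y l => av (projT2 y) l && ((0 < profit (projT2 y) (j (projT1 y)) l - pr (projT2 y) l) &&
     (profit (projT2 y) (j (projT1 y)) l - pr (projT2 y) l ==
      best_margin (@av (projT1 y)) (@pr (projT1 y)) (j (projT1 y)) (projT2 y))))).
- exact: pt_wk (pt_small (base_n be)) (base_L be).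
- exact: polyb_ext (polyb_L ov).
apply: ptb_and; first exact: pt_avail.
apply: ptb_and; first exact: ptb_lt (pt_cst 0 (pt_src pt_avail)) pt_margin.
apply: ptb_eq; first exact: pt_margin.
exact: (pt_lookup (wk pt_best_margin) ix1).
Qed.

Lemma pt_sel : pt e (fun x => enc_set (sel (@best_set (g x)) (@av x) (@pr x) (j x))).
Proof. exact: pt_best ov _ _ _ hj pt_best_margin. Qed.

Lemma pt_gain : ptq e (fun x => gain (@best_set (g x)) (@av x) (@pr x) (j x)).
Proof.
apply: ptq_sum (base_n be) (polyb_n ov) _.
have hi := pt_ix (pt_src (base_n be)) (pt_small (base_n be)).
have w f (h : pt e f) := pt_wk (pt_small (base_n be)) h.
apply: ptqM.
  exact: (pt_lookup (w _ (pt_phi ov hj pt_sel)) hi).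
exact: (pt_lookup (w _ pt_best_margin) hi).
Qed.

Lemma pt_serve (i : forall x, 'I_(n x)) (l : forall x, 'I_(L x)) :
  ptn e (fun x => nat_of_ord (i x)) -> ptn e (fun x => nat_of_ord (l x)) ->
  ptq e (fun x => prob_serve (@best_set (g x)) (@av x) (@pr x) (j x) (i x) (l x)).
Proof.
move=> hi hl; apply: ptqM; first exact: (pt_lookup (pt_phi ov hj pt_sel) hi).
have hw := pt_lookup pt_best_ware hi; have he := pt_src hi.
have hb : ptb e (fun x => isSome (best_ware (@av x) (@pr x) (j x) (i x))).
  apply: pt_eq (pt_if hw (pt_cst 1 he) (pt_cst 0 he)) _ => x.
  by case: best_ware => [?|] //=; rewrite eqxx.
(* [Fst] turns the encoding of [None] into 0, which could be mistaken for warehouse 0; the flag [hb]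
   excludes this. *)
have hv : ptn e (fun x => if best_ware (@av x) (@pr x) (j x) (i x) is Some l' then nat_of_ord l'
  else 0%N).
  by apply: pt_eq (pt_fst hw) _ => x; case: best_ware.
apply: pt_eq (ptb_and hb (ptn_eq hv hl)) _ => x.
by case: best_ware.
Qed.
End Best.

(** * Programs for the fluid plan *)

Lemma mbits_sum k (F : 'I_k -> rat) : (mbits (\sum_j F j) <= 1 + \sum_j (mbits (F j)).+1)%N.
Proof.
rewrite -[X in mbits X]big_enum -foldl_sum.
apply: leq_trans (mbits_foldl _ _ _ mbitsD) _.
by rewrite (mbits_bool false) big_enum.
Qed.

Lemma dsize_in k (F : 'I_k -> data) (i : 'I_k) : (dsize (F i) <= dsize (enc_fun F))%N.
Proof. by rewrite dsize_enc_fun (bigD1 i) //= -addnA addSn leqW // leq_addr. Qed.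

Lemma mbits_in_mx k1 k2 (M : 'I_k1 -> 'I_k2 -> rat) i l : (mbits (M i l) <= dsize (enc_mx M))%N.
Proof.
apply: leq_trans (mbits_dsize _) _; apply: leq_trans (dsize_in (fun l => Leaf (M i l)) l) _.
exact: (dsize_in (fun i => enc_fun (fun l => Leaf (M i l)))).
Qed.

Lemma small_mx (X : prob) (m n : X -> nat) (M : forall x, 'I_(m x) -> 'I_(n x) ->
  rat) (B : X -> nat) :
  polyb m -> polyb n -> polyb B -> (forall x i l, mbits (M x i l) <= B x)%N ->
  small (fun x => enc_mx (M x)).
Proof.
move=> pm pn pB hB; apply: small_fun => //.
apply: (@small_fun (extp (fun x => 'I_(m x))) (fun y => n (projT1 y))
  (fun y l => Leaf (M (projT1 y) (projT2 y) l))); first exact: polyb_ext.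
have p2 := polyb_ext (fun y : extp (fun x => 'I_(m x)) => 'I_(n (projT1 y)))
  (polyb_ext (fun x => 'I_(m x)) (polybD pB pB)).
by apply: polyb_le p2 => z; apply: leq_trans (dsize_rat _) _; rewrite leq_add.
Qed.

Section Consts.
Variables (X : prob) (g : X -> instance) (e : X -> data).
Hypotheses (ov : instance_of g) (be : base g e).

Local Notation n x := (nprod (mkt (g x))).
Local Notation m x := (ntype (mkt (g x))).
Local Notation L x := (nware (mkt (g x))).
Local Notation T x := (nper (mkt (g x))).

Let he := pt_src (base_n be).

Lemma pt_mx (M : forall x, 'I_(n x) -> 'I_(L x) -> rat) :
  ptq (@mx_src X e (fun x => n x) (fun x => L x)) (fun z => M _ (projT2 (projT1 z)) (projT2 z)) ->
  pt e (fun x => enc_mx (M x)).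
Proof. exact: pt_tab_mx (base_n be) (base_L be) (polyb_n ov) (polyb_L ov) _. Qed.

Let wk f := mx_wk (base_n be) (base_L be) (f := f).
Let ix1 := mx_ix1 (base_n be) (base_L be).
Let ix2 := mx_ix2 (base_n be) (base_L be).

Lemma pt_stocked : pt e (fun x => enc_mx (fun i l => (stocked (plc (g x)) i l)%:R)).
Proof.
apply: pt_mx; have h := pt_at (wk (base_plc be)) ix1 ix2.
apply: pt_eq (ptb_lt (pt_cst 0 (pt_src h)) h) _ => z.
by rewrite ltr0n.
Qed.

Lemma pt_zero : pt e (fun x => enc_mx (fun (i : 'I_(n x)) (l : 'I_(L x)) => 0)).
Proof. by apply: pt_mx; apply: pt_cst; exact: pt_src ix1. Qed.

Lemma pt_step_scale : ptn e (fun x => step_scale (mkt (g x))).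
Proof.
apply: ptnD (ptn_cst 1 he); apply: ptnM (ptn_cst 7 he) _.
apply: ptnM (base_n be) _; apply: ptnM (base_L be) _.
apply: pt_eq (ptnM (base_T be) (ptnM (base_T be) (base_T be))) _ => x.
by rewrite !expnS expn0 muln1.
Qed.

Lemma polyb_step_scale : polyb (fun x => step_scale (mkt (g x))).
Proof.
apply: polybD (polyb_cst _ 1); apply: polybM (polyb_cst _ 7) _.
apply: polybM (polyb_n ov) _; apply: polybM (polyb_L ov) _.
exact: polybX (polyb_T ov).
Qed.

Lemma pt_weight_max : ptn e (fun x => weight_max (mkt (g x))).
Proof. exact: ptnM (base_T be) pt_step_scale. Qed.

Lemma pt_nsteps : ptn e (fun x => nsteps (mkt (g x))).
Proof. exact: ptnM pt_step_scale pt_step_scale. Qed.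

Lemma polyb_nsteps : polyb (fun x => nsteps (mkt (g x))).
Proof. exact: polybM polyb_step_scale polyb_step_scale. Qed.

Lemma pt_arr_total (j : forall x, 'I_(m x)) : ptn e (fun x => nat_of_ord (j x)) ->
  ptq e (fun x => arr_total (j x)).
Proof.
move=> hj; apply: ptq_sum (base_T be) (polyb_T ov) _.
have sT := pt_small (base_T be).
exact: (pt_at (pt_wk sT (base_arr be)) (pt_wk sT hj) (pt_ix he sT)).
Qed.

Lemma pt_arr_from (j : forall x, 'I_(m x)) (t : X -> nat) : ptn e (fun x => nat_of_ord (j x)) ->
  ptn e t -> ptq e (fun x => arr_from (j x) (t x)).
Proof.
move=> hj ht; apply: ptq_sum (base_T be) (polyb_T ov) _.
have sT := pt_small (base_T be); have hs := pt_ix he sT.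
apply: ptq_if; first exact: ptn_le (pt_wk sT ht) hs.
  exact: (pt_at (pt_wk sT (base_arr be)) (pt_wk sT hj) hs).
exact: pt_cst (pt_src hs).
Qed.
End Consts.

Section Solver.
Variables (X : prob) (g : X -> instance) (e : X -> data).
Hypotheses (ov : instance_of g) (be : base g e).

Local Notation n x := (nprod (mkt (g x))).
Local Notation m x := (ntype (mkt (g x))).
Local Notation L x := (nware (mkt (g x))).
Local Notation T x := (nper (mkt (g x))).
Local Notation Ym := (extp (fun x : X => 'I_(m x))).

Lemma pt_free_value : ptq e (fun x => free_value (plc (g x)) (@best_set (g x))).
Proof.
apply: ptq_sum (base_m be) (polyb_m ov) _.
have sm := pt_small (base_m be); have hj := pt_ix (pt_src (base_m be)) sm.
have be' := base_wk sm be; have ov' : instance_of (fun y : Ym => g (projT1 y)) :=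
  instance_of_ext _ ov.
apply: ptqM; first exact: (pt_arr_total ov' be' hj).
exact: (pt_gain ov' be' (pt_stocked ov' be') (pt_zero ov' be') hj).
Qed.
End Solver.

Section Theta.
Variables (X : prob) (g : X -> instance) (e : X -> data).
Hypotheses (ov : instance_of g) (be : base g e).

Local Notation n x := (nprod (mkt (g x))).
Local Notation m x := (ntype (mkt (g x))).
Local Notation L x := (nware (mkt (g x))).
Local Notation T x := (nper (mkt (g x))).

Variable a : forall x, 'I_(n x) -> 'I_(L x) -> rat.
Hypothesis ha : pt e (fun x => enc_mx (@a x)).

Lemma pt_theta : pt e (fun x => enc_mx (theta (plc (g x)) (@best_set (g x)) (@a x))).
Proof.
apply: (pt_mx ov be).
have wk f := mx_wk (base_n be) (base_L be) (f := f).
have ix1 := mx_ix1 (base_n be) (base_L be).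
have ix2 := mx_ix2 (base_n be) (base_L be).
apply: ptq_div; first apply: ptqM.
- exact: wk (pt_free_value ov be).
- exact: (pt_at (wk _ ha) ix1 ix2).
apply: ptnM; last exact: wk (pt_weight_max be).
exact: (pt_at (wk _ (base_plc be)) ix1 ix2).
Qed.
End Theta.

Section Usage.
Variables (X : prob) (g : X -> instance) (e : X -> data).
Hypotheses (ov : instance_of g) (be : base g e).

Local Notation n x := (nprod (mkt (g x))).
Local Notation m x := (ntype (mkt (g x))).
Local Notation L x := (nware (mkt (g x))).
Local Notation T x := (nper (mkt (g x))).
Local Notation Ym := (extp (fun x : X => 'I_(m x))).

Variable a : forall x, 'I_(n x) -> 'I_(L x) -> rat.
Hypothesis ha : pt e (fun x => enc_mx (@a x)).

Lemma pt_usage (i : forall x, 'I_(n x)) (l : forall x, 'I_(L x)) :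
  ptn e (fun x => nat_of_ord (i x)) -> ptn e (fun x => nat_of_ord (l x)) ->
  ptq e (fun x => usage (plc (g x)) (@best_set (g x)) (@a x) (i x) (l x)).
Proof.
move=> hi hl; apply: ptq_sum (base_m be) (polyb_m ov) _.
have sm := pt_small (base_m be); have hj := pt_ix (pt_src (base_m be)) sm.
have be' := base_wk sm be; have ov' : instance_of (fun y : Ym => g (projT1 y)) :=
  instance_of_ext _ ov.
apply: ptqM; first exact: (pt_arr_total ov' be' hj).
have ht := pt_wk sm (pt_theta ov be ha).
exact: (pt_serve ov' be' (pt_stocked ov' be') ht hj (pt_wk sm hi) (pt_wk sm hl)).
Qed.
End Usage.

Section Step.
Variables (X : prob) (g : X -> instance) (e : X -> data).
Hypotheses (ov : instance_of g) (be : base g e).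

Local Notation n x := (nprod (mkt (g x))).
Local Notation m x := (ntype (mkt (g x))).
Local Notation L x := (nware (mkt (g x))).
Local Notation T x := (nper (mkt (g x))).
Local Notation Y1 := (extp (fun x : X => 'I_(n x))).
Local Notation Y2 := (extp (fun y : Y1 => 'I_(L (projT1 y)))).

Lemma base_mx : base (fun z : Y2 => g (projT1 (projT1 z))) (@mx_src X e (fun x =>
  n x) (fun x => L x)).
Proof.
have b1 := base_wk (pt_small (base_n be)) be.
exact: base_wk (pt_small (base_L b1)) b1.
Qed.

Lemma instance_mx : instance_of (fun z : Y2 => g (projT1 (projT1 z))).
Proof. exact: instance_of_ext (instance_of_ext _ ov). Qed.

Variable a : forall x, 'I_(n x) -> 'I_(L x) -> rat.
Hypothesis ha : pt e (fun x => enc_mx (@a x)).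

Lemma pt_step : pt e (fun x => enc_mx (step (plc (g x)) (@best_set (g x)) (@a x))).
Proof.
apply: (pt_mx ov be).
have wk f := mx_wk (base_n be) (base_L be) (f := f).
have ix1 := mx_ix1 (base_n be) (base_L be).
have ix2 := mx_ix2 (base_n be) (base_L be).
apply: ptq_max; first exact: pt_cst (pt_src ix1).
apply: ptq_min; first exact: wk (pt_weight_max be).
apply: ptqB; last exact: (pt_at (wk _ (base_plc be)) ix1 ix2).
apply: ptqD; first exact: (pt_at (wk _ ha) ix1 ix2).
exact: (pt_usage instance_mx base_mx (wk _ ha) ix1 ix2).
Qed.

(** The prices affect the usage only through the sets and warehouses they select, so its size is
    bounded by arrival and choice probabilities alone, whatever the weights [b]. *)
Lemma mbits_usage : exists U : X -> nat, polyb U /\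
  forall x (b : 'I_(n x) -> 'I_(L x) -> rat) i l,
    (mbits (usage (plc (g x)) (@best_set (g x)) b i l) <= U x)%N.
Proof.
have sm := pt_small (base_m be).
have b1 := base_wk sm be.
have ov1 : instance_of (fun y : extp (fun x : X => 'I_(m x)) => g (projT1 y)) :=
  instance_of_ext _ ov.
have pL := pt_small (pt_arr_total ov1 b1 (pt_ix (pt_src (base_m be)) sm)).
exists (fun x => 1 + \sum_(j < m x) (dsize (Leaf (arr_total j)) + (input_size (plc (g x)) +
  1)).+1)%N; split.
  apply: polybD (polyb_cst _ 1) _; apply: polyb_sum (polyb_m ov) _.
  apply: polyb_le (polybD pL (polybD (polyb_psz _) (polyb_cst _ 2))) => y.
  by rewrite ov1.2; lia.
move=> x b i l; apply: leq_trans (mbits_sum _) _; rewrite leq_add2l leq_sum // => j _.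
rewrite ltnS; apply: leq_trans (mbitsM _ _) _; apply: leq_add; first exact: mbits_dsize.
apply: leq_trans (mbitsM _ _) _; rewrite mbits_bool leq_add2r.
exact: leq_trans (mbits_dsize _) (dsize_phi _ _ _).
Qed.

(** By [mbits_usage] the previous weight enters the size of the next one only as a summand, so the
    bits grow linearly in the number of steps instead of compounding. *)
Lemma mbits_weight : exists U : X -> nat, polyb U /\
  forall x k i l, (mbits (weight (plc (g x)) (@best_set (g x)) k i l) <= 1 + k * U x)%N.
Proof.
have [U [pU hU]] := mbits_usage.
(* The 5 counts the bit of the constant 0 and one bit each for maximum, minimum, difference and
   sum. *)
exists (fun x => dsize (enc_nat (weight_max (mkt (g x)))) + (U x + (dsize (enc_mx (fun i l =>
  (plc (g x) i l)%:R)) + 5)))%N.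
split.
  apply: polybD (pt_small (pt_weight_max be)) _; apply: polybD pU _.
  exact: polybD (pt_small (base_plc be)) (polyb_cst _ 5).
move=> x; elim=> [|k IH] i l; first by rewrite (mbits_bool false).
rewrite [weight _]/= /step; apply: leq_trans (mbits_max _ _) _.
rewrite (mbits_bool false) mulSn.
have h1 := mbits_min (weight_max (mkt (g x)))%:R (weight (plc (g x)) (@best_set (g x)) k i l +
  usage (plc (g x)) (@best_set (g x)) (weight (plc (g x)) (@best_set (g x)) k) i l - (plc (g x) i
    l)%:R).
have h2 := mbitsB (weight (plc (g x)) (@best_set (g x)) k i l +
  usage (plc (g x)) (@best_set (g x)) (weight (plc (g x)) (@best_set (g x)) k) i l) (plc (g x) i
    l)%:R.
have h3 := mbitsD (weight (plc (g x)) (@best_set (g x)) k i l)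
  (usage (plc (g x)) (@best_set (g x)) (weight (plc (g x)) (@best_set (g x)) k) i l).
have h4 := hU x (weight (plc (g x)) (@best_set (g x)) k) i l.
have h5 := mbits_in_mx (fun i l => (plc (g x) i l)%:R : rat) i l.
have h6 := mbits_dsize (weight_max (mkt (g x)))%:R.
have h7 := IH i l; rewrite -/(weight _ _ k).
move: (mbits (Num.min _ _)) h1 => v1 h1; move: (mbits (_ - _)) h1 h2 => v2 h1 h2.
move: (mbits (_ + _)) h2 h3 => v3 h2 h3; move: (mbits (usage _ _ _ _ _)) h3 h4 => v4 h3 h4.
move: (mbits (plc (g x) i l)%:R) h2 h5 => v5 h2 h5;
  move: (mbits (weight_max _)%:R) h1 h6 => v6 h1 h6.
move: (mbits (weight _ _ k i l)) h3 h7 => v7 h3 h7.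
move: h6; rewrite -/(enc_nat _).
move: (dsize (enc_nat _)) (dsize (enc_mx _)) h5 h7 => v8 v9 h5 h7 h6.
move: (k * _)%N h7 => w h7; lia.
Qed.

End Step.

Section Erl.
Variables (X : prob) (e : X -> data) (M : X -> rat) (x : X -> nat).

(** The previous value occurs only once in the recurrence, so sizes add up rather than double. *)
Lemma mbits_erl (q : rat) k n : (k <= n)%N ->
  (mbits (erl q k) <= 1 + k * (2 * nbits n + mbits q + 4))%N.
Proof.
elim: k => [|k IH] kn; first by rewrite (mbits_bool false).
have h1 : (mbits k.+1%:R <= nbits n)%N by rewrite mbits_nat leq_nbits.
rewrite [erl _ _]/=; apply: leq_trans (mbits_div _ _) _.
have h2 := mbitsD k.+1%:R (q * (1 - erl q k)); have h3 := mbitsM q (1 - erl q k).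
have h4 := mbitsB 1 (erl q k); have h5 := IH (ltnW kn).
have h6 : mbits 1 = 1%N := mbits_bool true.
rewrite h6 in h4; rewrite mulSn.
move: (mbits (_ + _)) h2 => v1 h2; move: (mbits (_ * _)) h2 h3 => v2 h2 h3.
move: (mbits (_ - _)) h3 h4 => v3 h3 h4; move: (mbits (erl q k)) h4 h5 => v4 h4 h5.
move: (mbits k.+1%:R) h1 h2 => v5 h1 h2.
move: (mbits q) h3 h5 => v6 h3 h5; move: (nbits n) h1 h5 => v7 h1 h5.
move: (k * _)%N h5 => w h5; lia.
Qed.

Lemma pt_erl : ptq e M -> ptn e x -> polyb x -> ptq e (fun y => erl (M y) (x y)).
Proof.
move=> hM hx px; have he := pt_src hx.
apply: (pt_iter (acc := fun y k => Leaf (erl (M y) k))) => //; first exact: pt_cst.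
have sacc : small (fun y : extp (fun y : X => 'I_(x y)) => Leaf (erl (M (projT1 y)) (projT2 y))).
  have p : polyb (fun y : X => 1 + x y * (2 * dsize (enc_nat (x y)) + dsize (Leaf (M y)) + 4))%N.
    apply: polybD (polyb_cst _ 1) _; apply: polybM px _.
    apply: polybD (polybD (polybM (polyb_cst _ 2) (pt_small hx)) (pt_small hM)) (polyb_cst _ 4).
  apply: polyb_le (polyb_ext _ (polybD p p)) => y; apply: leq_trans (dsize_rat _) _.
  suff h : (mbits (erl (M (projT1 y)) (projT2 y)) <= 1 + x (projT1 y) *
     (2 * dsize (enc_nat (x (projT1 y))) + dsize (Leaf (M (projT1 y))) + 4))%N by exact: leq_add.
  apply: leq_trans (mbits_erl _ (ltnW (ltn_ord (projT2 y)))) _.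
  rewrite leq_add2l leq_mul ?(ltnW (ltn_ord _)) // leq_add2r leq_add ?mbits_dsize //.
  by rewrite leq_mul2l dsize_nat leq_addr.
have [h1 h2] := pt_loop_src (acc := fun y k => Leaf (erl (M y) k)) he (pt_small hx) sacc.
have hk := pt_trans h1 (pt_ix he (pt_small hx)).
have hk1 := ptnD hk (ptn_cst 1 (pt_src hk)).
have hM' := pt_trans h1 (pt_wk (pt_small hx) hM).
have h1' := pt_cst 1 (pt_src hk).
apply: pt_eq (ptq_div hk1 (ptqD hk1 (ptqM hM' (ptqB h1' h2)))) _ => y /=.
by rewrite addn1.
Qed.
End Erl.

Section Iterates.
Variables (X : prob) (g : X -> instance) (e : X -> data).
Hypotheses (ov : instance_of g) (be : base g e).

Local Notation n x := (nprod (mkt (g x))).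
Local Notation m x := (ntype (mkt (g x))).
Local Notation L x := (nware (mkt (g x))).
Local Notation T x := (nper (mkt (g x))).

Lemma pt_weight (k : X -> nat) : ptn e k -> polyb k ->
  pt e (fun x => enc_mx (weight (plc (g x)) (@best_set (g x)) (k x))).
Proof.
move=> hk pk; have he := pt_src hk.
pose acc x i := enc_mx (weight (plc (g x)) (@best_set (g x)) i).
pose Yk := extp (fun x : X => 'I_(k x)).
have ovk : instance_of (fun y : Yk => g (projT1 y)) := instance_of_ext _ ov.
have sacc : small (fun y : Yk => acc (projT1 y) (projT2 y)).
  have [U [pU hU]] := mbits_weight ov be.
  apply: (small_mx (B := fun y : Yk => (1 + k (projT1 y) * U (projT1 y))%N)).
  - exact: (polyb_n ovk).
  - exact: (polyb_L ovk).
  - apply: polybD (polyb_cst _ 1) _; apply: polybM; exact: polyb_ext.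
  - move=> y i l; apply: leq_trans (hU _ _ _ _) _.
    by rewrite leq_add2l leq_mul2r ltnW ?orbT.
have [h1 h2] := pt_loop_src he (pt_small hk) sacc.
apply: (pt_iter (acc := acc)) => //; first exact: (pt_zero ov be).
have b1 := base_wk (pt_small hk) be.
have b2 : base (fun y : Yk => g (projT1 y)) (@loop_src X e k acc).
  by split; apply: (pt_trans h1); [exact: base_n b1 | exact: base_m b1 | exact: base_L b1 |
    exact: base_T b1 | exact: base_arr b1 | exact: base_profit b1 | exact: base_plc b1].
exact: (pt_step ovk b2 h2).
Qed.
End Iterates.

Section Values.
Variables (X : prob) (g : X -> instance) (e : X -> data).
Hypotheses (ov : instance_of g) (be : base g e).

Local Notation n x := (nprod (mkt (g x))).
Local Notation m x := (ntype (mkt (g x))).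
Local Notation L x := (nware (mkt (g x))).
Local Notation T x := (nper (mkt (g x))).
Local Notation YK := (extp (fun x : X => 'I_(nsteps (mkt (g x))))).

(** Each summand recomputes its weights from the start, which costs only another polynomial
    factor. *)
Lemma pt_serve_rate (i : forall x, 'I_(n x)) (l : forall x, 'I_(L x)) (j : forall x, 'I_(m x)) :
  ptn e (fun x => nat_of_ord (i x)) -> ptn e (fun x => nat_of_ord (l x)) ->
  ptn e (fun x => nat_of_ord (j x)) ->
  ptq e (fun x => serve_rate (plc (g x)) (@best_set (g x)) (i x) (l x) (j x)).
Proof.
move=> hi hl hj; apply: ptq_div; last exact: pt_nsteps be.
apply: ptq_sum (pt_nsteps be) (polyb_nsteps ov) _.
have sK := pt_small (pt_nsteps be); have bK := base_wk sK be.
have ovK : instance_of (fun y : YK => g (projT1 y)) := instance_of_ext _ ov.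
have hk : ptn (@idx_src X e (fun x => nsteps (mkt (g x)))) (fun y : YK => nat_of_ord (projT2 y)) :=
  pt_ix (pt_src hi) sK.
have pk : polyb (fun y : YK => nat_of_ord (projT2 y)).
  by apply: polyb_le (polyb_ext _ (polyb_nsteps ov)) => y; exact: ltnW.
have ht := pt_theta ovK bK (pt_weight ovK bK hk pk).
exact: (pt_serve ovK bK (pt_stocked ovK bK) ht (pt_wk sK hj) (pt_wk sK hi) (pt_wk sK hl)).
Qed.
End Values.

Section Prices.
Variables (X : prob) (g : X -> instance) (e : X -> data).
Hypotheses (ov : instance_of g) (be : base g e).

Local Notation n x := (nprod (mkt (g x))).
Local Notation m x := (ntype (mkt (g x))).
Local Notation L x := (nware (mkt (g x))).
Local Notation T x := (nper (mkt (g x))).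
Local Notation Ym := (extp (fun x : X => 'I_(m x))).

Variables (i : forall x, 'I_(n x)) (l : forall x, 'I_(L x)) (t : X -> nat).
Hypotheses (hi : ptn e (fun x => nat_of_ord (i x))) (hl : ptn e (fun x => nat_of_ord (l x))).
Hypothesis ht : ptn e t.

Let sm := pt_small (base_m be).
Let bm := base_wk sm be.
Let ovm : instance_of (fun y : Ym => g (projT1 y)) := instance_of_ext _ ov.
Let hj := pt_ix (pt_src ht) sm.

Lemma pt_load_from_term : ptq (@idx_src X e (fun x => m x)) (fun y : Ym =>
  arr_from (projT2 y) (t (projT1 y)) * serve_rate (plc (g (projT1 y))) (@best_set (g (projT1 y)))
    (i (projT1 y)) (l (projT1 y)) (projT2 y)).
Proof.
apply: ptqM; first exact: (pt_arr_from ovm bm hj (pt_wk sm ht)).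
exact: (pt_serve_rate ovm bm (pt_wk sm hi) (pt_wk sm hl) hj).
Qed.

Lemma pt_load_from : ptq e (fun x => load_from (plc (g x)) (@best_set (g x)) (t x) (i x) (l x)).
Proof. exact: ptq_sum (base_m be) (polyb_m ov) pt_load_from_term. Qed.

Lemma pt_revenue_from : ptq e (fun x => revenue_from (plc (g x)) (@best_set (g x)) (t x) (i x) (l
  x)).
Proof.
apply: ptq_sum (base_m be) (polyb_m ov) _.
apply: ptqM; first exact: pt_load_from_term.
have h := pt_lookup (base_profit bm) (pt_wk sm hi).
exact: (pt_at (M := fun y : Ym => @profit (mkt (g (projT1 y))) (i (projT1 y))) h hj (pt_wk sm hl)).
Qed.

Variable x : forall y, placement (mkt (g y)).
Hypothesis hx : ptn e (fun y => x (i y) (l y)).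
Hypothesis xc : forall y, (x (i y) (l y) <= plc (g y) (i y) (l y))%N.

Lemma pt_plc : ptn e (fun y => plc (g y) (i y) (l y)).
Proof. exact: (pt_at (base_plc be) hi hl). Qed.

Lemma pt_value_fn (k : X -> nat) : ptn e k -> (forall y, (k y <= x (i y) (l y))%N) ->
  ptq e (fun y => value_fn (plc (g y)) (@best_set (g y)) (t y) (i y) (l y) (k y)).
Proof.
move=> hk kx; have hc := ptn_le (base_T be) pt_plc.
(* The program evaluates [erl] in both cases of [value_fn]. Where the stock may be exponential the
   recursion depth is set to 0 and the result discarded. *)
pose k' y := if (T y <= plc (g y) (i y) (l y))%N then 0%N else k y.
have hk' : ptn e k' := ptn_if hc (ptn_cst 0 (pt_src hi)) hk.
have pk' : polyb k'.
  apply: polyb_le (polyb_T ov) => y; rewrite /k'; case: (leqP (T y) (plc (g y) (i y) (l y))) =>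
    // h.
  by apply: leq_trans (kx y) _; apply: leq_trans (xc y) _; exact: ltnW.
have h := ptqM pt_revenue_from (pt_erl pt_load_from hk' pk').
by apply: pt_eq (ptq_if hc pt_revenue_from h) _ => y; rewrite /value_fn /k'; case: (T y <= _)%N.
Qed.
End Prices.

Section Greedy.
Variables (X : prob) (g : X -> instance) (e : X -> data).
Hypotheses (ov : instance_of g) (be : base g e).

Local Notation n x := (nprod (mkt (g x))).
Local Notation m x := (ntype (mkt (g x))).
Local Notation L x := (nware (mkt (g x))).
Local Notation T x := (nper (mkt (g x))).

Variables (j : forall y, 'I_(m y)) (t : X -> nat) (x : forall y, placement (mkt (g y))).
Hypotheses (hj : ptn e (fun y => nat_of_ord (j y))) (ht : ptn e t).
Hypothesis hx : pt e (fun y => enc_placement (@x y)).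
Hypothesis xc : forall y i l, (x i l <= plc (g y) i l)%N.

Let wk f := mx_wk (base_n be) (base_L be) (f := f).
Let ix1 := mx_ix1 (base_n be) (base_L be).
Let ix2 := mx_ix2 (base_n be) (base_L be).
Local Notation Y1 := (extp (fun x : X => 'I_(n x))).
Local Notation Y2 := (extp (fun y : Y1 => 'I_(L (projT1 y)))).

Let hxm : pt e (fun y => enc_mx (fun i l => (@x y i l)%:R)) := hx.
Let hxil := pt_at (wk hxm) ix1 ix2.

Lemma pt_instock : pt e (fun y => enc_mx (fun i l => (instock (@x y) i l)%:R)).
Proof.
apply: (pt_mx ov be).
apply: pt_eq (ptb_lt (pt_cst 0 (pt_src hxil)) hxil) _ => z.
by rewrite ltr0n.
Qed.

Lemma pt_price : pt e (fun y => enc_mx (price (plc (g y)) (@best_set (g y)) (t y) (@x y))).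
Proof.
apply: (pt_mx ov be).
have t1 : ptn e (fun y => (t y).+1).
  by apply: pt_eq (ptnD ht (ptn_cst 1 (pt_src ht))) _ => y; rewrite addn1.
have w := @pt_value_fn Y2 _ _ (instance_mx ov) (base_mx be) _ _ _ ix1 ix2 (wk t1)
  (fun z => @x (projT1 (projT1 z))) (fun z => @xc _ _ _).
apply: ptqB; first exact: w.
apply: w; last by move=> z; exact: leq_pred.
apply: pt_eq (ptnB (hxil : ptn _ _) (ptn_cst 1 (pt_src hxil))) _ => z.
by rewrite subn1.
Qed.

Lemma pt_greedy : pt e (fun y => enc_decision
  (greedy (plc (g y)) (@best_set (g y)) (t y) (@x y) (j y))).
Proof.
apply: pt_pair; first exact: (pt_sel ov be pt_instock pt_price hj).
apply: pt_eq (pt_best_ware ov be pt_instock pt_price hj) _ => y.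
by congr enc_fun; apply: funext => i; rewrite ffunE.
Qed.
End Greedy.

(** * Reading the state *)

(** Bundling the state with its instance makes one program serve all inputs; [st_size] bounds the
    history by the horizon. *)
Record state := State {
  st_inst : instance;
  st_time : 'I_(nper (mkt st_inst));
  st_hist : seq (event (mkt st_inst));
  st_type : 'I_(ntype (mkt st_inst));
  st_size : size st_hist = st_time }.

Definition states : prob :=
  @Prob state (fun s => orc (st_inst s)) (fun s => input_size (plc (st_inst s))).

(** The input of [act] at seed 0, the only seed of a deterministic policy. *)
Definition st_src (s : states) : data :=
  Node (enc_state (plc (st_inst s)) (st_time s) (st_hist s) (st_type s)) (enc_nat 0).

Lemma states_instance : @instance_of states st_inst.
Proof. by []. Qed.

Lemma dsize_opt k (x : option 'I_k) : (dsize (enc_opt x) <= k + 5)%N.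
Proof.
case: x => [i|]; last by apply: leq_trans dsize0 _; rewrite !addnS.
have h : dsize (enc_opt (Some i)) = (dsize (enc_nat i) + dsize (Leaf 0)).+1 by [].
have := nbits_le i; have := ltn_ord i; rewrite h dsize_nat.
by have := dsize0; move: (dsize _) => v; lia.
Qed.

Lemma dsize_set k (S : {set 'I_k}) : (dsize (enc_set S) <= k * 3 + 2)%N.
Proof.
rewrite dsize_enc_fun leq_add ?dsize0 //.
rewrite -[X in (_ <= X * _)%N]card_ord -sum_nat_const leq_sum // => i _.
by rewrite ltnS dsize_bool.
Qed.

Lemma dsize_event (I : market) (e : event I) :
  (dsize (enc_event e) <= ntype I + nprod I * (nware I + 10) + 20)%N.
Proof.
case: e => [[[j d] x]|]; last by apply: leq_trans dsize0 _; rewrite !addnS.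
have h : dsize (enc_event (Some (j, d, x))) = (dsize (enc_nat j) +
  ((dsize (enc_set d.1) + dsize (enc_fun (fun i => enc_opt (d.2 i)))).+1 + dsize (enc_opt
    x)).+1).+1 by [].
have h1 : (dsize (enc_nat j) <= ntype I + 1)%N.
  by rewrite dsize_nat leq_add2r (leq_trans (nbits_le _)).
have h2 := dsize_set d.1; have h3 := dsize_opt x.
have h4 : (dsize (enc_fun (fun i => enc_opt (d.2 i))) <= nprod I * (nware I + 6) + 2)%N.
  rewrite dsize_enc_fun leq_add ?dsize0 //.
  rewrite -[X in (_ <= X * _)%N]card_ord -sum_nat_const leq_sum // => i _.
  by rewrite addnS ltnS dsize_opt.
move: h1 h2 h3 h4; rewrite h.
move: (dsize _) (dsize _) (dsize _) (dsize _) => v1 v2 v3 v4; lia.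
Qed.

Lemma small_state : small st_src.
Proof.
have ov := states_instance.
have inst s : (dsize (enc_instance (plc (st_inst s))) <= input_size (plc (st_inst s)))%N.
  by rewrite /input_size -!addnA leq_addr.
have pI : @polyb states (fun s => input_size (plc (st_inst s))).
  exact: (@polyb_psz states).
apply: small_node; last exact: (@polyb_cst states _).
apply: small_node; first by apply: (polyb_le _ pI) => s; exact: inst.
apply: small_node.
  apply: polyb_le (polybD (polyb_T ov) (polyb_cst _ 1)) => s.
  by rewrite dsize_nat leq_add2r (leq_trans (nbits_le _)).
apply: small_node.
  apply: polyb_le (polybD (polyb_m ov) (polyb_cst _ 1)) => s.
  by rewrite dsize_nat leq_add2r (leq_trans (nbits_le _)).
apply: small_node.
  apply: (polyb_le _ pI) => s; apply: leq_trans (inst s).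
  apply: (@leq_trans (dsize (enc_placement (plc (st_inst s))))); last first.
    by rewrite /enc_instance /=; lia.
  rewrite !dsize_enc_fun leq_add2r leq_sum // => i _; rewrite ltnS.
  rewrite !dsize_enc_fun leq_add2r leq_sum // => l _; rewrite ltnS.
  by rewrite dsize_nat_le // leq_subr.
apply: small_node; last exact: (@polyb_cst states _).
pose B (s : states) := (ntype (mkt (st_inst s)) +
  nprod (mkt (st_inst s)) * (nware (mkt (st_inst s)) + 10) + 20)%N.
have pB : polyb B.
  by do ?[apply: polybD | apply: polybM | exact: polyb_m ov | exact: polyb_n ov |
    exact: polyb_L ov | exact: polyb_cst].
apply: polyb_le (polybD (polybM (polyb_T ov) (polybD pB (polyb_cst _ 1))) (polyb_cst _ 2)) => s.
rewrite dsize_enc_seq leq_add ?dsize0 // big_map.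
apply: (@leq_trans (\sum_(e <- st_hist s) (B s + 1))%N).
  by apply: leq_sum => e _; rewrite addn1 ltnS dsize_event.
by rewrite big_const_seq count_predT iter_addn_0 mulnC st_size leq_mul2r ltnW ?orbT.
Qed.

Lemma pt_state : [/\ @base states st_inst st_src, ptn st_src (fun s : states =>
  nat_of_ord (st_time s)),
  ptn st_src (fun s : states => nat_of_ord (st_type s)) &
  pt st_src (fun s : states => enc_placement (stock (plc (st_inst s)) (st_hist s)))].
Proof.
have h0 := pt_fst (pt_refl small_state); have h1 := pt_snd h0.
have h2 := pt_snd h1; have h3 := pt_snd h2.
have hi := pt_fst h0.
have i1 := pt_snd hi; have i2 := pt_snd i1; have i3 := pt_snd i2; have i4 := pt_snd i3.
have i5 := pt_snd i4; have i6 := pt_snd i5.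
split; [split|exact: (pt_fst h1)|exact: (pt_fst h2)|exact: (pt_fst h3)].
- exact: (pt_fst hi).
- exact: (pt_fst i1).
- exact: (pt_fst i2).
- exact: (pt_fst i3).
- exact: (pt_fst i4).
- exact: (pt_fst i5).
- exact: (pt_fst i6).
Qed.

Theorem theorem3p2 (R : realType) :
  exists (range act : cmd) (p : {poly nat}),
  forall (I : market) (c : placement I) (O : data -> data),
  valid_market I ->
  (exists i l, (0 < c i l)%N) ->
  choice_oracle I O ->
  exists pi : policy R I,
    [/\ admissible c pi,
        computes_policy c O range act p.[input_size c] pi &
        Num.max (322%:R / 1000%:R)
                (1 - (ntype I).+1%:R / Num.sqrt (cmin c)%:R) * J1star R c
          <= expected_profit pi].
Proof.
have [be ht hj hx] := pt_state.
have [_ _ [p [b [[d hb] hp]]]] := pt_greedy states_instance be hj ht hx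
  (fun s i l => leq_subr (count (served i l) (st_hist s)) (plc (st_inst s) i l)).
(* [range] returns 1 by a single assignment, and the 2 added to the polynomial pays for it. *)
exists (Assign 0 (Cst 1)), (p 0%N), (('X + 2%:P) ^+ d + 2%:P).
move=> I c O vI posc okO.
pose s0 := Instance c vI okO.
have Sel_opt := fun j r => (@best_setP s0 j r).2.
exists (greedy_policy R c (@best_set s0)); split.
- exact: greedy_admissible.
- move=> t h j hh; pose gd := greedy c (@best_set s0) t (stock c h) j.
  have bound : (('X + 2%:P) ^+ d + 2%:P : {poly nat}).[input_size c] = ((input_size c + 2) ^ d +
    2)%N.
    by rewrite hornerD horner_exp hornerD hornerX !hornerC.
  exists 1%N, (fun=> gd); split => //.
  + exists (eval_cost (update (fun=> Leaf 0) 0 (enc_state c t h j)) (Cst 1)),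
      (update (update (fun=> Leaf 0) 0 (enc_state c t h j)) 0 (Leaf 1)); split => //.
    * exact: ExecAssign.
    * by rewrite bound; apply: leq_trans (leq_addl _ _); rewrite /= addn0; exact: (dsize_bool true).
  + move=> u; rewrite (ord1 u).
    pose s1 := @State s0 t h j hh.
    have [|k [s' [h1 h2 h3 h4]]] := hp s1 0%N (update (fun=> Leaf 0) 0 (st_src s1)).
      by rewrite update_eq.
    exists k, s'; split => //.
    by rewrite bound; apply: leq_trans h2 _; apply: leq_trans (hb s1) (leq_addr _ _).
  (* With a single seed the count is 1 at the greedy decision and 0 elsewhere. *)
  + move=> d'; rewrite divr1 /greedy_policy -/gd.
    by case: (gd =P d') => [e|ne]; rewrite ?cardT ?size_enum_ord // eq_card0.
- exact: greedy_ratio.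
Qed.
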